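(* Let $F$ be a field of characteristic $2$. There is a unique isomorphism of $\mathbb{Z}$-graded rings $\mathrm{K}^W_*(F) \to \mathrm{I}^*(F)$ sending $[\![a]\!] \in \mathrm{K}^W_1(F)$ to the Pfister form $\langle\!\langle a\rangle\!\rangle \in \mathrm{I}^1(F)$ for every $a \in F^\times$.
   Context: Milnor-Witt K-theory: for a field $F$, $\mathrm{K}^{MW}_*(F)$ is the associative unital $\mathbb{Z}$-graded ring generated by symbols $[u]$ of degree $1$ for $u\in F^\times$ and a symbol $\eta$ of degree $-1$, subject to the relations: (1) $[a][1-a]=0$ for $a\in F^\times$, $a\neq 1$; (2) $[ab]=[a]+[b]+\eta[a][b]$ for $a,b\in F^\times$; (3) $\eta[u]=[u]\eta$ for $u\in F^\times$; (4) $\eta h=0$, where $h := \eta[-1]+2$. Witt K-theory: $\mathrm{K}^W_*(F) := \mathrm{K}^{MW}_*(F)/(h)$, a $\mathbb{Z}$-graded ring. The class of $[a]$ in $\mathrm{K}^W_1(F)$ is denoted $[\![a]\!]$. Witt ring: $\mathrm{GW}(F)$ is the group completion of the monoid (under orthogonal sum) of isomorphism classes of symmetric inner product spaces over $F$ (finite-dimensional vector spaces with a nondegenerate symmetric bilinear form), with ring structure given by tensor product. For $u\in F^\times$, $\langle u\rangle$ denotes the one-dimensional space with a basis vector $e$ such that $(e\mid e)=u$ (or its class). $\mathrm{W}(F) := \mathrm{GW}(F)/(1+\langle -1\rangle)$ is the Witt ring of symmetric bilinear forms, and $\mathrm{I}(F)\subset \mathrm{W}(F)$ is the fundamental ideal,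 i.e. the kernel of the rank modulo $2$ map $\mathrm{W}(F)\to\mathbb{Z}/2\mathbb{Z}$. For $a\in F^\times$, $\langle\!\langle a\rangle\!\rangle := 1+\langle -a\rangle = 1-\langle a\rangle\in \mathrm{I}(F)$. For $n>0$, $\mathrm{I}^n(F)$ is the $n$-th power of the ideal $\mathrm{I}(F)$; for $n\le 0$, $\mathrm{I}^n(F):=\mathrm{W}(F)$. Then $\mathrm{I}^*(F):=\bigoplus_{n\in\mathbb{Z}}\mathrm{I}^n(F)$ is a $\mathbb{Z}$-graded ring with multiplication $\mathrm{I}^m(F)\times \mathrm{I}^n(F)\to \mathrm{I}^{m+n}(F)$ induced by multiplication in $\mathrm{W}(F)$.
   Formalization: Uniqueness as stated fails (e.g. F = F_2(t): scale degree −n by <t>^n). Proved: exactly one graded ring isomorphism sends [[a]] to <<a>> for all a and η to −1 in I^{-1}(F) = W(F); without the condition on η, any two such isomorphisms agree in positive degrees. *)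

(* Defs.v *)
From HB Require Import structures.
From mathcomp Require Import all_boot all_order all_algebra.
From mathcomp Require Import finmap boolp.
From mathcomp.multinomials Require Import monalg.
From mathcomp.real_closed Require Import mxtens.
From mathcomp Require Import ring zify.

Set Implicit Arguments.
Unset Strict Implicit.
Unset Printing Implicit Defensive.

Import GRing.Theory VectorInternalTheory.
Local Open Scope ring_scope.
Local Open Scope quotient_scope.

(* The space F^n with a nondegenerate symmetric bilinear form, given by its
   Gram matrix (see ipform, ipform_sym, ipform_nondeg); by ipspace_coord below,
   every symmetric inner product space is isometric to such a space. *)
Record ipspace (F : fieldType) := IPSpace {
  ipspace_data :> {n : nat & 'M[F]_n};
  _ : ((tagged ipspace_data)^T == tagged ipspace_data)
      && (tagged ipspace_data \in unitmx) }.

HB.instance Definition _ (F : fieldType) := [isSub for @ipspace_data F].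
HB.instance Definition _ (F : fieldType) := [Choice of ipspace F by <:].

Section InnerProductSpaces.
Variable F : fieldType.
Implicit Types A B C D : ipspace F.

Definition ipdim A : nat := tag (ipspace_data A).
Definition gram A : 'M[F]_(ipdim A) := tagged (ipspace_data A).
Definition ipform A (u v : 'rV[F]_(ipdim A)) : F := (u *m gram A *m v^T) 0 0.

Lemma gram_sym A : (gram A)^T = gram A.
Proof. by case: A => -[n M] p; have /andP[/eqP h _] := p. Qed.

Lemma gram_unit A : gram A \in unitmx.
Proof. by case: A => -[n M] p; have /andP[_ h] := p. Qed.

Definition mkipspace n (M : 'M[F]_n) (s : M^T = M) (u : M \in unitmx) :
  ipspace F := @IPSpace F (Tagged (fun n => 'M[F]_n) M) (introT andP (conj (introT eqP s) u)).

Lemma ipform_sym A (u v : 'rV_(ipdim A)) : ipform u v = ipform v u.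
Proof.
rewrite /ipform -{1}(trmxK (u *m gram A *m v^T)) [LHS]mxE.
by rewrite !trmx_mul gram_sym trmxK mulmxA.
Qed.

Lemma ipform_nondeg A (u : 'rV_(ipdim A)) :
  (forall v : 'rV_(ipdim A), ipform u v = 0) -> u = 0.
Proof.
move=> h; apply: (can_inj (mulmxK (gram_unit A))); rewrite mul0mx.
by apply/rowP=> i; have := h (delta_mx 0 i); rewrite /ipform trmx_delta -colE !mxE.
Qed.

Definition isometric A B : Prop :=
  exists2 P : 'M[F]_(ipdim A, ipdim B),
    bijective (fun u : 'rV_(ipdim A) => u *m P)
  & forall u v : 'rV_(ipdim A), ipform (u *m P) (v *m P) = ipform u v.

Lemma isometricP A B :
  isometric A B <->
  exists P Q, [/\ P *m Q = 1%:M, Q *m P = 1%:M & P *m gram B *m P^T = gram A].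
Proof.
split=> [[P [g gK Kg] h]|[P [Q [PQ QP e]]]]; last first.
  exists P; first by exists (fun u => u *m Q) => u;
    rewrite -mulmxA ?PQ ?QP mulmx1.
  by move=> u v; rewrite /ipform trmx_mul !mulmxA -e !mulmxA.
have e : P *m gram B *m P^T = gram A.
  apply/matrixP => i j; have := h (delta_mx 0 i) (delta_mx 0 j).
  rewrite /ipform trmx_mul trmx_delta.
  have E (M : 'M[F]_(ipdim A)) : ('e_i *m M *m delta_mx j 0 : 'M[F]_1) 0 0 = M i j.
    by rewrite -rowE -colE !mxE.
  by rewrite !mulmxA -(mulmxA _ P) -(mulmxA _ (P *m _)) !E.
pose Q := \matrix_i g (delta_mx 0 i).
have QP : Q *m P = 1%:M.
  by apply/row_matrixP => i; rewrite row_mul rowK Kg row1.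
exists P, Q; split=> //; apply/row_matrixP => i.
by apply: (can_inj gK); rewrite row_mul row1 -!mulmxA QP mulmx1 rowE.
Qed.

Lemma isometric_bij A B (s : 'I_(ipdim A) -> 'I_(ipdim B)) : bijective s ->
  (forall i j, gram A i j = gram B (s i) (s j)) -> isometric A B.
Proof.
move=> [t sK tK] e; apply/isometricP.
exists (\matrix_(i, j) (s i == j)%:R), (\matrix_(i, j) (t i == j)%:R).
have sum1 (n : nat) (i : 'I_n) (G : 'I_n -> F) :
    \sum_j (i == j)%:R * G j = G i.
  rewrite (bigD1 i) //= eqxx mul1r big1 ?addr0 // => j /negPf.
  by rewrite eq_sym => ->; rewrite mul0r.
split; apply/matrixP => i j; rewrite !mxE.
- by under eq_bigr do rewrite !mxE; rewrite sum1 sK.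
- by under eq_bigr do rewrite !mxE; rewrite sum1 tK.
rewrite e; under eq_bigr => k _.
  rewrite !mxE mulrC; under eq_bigr do rewrite !mxE.
  rewrite sum1; over.
by rewrite /= sum1.
Qed.

Lemma isometric_refl A : isometric A A.
Proof. by apply: (@isometric_bij A A id); first exists id. Qed.

Lemma isometric_sym A B : isometric A B -> isometric B A.
Proof.
move/isometricP=> [P [Q [PQ QP e]]]; apply/isometricP; exists Q, P; split=> //.
by rewrite -e -[RHS]mul1mx -[RHS]mulmx1 -{2}trmx1 -QP trmx_mul !mulmxA.
Qed.

Lemma isometric_trans B A C : isometric A B -> isometric B C -> isometric A C.
Proof.
move=> [P bP hP] [Q bQ hQ]; exists (P *m Q).
  by apply: (eq_bij (bij_comp bQ bP)) => u /=; rewrite mulmxA.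
by move=> u v; rewrite !mulmxA hQ hP.
Qed.

Lemma tens1mx m n : (1%:M : 'M[F]_m) *t (1%:M : 'M[F]_n) = 1%:M.
Proof.
apply/matrixP => x y; case: (mxtens_indexP x) => i j; case: (mxtens_indexP y) => k l.
rewrite tensmxE !mxE (can_eq (@mxtens_indexK m n)) xpair_eqE.
by case: eqP => _; rewrite ?mul1r ?mul0r.
Qed.

Lemma ipsum_subproof1 A B :
  (block_mx (gram A) 0 0 (gram B))^T = block_mx (gram A) 0 0 (gram B).
Proof. by rewrite tr_block_mx !gram_sym !trmx0. Qed.
Lemma ipsum_subproof2 A B : block_mx (gram A) 0 0 (gram B) \in unitmx.
Proof. by rewrite unitmxE det_ublock unitrM -!unitmxE !gram_unit. Qed.
Definition ipsum A B : ipspace F :=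
  mkipspace (ipsum_subproof1 A B) (ipsum_subproof2 A B).

Lemma iptens_subproof1 A B : (gram A *t gram B)^T = gram A *t gram B.
Proof. by rewrite trmx_tens !gram_sym. Qed.
Lemma iptens_subproof2 A B : gram A *t gram B \in unitmx.
Proof.
rewrite -row_full_unit; apply/row_fullP; exists (invmx (gram A) *t invmx (gram B)).
by rewrite tensmx_mul !mulVmx ?gram_unit // tens1mx.
Qed.
(* The Gram matrix of the form determined on F^m (x) F^n, in the basis of the
   e_i (x) e_j, by (u (x) v | u' (x) v') = (u | u') (v | v'). *)
Definition iptens A B : ipspace F :=
  mkipspace (iptens_subproof1 A B) (iptens_subproof2 A B).

Lemma ipzero_subproof : (1%:M : 'M[F]_0)^T = 1%:M. Proof. exact: trmx1. Qed.
Definition ipzero : ipspace F := mkipspace ipzero_subproof (unitmx1 F 0).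

Lemma ipline_subproof1 (u : F) : (u%:M : 'M[F]_1)^T = u%:M.
Proof. exact: tr_scalar_mx. Qed.
Lemma ipline_subproof2 (u : F) : u != 0 -> (u%:M : 'M[F]_1) \in unitmx.
Proof. by move=> u0; rewrite unitmxE det_scalar1 unitfE. Qed.
Definition ipline (u : F) (u0 : u != 0) : ipspace F :=
  mkipspace (ipline_subproof1 u) (ipline_subproof2 u0).
Definition ipone : ipspace F := ipline (oner_neq0 F).

Lemma isometric_sum A B C D :
  isometric A B -> isometric C D -> isometric (ipsum A C) (ipsum B D).
Proof.
move/isometricP=> [P [Q [PQ QP e]]] /isometricP [P' [Q' [PQ' QP' e']]].
apply/isometricP; exists (block_mx P 0 0 P'), (block_mx Q 0 0 Q').
split; rewrite ?[gram (ipsum _ _)]/= ?tr_block_mx !mulmx_block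
  ?trmx0 ?mul0mx ?mulmx0 ?add0r ?addr0 ?mul0mx ?mulmx0 ?add0r ?addr0.
- by rewrite PQ PQ' -scalar_mx_block.
- by rewrite QP QP' -scalar_mx_block.
by rewrite e e'.
Qed.

Lemma isometric_tens A B C D :
  isometric A B -> isometric C D -> isometric (iptens A C) (iptens B D).
Proof.
move/isometricP=> [P [Q [PQ QP e]]] /isometricP [P' [Q' [PQ' QP' e']]].
apply/isometricP; exists (P *t P'), (Q *t Q').
split; first by rewrite tensmx_mul PQ PQ' tens1mx.
  by rewrite tensmx_mul QP QP' tens1mx.
by rewrite trmx_tens /= !tensmx_mul e e'.
Qed.

Local Arguments unsplit : simpl never.

Lemma gram_sum A B (x y : 'I_(ipdim A) + 'I_(ipdim B)) :
  gram (ipsum A B) (unsplit x) (unsplit y) =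
  match x, y with
  | inl i, inl j => gram A i j | inr i, inr j => gram B i j | _, _ => 0 end.
Proof.
rewrite [gram (ipsum A B)]/=; case: x => i; case: y => j /=.
- exact: block_mxEul.
- by rewrite block_mxEur mxE.
- by rewrite block_mxEdl mxE.
- exact: block_mxEdr.
Qed.

Lemma gram_tens A B i j k l :
  gram (iptens A B) (mxtens_index (i, j)) (mxtens_index (k, l)) =
  gram A i k * gram B j l.
Proof. exact: tensmxE. Qed.

Lemma isometric_gen A B (I : Type) (f : I -> 'I_(ipdim A)) (g : I -> 'I_(ipdim B)) :
  bijective f -> bijective g ->
  (forall i j, gram A (f i) (f j) = gram B (g i) (g j)) -> isometric A B.
Proof.
move=> [f' fK f'K] bg e; apply: (@isometric_bij A B (g \o f')).
  by apply: bij_comp bg _; exists f.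
by move=> i j /=; rewrite -e !f'K.
Qed.

Lemma bij_unsplit m n : bijective (@unsplit m n).
Proof. by exists (@split m n); [exact: unsplitK | exact: splitK]. Qed.

Lemma bij_tens m n : bijective (@mxtens_index m n).
Proof. by exists (@mxtens_unindex m n); [exact: mxtens_indexK | exact: mxtens_unindexK]. Qed.

Lemma bij_suml (I J K : Type) (f : I -> J) : bijective f ->
  bijective (fun x : I + K => match x with inl i => inl (f i) | inr k => inr k end).
Proof.
move=> [g fK gK].
exists (fun x : J + K => match x with inl i => inl (g i) | inr k => inr k end);
  by case=> // i; rewrite ?fK ?gK.
Qed.
Lemma bij_sumr (I J K : Type) (f : I -> J) : bijective f ->
  bijective (fun x : K + I => match x with inr i => inr (f i) | inl k => inl k end).
Proof.
move=> [g fK gK].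
exists (fun x : K + J => match x with inr i => inr (g i) | inl k => inl k end);
  by case=> // i; rewrite ?fK ?gK.
Qed.
Lemma bij_prodl (I J K : Type) (f : I -> J) : bijective f ->
  bijective (fun x : I * K => (f x.1, x.2)).
Proof. by move=> [g fK gK]; exists (fun x : J * K => (g x.1, x.2)) => -[i k] /=; rewrite ?fK ?gK. Qed.
Lemma bij_prodr (I J K : Type) (f : I -> J) : bijective f ->
  bijective (fun x : K * I => (x.1, f x.2)).
Proof. by move=> [g fK gK]; exists (fun x : K * J => (x.1, g x.2)) => -[i k] /=; rewrite ?fK ?gK. Qed.

Let of_I0 (T : Type) (i : 'I_0) : T := let: Ordinal _ h := i in match notF h with end.

Lemma ipsumA A B C : isometric (ipsum A (ipsum B C)) (ipsum (ipsum A B) C).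
Proof.
pose r (x : 'I_(ipdim A) + ('I_(ipdim B) + 'I_(ipdim C))) :
    ('I_(ipdim A) + 'I_(ipdim B)) + 'I_(ipdim C) :=
  match x with inl i => inl (inl i) | inr (inl i) => inl (inr i) | inr (inr i) => inr i end.
have br : bijective r.
  exists (fun x => match x with inl (inl i) => inl i | inl (inr i) => inr (inl i)
     | inr i => inr (inr i) end); first by case=> [|[]].
  by case=> [[]|].
have b1 := bij_comp (bij_unsplit (ipdim A) _) (bij_sumr 'I_(ipdim A) (bij_unsplit (ipdim B) (ipdim C))).
have b2 := bij_comp (bij_comp (bij_unsplit _ (ipdim C)) (bij_suml 'I_(ipdim C) (bij_unsplit (ipdim A) (ipdim B)))) br.
apply: (@isometric_gen (ipsum A (ipsum B C)) (ipsum (ipsum A B) C) _ _ _ b1 b2).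
by case=> [i|[i|i]] [j|[j|j]]; rewrite /= !gram_sum ?gram_sum.
Qed.

Lemma ipsumC A B : isometric (ipsum A B) (ipsum B A).
Proof.
pose r (x : 'I_(ipdim A) + 'I_(ipdim B)) : 'I_(ipdim B) + 'I_(ipdim A) :=
  match x with inl i => inr i | inr i => inl i end.
have br : bijective r.
  by exists (fun x => match x with inl i => inr i | inr i => inl i end); case.
apply: (@isometric_gen (ipsum A B) (ipsum B A) _ _ _ (bij_unsplit _ _) (bij_comp (bij_unsplit _ _) br)).
by case=> i [] j; rewrite /= !gram_sum.
Qed.

Lemma ipsum0 A : isometric (ipsum ipzero A) A.
Proof.
pose f (x : 'I_(ipdim A)) : 'I_0 + 'I_(ipdim A) := inr x.
have bf : bijective f.
  by exists (fun x => match x with inl i => of_I0 _ i | inr i => i end) => [//|[[]|]].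
have bid : bijective (@id 'I_(ipdim A)) by exists id.
apply: (@isometric_gen (ipsum ipzero A) A _ _ _ (bij_comp (bij_unsplit _ _) bf) bid).
by move=> i j; rewrite /= gram_sum.
Qed.

Lemma iptensA A B C : isometric (iptens A (iptens B C)) (iptens (iptens A B) C).
Proof.
pose r (x : 'I_(ipdim A) * ('I_(ipdim B) * 'I_(ipdim C))) := ((x.1, x.2.1), x.2.2).
have br : bijective r by exists (fun x => (x.1.1, (x.1.2, x.2))) => [[? []]|[[]]].
have b1 := bij_comp (bij_tens (ipdim A) _) (bij_prodr 'I_(ipdim A) (bij_tens (ipdim B) (ipdim C))).
have b2 := bij_comp (bij_comp (bij_tens _ (ipdim C)) (bij_prodl 'I_(ipdim C) (bij_tens (ipdim A) (ipdim B)))) br.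
apply: (@isometric_gen (iptens A (iptens B C)) (iptens (iptens A B) C) _ _ _ b1 b2) => -[i [j k]] [i' [j' k']].
by rewrite /comp [fst _]/= [snd _]/= !gram_tens mulrA.
Qed.

Lemma iptensC A B : isometric (iptens A B) (iptens B A).
Proof.
pose r (x : 'I_(ipdim A) * 'I_(ipdim B)) := (x.2, x.1).
have br : bijective r by exists (fun x => (x.2, x.1)) => -[].
apply: (@isometric_gen (iptens A B) (iptens B A) _ _ _ (bij_tens _ _) (bij_comp (bij_tens _ _) br)).
by move=> [i j] [k l]; rewrite /comp /r !gram_tens mulrC.
Qed.

Lemma iptens1 A : isometric (iptens ipone A) A.
Proof.
pose f (x : 'I_(ipdim A)) : 'I_1 * 'I_(ipdim A) := (ord0, x).
have bf : bijective f by exists snd => [//|[i j]]; rewrite /f /= (ord1 i).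
have bid : bijective (@id 'I_(ipdim A)) by exists id.
apply: (@isometric_gen (iptens ipone A) A _ _ _ (bij_comp (bij_tens _ _) bf) bid).
by move=> i j; rewrite /comp /f gram_tens !mxE eqxx mulr1n mul1r.
Qed.

Lemma iptens0 A : isometric (iptens ipzero A) ipzero.
Proof.
pose f (x : 'I_0) : 'I_0 * 'I_(ipdim A) := of_I0 _ x.
have bf : bijective f by exists fst => [[]|[[]]].
have bid : bijective (@id 'I_0) by exists id.
by apply: (@isometric_gen (iptens ipzero A) ipzero _ _ _ (bij_comp (bij_tens _ _) bf) bid) => -[].
Qed.

Lemma iptensDl A B C :
  isometric (iptens (ipsum A B) C) (ipsum (iptens A C) (iptens B C)).
Proof.
pose r (x : ('I_(ipdim A) + 'I_(ipdim B)) * 'I_(ipdim C)) :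
    'I_(ipdim A) * 'I_(ipdim C) + 'I_(ipdim B) * 'I_(ipdim C) :=
  match x.1 with inl i => inl (i, x.2) | inr i => inr (i, x.2) end.
have br : bijective r.
  exists (fun x => match x with inl y => (inl y.1, y.2) | inr y => (inr y.1, y.2) end).
    by case=> -[].
  by case=> -[].
have b1 := bij_comp (bij_tens _ _) (bij_prodl 'I_(ipdim C) (bij_unsplit (ipdim A) (ipdim B))).
have b2 := bij_comp (bij_comp (bij_unsplit _ _)
  (bij_comp (bij_suml _ (bij_tens (ipdim A) (ipdim C)))
            (bij_sumr _ (bij_tens (ipdim B) (ipdim C))))) br.
apply: (@isometric_gen (iptens (ipsum A B) C) (ipsum (iptens A C) (iptens B C)) _ _ _ b1 b2) => -[[i|i] k] [[j|j] l]; rewrite /comp /r ![fst _]/= ![snd _]/=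
 gram_tens gram_sum [RHS]gram_sum ?gram_tens ?mul0r //.
Qed.
End InnerProductSpaces.

Lemma ipspace_coord (F : fieldType) (V : vectType F) (b : V -> V -> F)
    (bl : forall w a u v, b w (a *: u + v) = a * b w u + b w v)
    (bs : forall u v, b u v = b v u)
    (bn : forall u, (forall v, b u v = 0) -> u = 0) :
  exists (A : ipspace F) (f : 'rV[F]_(ipdim A) -> V),
    [/\ linear f, bijective f
      & forall u v : 'rV_(ipdim A), b (f u) (f v) = ipform u v].
Proof.
pose e i : V := r2v (delta_mx 0 i).
pose G := \matrix_(i, j) b (e i) (e j).
have b0 w : b w 0 = 0.
  by have := bl w (- 1) 0 0; rewrite scaler0 addr0 mulN1r addNr.
have bE u v : b (r2v u) (r2v v) = (u *m G *m v^T) 0 0.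
  have bsum w (x : 'rV_(dim V)) : b w (r2v x) = \sum_j x 0 j * b w (e j).
    rewrite {1}[x]row_sum_delta linear_sum /=.
    elim/big_rec2: _ => [|j y z _ <-]; first exact: b0.
    by rewrite linearZ bl.
  rewrite bsum !mxE; apply: eq_bigr => j _; rewrite bs bsum !mxE mulrC.
  by congr (_ * _); apply: eq_bigr => i _; rewrite mxE bs.
have Gs : G^T = G by apply/matrixP => i j; rewrite !mxE bs.
have Gu : G \in unitmx.
  rewrite -row_free_unit; apply: inj_row_free => u uG.
  apply: (can_inj r2vK); rewrite linear0; apply: bn => v.
  by rewrite -[v]v2rK bE uG mul0mx mxE.
have rb : bijective (r2v : 'rV[F]_(dim V) -> V).
  exact: (Bijective (@r2vK _ _) (@v2rK _ _)).
exists (mkipspace Gs Gu), r2v; split; [by move=> a u v; rewrite linearP | exact: rb | exact: bE].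
Qed.

Section IsometryClasses.
Variable F : fieldType.
Implicit Types A B C D : ipspace F.

Definition isorel A B : bool := `[< isometric A B >].

Lemma isorel_refl : reflexive isorel.
Proof. by move=> A; apply/asboolP/isometric_refl. Qed.
Lemma isorel_sym : symmetric isorel.
Proof. by move=> A B; apply/asboolP/asboolP; exact: isometric_sym. Qed.
Lemma isorel_trans : transitive isorel.
Proof.
by move=> B A C /asboolP h /asboolP k; apply/asboolP/(isometric_trans h k).
Qed.
Canonical isorel_equiv := EquivRel isorel isorel_refl isorel_sym isorel_trans.

Definition isoclass := {eq_quot isorel_equiv}.
HB.instance Definition _ := Choice.on isoclass.
HB.instance Definition _ := EqQuotient.on isoclass.

Definition cls A : isoclass := \pi_isoclass A.

Lemma clsP A B : cls A = cls B <-> isometric A B.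
Proof.
split=> [/eqP|h]; first by rewrite /cls eqmodE => /asboolP.
by apply/eqP; rewrite /cls eqmodE; apply/asboolP.
Qed.

Lemma clsW (P : isoclass -> Prop) : (forall A, P (cls A)) -> forall x, P x.
Proof. by move=> h x; rewrite -[x]reprK; exact: h. Qed.

Lemma repr_cls A : isometric (repr (cls A)) A.
Proof. by apply/clsP; rewrite /cls reprK. Qed.

Definition isoadd (x y : isoclass) := cls (ipsum (repr x) (repr y)).
Definition isomul (x y : isoclass) := cls (iptens (repr x) (repr y)).

Lemma isoaddE A B : isoadd (cls A) (cls B) = cls (ipsum A B).
Proof. by apply/clsP/isometric_sum; exact: repr_cls. Qed.
Lemma isomulE A B : isomul (cls A) (cls B) = cls (iptens A B).
Proof. by apply/clsP/isometric_tens; exact: repr_cls. Qed.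

Lemma isoaddA : associative isoadd.
Proof.
elim/clsW=> A; elim/clsW=> B; elim/clsW=> C; rewrite !isoaddE.
exact/clsP/ipsumA.
Qed.
Lemma isoaddC : commutative isoadd.
Proof. by elim/clsW=> A; elim/clsW=> B; rewrite !isoaddE; apply/clsP/ipsumC. Qed.
Lemma isoadd0 : left_id (cls (ipzero F)) isoadd.
Proof. by elim/clsW=> A; rewrite !isoaddE; apply/clsP/ipsum0. Qed.
Lemma isomulA : associative isomul.
Proof.
elim/clsW=> A; elim/clsW=> B; elim/clsW=> C; rewrite !isomulE.
exact/clsP/iptensA.
Qed.
Lemma isomulC : commutative isomul.
Proof. by elim/clsW=> A; elim/clsW=> B; rewrite !isomulE; apply/clsP/iptensC. Qed.
Lemma isomul1 : left_id (cls (ipone F)) isomul.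
Proof. by elim/clsW=> A; rewrite !isomulE; apply/clsP/iptens1. Qed.
Lemma isomul0 : left_zero (cls (ipzero F)) isomul.
Proof. by elim/clsW=> A; rewrite !isomulE; apply/clsP/iptens0. Qed.
Lemma isomulDl : left_distributive isomul isoadd.
Proof.
elim/clsW=> A; elim/clsW=> B; elim/clsW=> C; rewrite !(isomulE, isoaddE).
exact/clsP/iptensDl.
Qed.

HB.instance Definition _ :=
  GRing.isNmodule.Build isoclass isoaddA isoaddC isoadd0.
HB.instance Definition _ := GRing.Nmodule_isPzSemiRing.Build isoclass
  isomulA isomul1 (fun x => etrans (isomulC _ _) (isomul1 x))
  isomulDl (fun x y z => etrans (isomulC _ _)
    (etrans (isomulDl _ _ _) (congr2 isoadd (isomulC _ _) (isomulC _ _))))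
  isomul0 (fun x => etrans (isomulC _ _) (isomul0 x)).
HB.instance Definition _ :=
  GRing.PzSemiRing_hasCommutativeMul.Build isoclass isomulC.

Lemma clsD A B : cls A + cls B = cls (ipsum A B). Proof. exact: isoaddE. Qed.
Lemma clsM A B : cls A * cls B = cls (iptens A B). Proof. exact: isomulE. Qed.
Lemma cls0 : cls (ipzero F) = 0. Proof. by []. Qed.
Lemma cls1 : cls (ipone F) = 1. Proof. by []. Qed.
End IsometryClasses.

Section Grothendieck.
Variable S : comPzSemiRingType.

(* groth S is the group completion of (S, +); (x, y) stands for x - y. *)
Definition groth_rel (p q : S * S) : bool :=
  `[< exists k, p.1 + q.2 + k = q.1 + p.2 + k >].

Lemma groth_refl : reflexive groth_rel.
Proof. by move=> p; apply/asboolP; exists 0. Qed.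
Lemma groth_sym : symmetric groth_rel.
Proof. by move=> p q; apply/asboolP/asboolP=> -[k h]; exists k. Qed.
Lemma groth_trans : transitive groth_rel.
Proof.
move=> q p r /asboolP[k h] /asboolP[l h']; apply/asboolP.
exists (q.1 + q.2 + k + l).
transitivity ((p.1 + q.2 + k) + (q.1 + r.2 + l)); first by ring.
by rewrite h h'; ring.
Qed.
Canonical groth_equiv := EquivRel groth_rel groth_refl groth_sym groth_trans.

Definition groth := {eq_quot groth_equiv}.
HB.instance Definition _ := Choice.on groth.
HB.instance Definition _ := EqQuotient.on groth.

Definition gsub (x y : S) : groth := \pi_groth (x, y).

Lemma gsubP x y z t : gsub x y = gsub z t <-> exists k, x + t + k = z + y + k.
Proof.
split=> [/eqP|h]; first by rewrite /gsub eqmodE => /asboolP.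
by apply/eqP; rewrite /gsub eqmodE; apply/asboolP.
Qed.

Lemma gsubW (P : groth -> Prop) : (forall x y, P (gsub x y)) -> forall z, P z.
Proof. by move=> h z; rewrite -[z]reprK; case: (repr z) => x y; exact: h. Qed.

Lemma repr_gsub x y :
  exists k, (repr (gsub x y)).1 + y + k = x + (repr (gsub x y)).2 + k.
Proof.
by apply/gsubP; rewrite /gsub -surjective_pairing reprK.
Qed.

Definition groth_add (u v : groth) : groth :=
  gsub ((repr u).1 + (repr v).1) ((repr u).2 + (repr v).2).
Definition groth_opp (u : groth) : groth := gsub (repr u).2 (repr u).1.
Definition groth_mul (u v : groth) : groth :=
  gsub ((repr u).1 * (repr v).1 + (repr u).2 * (repr v).2)
       ((repr u).1 * (repr v).2 + (repr u).2 * (repr v).1).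

Lemma groth_addE x y z t :
  groth_add (gsub x y) (gsub z t) = gsub (x + z) (y + t).
Proof.
apply/gsubP; have [k h] := repr_gsub x y; have [l h'] := repr_gsub z t.
set p := repr _ in h *; set q := repr _ in h' *.
exists (k + l); transitivity ((p.1 + y + k) + (q.1 + t + l)); first by ring.
by rewrite h h'; ring.
Qed.

Lemma groth_oppE x y : groth_opp (gsub x y) = gsub y x.
Proof.
apply/gsubP; have [k h] := repr_gsub x y; exists k.
by rewrite [_ + x]addrC -h; ring.
Qed.

Lemma groth_mulE x y z t :
  groth_mul (gsub x y) (gsub z t) = gsub (x * z + y * t) (x * t + y * z).
Proof.
have [k h] := repr_gsub x y; have [l h'] := repr_gsub z t.
rewrite /groth_mul; set p := repr _ in h *; set q := repr _ in h' *.
transitivity (gsub (p.1 * z + p.2 * t) (p.1 * t + p.2 * z)); apply/gsubP.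
  exists (p.1 * l + p.2 * l).
  transitivity (p.1 * (q.1 + t + l) + p.2 * (z + q.2 + l)); first by ring.
  by rewrite h' -[in X in p.2 * X]h'; ring.
exists (k * z + k * t).
transitivity ((p.1 + y + k) * z + (x + p.2 + k) * t); first by ring.
by rewrite h -[in X in _ + X * t]h; ring.
Qed.

Lemma groth_addA : associative groth_add.
Proof.
elim/gsubW=> a b; elim/gsubW=> c d; elim/gsubW=> e f.
by rewrite !groth_addE !addrA.
Qed.
Lemma groth_addC : commutative groth_add.
Proof.
by elim/gsubW=> a b; elim/gsubW=> c d; rewrite !groth_addE [c + _]addrC [d + _]addrC.
Qed.
Lemma groth_add0 : left_id (gsub 0 0) groth_add.
Proof. by elim/gsubW=> a b; rewrite groth_addE !add0r. Qed.
Lemma groth_addN : left_inverse (gsub 0 0) groth_opp groth_add.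
Proof.
elim/gsubW=> a b; rewrite groth_oppE groth_addE; apply/gsubP; exists 0; ring.
Qed.
HB.instance Definition _ :=
  GRing.isZmodule.Build groth groth_addA groth_addC groth_add0 groth_addN.

Lemma groth_mulA : associative groth_mul.
Proof.
elim/gsubW=> a b; elim/gsubW=> c d; elim/gsubW=> e f.
by rewrite !groth_mulE; congr gsub; ring.
Qed.
Lemma groth_mulC : commutative groth_mul.
Proof.
by elim/gsubW=> a b; elim/gsubW=> c d; rewrite !groth_mulE; congr gsub; ring.
Qed.
Lemma groth_mul1 : left_id (gsub 1 0) groth_mul.
Proof. by elim/gsubW=> a b; rewrite groth_mulE; congr gsub; ring. Qed.
Lemma groth_mulDl : left_distributive groth_mul +%R.
Proof.
elim/gsubW=> a b; elim/gsubW=> c d; elim/gsubW=> e f.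
rewrite /GRing.add /=.
by rewrite !(groth_mulE, groth_addE); congr gsub; ring.
Qed.
HB.instance Definition _ := GRing.Zmodule_isPzRing.Build groth
  groth_mulA groth_mul1 (fun x => etrans (groth_mulC _ _) (groth_mul1 x))
  groth_mulDl (fun x y z => etrans (groth_mulC _ _)
    (etrans (groth_mulDl _ _ _) (congr2 +%R (groth_mulC _ _) (groth_mulC _ _)))).
HB.instance Definition _ :=
  GRing.PzRing_hasCommutativeMul.Build groth groth_mulC.

Lemma gsubD x y z t : gsub x y + gsub z t = gsub (x + z) (y + t).
Proof. exact: groth_addE. Qed.
Lemma gsubN x y : - gsub x y = gsub y x.
Proof. exact: groth_oppE. Qed.
Lemma gsubM x y z t : gsub x y * gsub z t = gsub (x * z + y * t) (x * t + y * z).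
Proof. exact: groth_mulE. Qed.
Lemma gsub0 : gsub 0 0 = 0. Proof. by []. Qed.
Lemma gsub1 : gsub 1 0 = 1. Proof. by []. Qed.
End Grothendieck.

Section IdealQuotient.
Variables (R : pzRingType) (S : R -> Prop).

(* The two-sided ideal generated by S. *)
Inductive idealgen : R -> Prop :=
| idealgen0 : idealgen 0
| idealgenD u v : idealgen u -> idealgen v -> idealgen (u + v)
| idealgenM a s b : S s -> idealgen (a * s * b).

Lemma idealgen_sub s : S s -> idealgen s.
Proof. by move/(idealgenM 1 1); rewrite mul1r mulr1. Qed.
Lemma idealgenMl a u : idealgen u -> idealgen (a * u).
Proof.
elim=> [|v w _ hv _ hw|b s c Ss]; first by rewrite mulr0; exact: idealgen0.
  by rewrite mulrDr; exact: idealgenD.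
by rewrite !mulrA; exact: idealgenM.
Qed.
Lemma idealgenMr a u : idealgen u -> idealgen (u * a).
Proof.
elim=> [|v w _ hv _ hw|b s c Ss]; first by rewrite mul0r; exact: idealgen0.
  by rewrite mulrDl; exact: idealgenD.
by rewrite -mulrA; exact: idealgenM.
Qed.
Lemma idealgenN u : idealgen u -> idealgen (- u).
Proof. by move=> h; rewrite -mulN1r; exact: idealgenMl. Qed.

Definition idealrel (x y : R) : bool := `[< idealgen (x - y) >].

Lemma idealrel_refl : reflexive idealrel.
Proof. by move=> x; apply/asboolP; rewrite subrr; exact: idealgen0. Qed.
Lemma idealrel_sym : symmetric idealrel.
Proof.
by move=> x y; apply/asboolP/asboolP=> /idealgenN; rewrite opprB.
Qed.
Lemma idealrel_trans : transitive idealrel.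
Proof.
move=> y x z /asboolP h /asboolP k; apply/asboolP.
by rewrite -(subrKA y); exact: idealgenD.
Qed.
Canonical idealrel_equiv :=
  EquivRel idealrel idealrel_refl idealrel_sym idealrel_trans.

Definition quo := {eq_quot idealrel_equiv}.
HB.instance Definition _ := Choice.on quo.
HB.instance Definition _ := EqQuotient.on quo.

Definition qpi (x : R) : quo := \pi_quo x.

Lemma qpiP x y : qpi x = qpi y <-> idealgen (x - y).
Proof.
split=> [/eqP|h]; first by rewrite /qpi eqmodE => /asboolP.
by apply/eqP; rewrite /qpi eqmodE; apply/asboolP.
Qed.
Lemma qpiW (P : quo -> Prop) : (forall x, P (qpi x)) -> forall z, P z.
Proof. by move=> h z; rewrite -[z]reprK; exact: h. Qed.
Lemma repr_qpi x : idealgen (repr (qpi x) - x).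
Proof. by apply/qpiP; rewrite /qpi reprK. Qed.

Definition quo_add (u v : quo) := qpi (repr u + repr v).
Definition quo_opp (u : quo) := qpi (- repr u).
Definition quo_mul (u v : quo) := qpi (repr u * repr v).

Lemma quo_addE x y : quo_add (qpi x) (qpi y) = qpi (x + y).
Proof.
by apply/qpiP; rewrite opprD addrACA; apply: idealgenD; exact: repr_qpi.
Qed.
Lemma quo_oppE x : quo_opp (qpi x) = qpi (- x).
Proof. by apply/qpiP; rewrite -opprD; apply: idealgenN; exact: repr_qpi. Qed.
Lemma quo_mulE x y : quo_mul (qpi x) (qpi y) = qpi (x * y).
Proof.
apply/qpiP; rewrite -(subrKA (x * repr (qpi y))) -mulrBl -mulrBr.
by apply: idealgenD; [apply: idealgenMr | apply: idealgenMl]; exact: repr_qpi.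
Qed.

Lemma quo_addA : associative quo_add.
Proof.
elim/qpiW=> x; elim/qpiW=> y; elim/qpiW=> z; by rewrite !quo_addE addrA.
Qed.
Lemma quo_addC : commutative quo_add.
Proof. by elim/qpiW=> x; elim/qpiW=> y; rewrite !quo_addE addrC. Qed.
Lemma quo_add0 : left_id (qpi 0) quo_add.
Proof. by elim/qpiW=> x; rewrite quo_addE add0r. Qed.
Lemma quo_addN : left_inverse (qpi 0) quo_opp quo_add.
Proof. by elim/qpiW=> x; rewrite quo_oppE quo_addE addNr. Qed.
HB.instance Definition _ :=
  GRing.isZmodule.Build quo quo_addA quo_addC quo_add0 quo_addN.

Lemma quo_mulA : associative quo_mul.
Proof.
elim/qpiW=> x; elim/qpiW=> y; elim/qpiW=> z; by rewrite !quo_mulE mulrA.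
Qed.
Lemma quo_mul1 : left_id (qpi 1) quo_mul.
Proof. by elim/qpiW=> x; rewrite quo_mulE mul1r. Qed.
Lemma quo_mulr1 : right_id (qpi 1) quo_mul.
Proof. by elim/qpiW=> x; rewrite quo_mulE mulr1. Qed.
Lemma quo_mulDl : left_distributive quo_mul quo_add.
Proof.
by elim/qpiW=> x; elim/qpiW=> y; elim/qpiW=> z; rewrite !(quo_mulE, quo_addE) mulrDl.
Qed.
Lemma quo_mulDr : right_distributive quo_mul quo_add.
Proof.
by elim/qpiW=> x; elim/qpiW=> y; elim/qpiW=> z; rewrite !(quo_mulE, quo_addE) mulrDr.
Qed.
HB.instance Definition _ := GRing.Zmodule_isPzRing.Build quo
  quo_mulA quo_mul1 quo_mulr1 quo_mulDl quo_mulDr.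

Lemma qpi_is_zmod_morphism : zmod_morphism qpi.
Proof.
move=> x y; rewrite [RHS](_ : _ = quo_add (qpi x) (quo_opp (qpi y))) //.
by rewrite quo_oppE quo_addE.
Qed.
Lemma qpi_is_monoid_morphism : monoid_morphism qpi.
Proof. by split=> // x y; exact/esym/quo_mulE. Qed.
HB.instance Definition _ :=
  GRing.isZmodMorphism.Build R quo qpi qpi_is_zmod_morphism.
HB.instance Definition _ :=
  GRing.isMonoidMorphism.Build R quo qpi qpi_is_monoid_morphism.

Lemma qpi_eq0 x : qpi x = 0 <-> idealgen x.
Proof. by rewrite -(raddf0 qpi) qpiP subr0. Qed.
End IdealQuotient.

Section ComIdealQuotient.
Variables (R : comPzRingType) (S : R -> Prop).
Lemma quo_mulC : commutative (@GRing.mul (quo S)).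
Proof. by elim/qpiW=> x; elim/qpiW=> y; rewrite -!rmorphM mulrC. Qed.
HB.instance Definition _ :=
  GRing.PzRing_hasCommutativeMul.Build (quo S) quo_mulC.
End ComIdealQuotient.

Section Units.
Variable F : fieldType.
(* F^x *)
Definition nz := {x : F | x != 0}.
Definition nz1 : nz := exist _ 1 (oner_neq0 F).
Lemma nzN_subproof (u : nz) : - val u != 0.
Proof. by rewrite oppr_eq0 (valP u). Qed.
Definition nzN (u : nz) : nz := exist _ (- val u) (nzN_subproof u).
Lemma nzM_subproof (u v : nz) : val u * val v != 0.
Proof. by rewrite mulf_neq0 ?(valP u) ?(valP v). Qed.
Definition nzM (u v : nz) : nz := exist _ (val u * val v) (nzM_subproof u v).
Lemma nz1B_subproof (u : nz) : val u != 1 -> 1 - val u != 0.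
Proof. by rewrite subr_eq0 eq_sym. Qed.
Definition nz1B (u : nz) (h : val u != 1) : nz :=
  exist _ (1 - val u) (nz1B_subproof h).
End Units.

Section Witt.
Variable F : fieldType.

Definition GW := groth (isoclass F).
HB.instance Definition _ := GRing.ComPzRing.on GW.

Definition GWcls (A : ipspace F) : GW := gsub (cls A) 0.
Definition GWline (u : nz F) : GW := GWcls (ipline (valP u)).

Definition W := quo (fun x : GW => x = 1 + GWline (nzN (nz1 F))).
HB.instance Definition _ := GRing.ComPzRing.on W.
Definition Wline (u : nz F) : W := qpi _ (GWline u).

Lemma isometric_dim (A B : ipspace F) : isometric A B -> ipdim A = ipdim B.
Proof.
move/isometricP=> [P [Q [PQ QP _]]]; apply/eqP.
by rewrite eqn_leq (mulmx1_min PQ) (mulmx1_min QP).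
Qed.

Definition iso_rank (x : isoclass F) : nat := ipdim (repr x).
Lemma iso_rankE A : iso_rank (cls A) = ipdim A.
Proof. exact/isometric_dim/repr_cls. Qed.
Lemma iso_rankD x y : iso_rank (x + y) = (iso_rank x + iso_rank y)%N.
Proof. by elim/clsW: x => A; elim/clsW: y => B; rewrite clsD !iso_rankE. Qed.
Lemma iso_rankM x y : iso_rank (x * y) = (iso_rank x * iso_rank y)%N.
Proof. by elim/clsW: x => A; elim/clsW: y => B; rewrite clsM !iso_rankE. Qed.

(* Computed on representatives; see GWrankE and Wrank2E for independence of
   the choice. *)
Definition GWrank (z : GW) : int :=
  (iso_rank (repr z).1)%:Z - (iso_rank (repr z).2)%:Z.
Lemma GWrankE x y : GWrank (gsub x y) = (iso_rank x)%:Z - (iso_rank y)%:Z.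
Proof.
have [k /(congr1 iso_rank)] := repr_gsub x y; rewrite !iso_rankD => h.
apply/eqP; rewrite subr_eq addrAC eq_sym subr_eq -!PoszD.
by apply/eqP; congr Posz; apply: (@addIn (iso_rank k)); rewrite -h.
Qed.
Lemma GWrank_is_zmod_morphism : zmod_morphism GWrank.
Proof.
elim/gsubW=> a b; elim/gsubW=> c d.
rewrite gsubN gsubD !GWrankE !iso_rankD !PoszD; ring.
Qed.
Lemma GWrank_is_monoid_morphism : monoid_morphism GWrank.
Proof.
split; first by rewrite GWrankE -cls1 -cls0 !iso_rankE.
elim/gsubW=> a b; elim/gsubW=> c d.
rewrite gsubM !GWrankE !(iso_rankD, iso_rankM) !(PoszD, PoszM); ring.
Qed.
HB.instance Definition _ := GRing.isZmodMorphism.Build GW int GWrank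
  GWrank_is_zmod_morphism.
HB.instance Definition _ := GRing.isMonoidMorphism.Build GW int GWrank
  GWrank_is_monoid_morphism.
Lemma GWrankB x y : GWrank (x - y) = GWrank x - GWrank y.
Proof. exact: raddfB. Qed.
Lemma GWrankD x y : GWrank (x + y) = GWrank x + GWrank y.
Proof. exact: raddfD. Qed.
Lemma GWrankM x y : GWrank (x * y) = GWrank x * GWrank y.
Proof. exact: rmorphM. Qed.
Lemma GWrank1 : GWrank 1 = 1. Proof. exact: rmorph1. Qed.
Lemma GWrank_line u : GWrank (GWline u) = 1.
Proof. by rewrite GWrankE -cls0 !iso_rankE. Qed.

Definition Wrank2 (w : W) : 'Z_2 := (GWrank (repr w))%:~R.
Lemma Wrank2E z : Wrank2 (qpi _ z) = (GWrank z)%:~R.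
Proof.
apply/eqP; rewrite -subr_eq0 -intrB -GWrankB.
elim: (repr_qpi (fun x : GW => x = 1 + GWline (nzN (nz1 F))) z)
    => [|u v _ /eqP hu _ /eqP hv|a s b ->].
- by rewrite raddf0.
- by rewrite GWrankD intrD hu hv addr0.
rewrite !GWrankM GWrankD GWrank1 GWrank_line !intrM.
by rewrite (_ : (1 + 1)%:~R = 0 :> 'Z_2) ?mulr0 ?mul0r //; apply/val_inj.
Qed.
Lemma Wrank2_is_zmod_morphism : zmod_morphism Wrank2.
Proof.
elim/qpiW=> x; elim/qpiW=> y.
by rewrite -raddfB !Wrank2E GWrankB intrB.
Qed.
Lemma Wrank2_is_monoid_morphism : monoid_morphism Wrank2.
Proof.
split; first by rewrite -(rmorph1 (qpi _)) Wrank2E GWrank1.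
elim/qpiW=> x; elim/qpiW=> y.
by rewrite -rmorphM !Wrank2E GWrankM intrM.
Qed.
HB.instance Definition _ := GRing.isZmodMorphism.Build W 'Z_2 Wrank2
  Wrank2_is_zmod_morphism.
HB.instance Definition _ := GRing.isMonoidMorphism.Build W 'Z_2 Wrank2
  Wrank2_is_monoid_morphism.

Lemma Wrank2D x y : Wrank2 (x + y) = Wrank2 x + Wrank2 y.
Proof. exact: raddfD. Qed.
Lemma Wrank2M x y : Wrank2 (x * y) = Wrank2 x * Wrank2 y.
Proof. exact: rmorphM. Qed.
Lemma Wrank2_1 : Wrank2 1 = 1. Proof. exact: rmorph1. Qed.

Definition fundI (w : W) : Prop := Wrank2 w = 0.

Definition pfister (a : nz F) : W := 1 + Wline (nzN a).

Lemma fundI_pfister a : fundI (pfister a).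
Proof.
rewrite /fundI Wrank2D Wrank2_1 Wrank2E GWrank_line.
by apply/val_inj.
Qed.

Lemma GWlineM u v : GWline u * GWline v = GWline (nzM u v).
Proof.
rewrite gsubM /GWline /GWcls !mul0r !mulr0 !addr0 clsM; congr gsub.
apply/clsP.
have bs : bijective (fun _ : 'I_1 * 'I_1 => ord0 : 'I_1).
  exists (fun _ => (ord0, ord0)) => [[i j]|i]; first by rewrite (ord1 i) (ord1 j).
  by rewrite [RHS]ord1.
apply: (@isometric_gen _ (iptens (ipline (valP u)) (ipline (valP v)))
  (ipline (valP (nzM u v))) _ _ _ (bij_tens 1 1) bs) => -[i k] [j l].
by rewrite gram_tens !mxE !ord1 !eqxx !mulr1n.
Qed.

Lemma pfisterE a : pfister a = 1 - Wline a.
Proof.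
congr (1 + _); apply/eqP; rewrite -addr_eq0; apply/eqP.
have -> : nzN a = nzM a (nzN (nz1 F)).
  by apply/val_inj; rewrite /= mulrN mulr1.
rewrite /Wline -GWlineM -raddfD /=; apply/qpi_eq0.
have := @idealgenM _ (fun x : GW => x = 1 + GWline (nzN (nz1 F))) (GWline a) _ 1 erefl.
by rewrite mulr1 mulrDr mulr1 [GWline a + _]addrC.
Qed.
End Witt.

Section IdealPowers.
Variable R : pzRingType.

(* Finite sums of products x * y with x in J and y in K. Hence
   ideal_exp J 1 = J R, which is J for an ideal J (ideal_exp1). *)
Inductive ideal_mul (J K : R -> Prop) : R -> Prop :=
| ideal_mul0 : ideal_mul J K 0
| ideal_mulD x y z : J x -> K y -> ideal_mul J K z -> ideal_mul J K (x * y + z).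

Fixpoint ideal_exp (J : R -> Prop) (n : nat) : R -> Prop :=
  if n is n'.+1 then ideal_mul J (ideal_exp J n') else fun=> True.

Lemma ideal_mul_add J K x y : ideal_mul J K x -> ideal_mul J K y -> ideal_mul J K (x + y).
Proof.
move=> hx hy; elim: hx => [|a b z Ja Kb _ h]; first by rewrite add0r.
by rewrite -addrA; exact: ideal_mulD.
Qed.
Lemma ideal_mul_mul (J K : R -> Prop) x y : J x -> K y -> ideal_mul J K (x * y).
Proof.
by move=> Jx Ky; rewrite -[_ * _]addr0; apply: ideal_mulD => //; exact: ideal_mul0.
Qed.
End IdealPowers.

Section ComIdealPowers.
Variables (R : comPzRingType) (J : R -> Prop).
Hypotheses (J0 : J 0) (JD : forall x y, J x -> J y -> J (x + y))
  (JM : forall a x, J x -> J (a * x)).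

Lemma ideal_exp0 n : ideal_exp J n 0.
Proof. by case: n => // n; exact: ideal_mul0. Qed.
Lemma ideal_expD n x y : ideal_exp J n x -> ideal_exp J n y -> ideal_exp J n (x + y).
Proof. by case: n => // n; exact: ideal_mul_add. Qed.
Lemma ideal_expMl n a x : ideal_exp J n x -> ideal_exp J n (a * x).
Proof.
case: n => // n; elim=> [|b c z Jb Kc _ h]; first by rewrite mulr0; exact: ideal_mul0.
by rewrite mulrDr mulrA; apply: ideal_mulD => //; exact: JM.
Qed.
Lemma ideal_expN n x : ideal_exp J n x -> ideal_exp J n (- x).
Proof. by rewrite -mulN1r; exact: ideal_expMl. Qed.
Lemma ideal_expM m n x y :
  ideal_exp J m x -> ideal_exp J n y -> ideal_exp J (m + n) (x * y).
Proof.
elim: m x => [|m IH] x; first by move=> _; exact: ideal_expMl.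
move=> /= + hy; elim=> [|b c z Jb Kc _ h].
  by rewrite mul0r; exact: ideal_mul0.
by rewrite mulrDl -mulrA; apply: ideal_mulD => //; exact: IH.
Qed.
Lemma ideal_exp_le m n x : (m <= n)%N -> ideal_exp J n x -> ideal_exp J m x.
Proof.
elim: m n x => [|m IH] [|n] x //= le_mn; elim=> [|b c z Jb Kc _ h].
  exact: ideal_mul0.
by apply: ideal_mulD => //; exact: IH Kc.
Qed.
Lemma ideal_exp1 x : ideal_exp J 1 x <-> J x.
Proof.
split=> [|Jx]; last by rewrite -[x]mulr1; exact: ideal_mul_mul.
by elim=> // a b z Ja _ _; apply: JD; rewrite mulrC; exact: JM.
Qed.
End ComIdealPowers.

Section FundamentalPowers.
Variable F : fieldType.

Lemma fundI0 : @fundI F 0. Proof. exact: raddf0. Qed.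
Lemma fundID x y : @fundI F x -> fundI y -> fundI (x + y).
Proof. by rewrite /fundI Wrank2D => -> ->; rewrite addr0. Qed.
Lemma fundIM a x : @fundI F x -> fundI (a * x).
Proof. by rewrite /fundI Wrank2M => ->; rewrite mulr0. Qed.

Definition Ipow (n : int) : W F -> Prop :=
  if n is Posz m then ideal_exp (@fundI F) m else fun=> True.

Lemma IpowE n : Ipow n = ideal_exp (@fundI F) (if n is Posz m then m else 0).
Proof. by case: n. Qed.

Lemma Ipow0 n : Ipow n 0.
Proof. by rewrite IpowE; exact: ideal_exp0. Qed.
Lemma IpowB n x y : Ipow n x -> Ipow n y -> Ipow n (x - y).
Proof.
rewrite IpowE => hx hy; apply: ideal_expD => //.
by apply: ideal_expN => //; exact: fundIM.
Qed.
Lemma IpowD n x y : Ipow n x -> Ipow n y -> Ipow n (x + y).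
Proof. by rewrite IpowE; exact: ideal_expD. Qed.
Lemma Ipow_sum n (T : Type) (r : seq T) (P : pred T) G :
  (forall i, P i -> Ipow n (G i)) -> Ipow n (\sum_(i <- r | P i) G i).
Proof. by move=> h; elim/big_ind: _ => //; [exact: Ipow0 | exact: IpowD]. Qed.
Lemma IpowM m n x y : Ipow m x -> Ipow n y -> Ipow (m + n) (x * y).
Proof.
rewrite !IpowE => hx hy.
apply: (@ideal_exp_le _ _ _
  ((if m is Posz k then k else 0) + (if n is Posz k then k else 0))%N).
  by case E: (m + n)%R => [k|k] //; case: m n E {hx hy} => [m|m] [n|n]; rewrite ?NegzE => E; lia.
by apply: ideal_expM => //; exact: fundIM.
Qed.
Lemma Ipow1 x : Ipow 1 x <-> fundI x.
Proof. by apply: ideal_exp1; [exact: fundI0|exact: fundID|exact: fundIM]. Qed.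
End FundamentalPowers.

(* D n is the set of homogeneous elements of degree n; the last two clauses
   say that R is the direct sum of the D n. *)
Definition is_grading (R : pzRingType) (D : int -> R -> Prop) : Prop :=
  [/\ forall n, D n 0 /\ (forall x y, D n x -> D n y -> D n (x - y)),
      D 0 1 /\ (forall m n x y, D m x -> D n y -> D (m + n) (x * y)),
      forall x, exists (s : seq int) (y : int -> R),
        (forall n, D n (y n)) /\ x = \sum_(n <- s) y n
    & forall (s : seq int) (y : int -> R), uniq s -> (forall n, D n (y n)) ->
        \sum_(n <- s) y n = 0 -> forall n, n \in s -> y n = 0].

Record gradedRing := GradedRing {
  gr_ring :> pzRingType;
  gr_deg : int -> gr_ring -> Prop;
  gr_axiom : is_grading gr_deg }.

Definition graded_iso (A B : gradedRing) (f : A -> B) : Prop :=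
  [/\ zmod_morphism f, monoid_morphism f, bijective f
    & forall n x, gr_deg n x <-> gr_deg n (f x)].

Lemma sum_fibers (R : nmodType) (T : Type) (t : seq T) (d : T -> int)
    (G : T -> R) (s : seq int) :
  uniq s -> {subset map d t <= s} ->
  \sum_(n <- s) \sum_(x <- t | d x == n) G x = \sum_(x <- t) G x.
Proof.
move=> us; elim: t => [|x t IH] sub.
  by rewrite big_nil big1 // => n _; rewrite big_nil.
rewrite big_cons -IH; last by move=> n nt; apply: sub; rewrite inE nt orbT.
have dx : d x \in s by apply: sub; rewrite inE eqxx.
under eq_bigr => n _ do rewrite big_cons.
rewrite (bigD1_seq (d x)) //= [X in _ = _ + X](bigD1_seq (d x)) //= eqxx addrA.
by congr (_ + _); apply: eq_bigr => n; rewrite eq_sym => /negPf ->.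
Qed.

Section GradedTheory.
Variables (R : pzRingType) (D : int -> R -> Prop) (gD : is_grading D).

Lemma gr0 n : D n 0. Proof. by case: gD => /(_ n)[]. Qed.
Lemma grB n x y : D n x -> D n y -> D n (x - y).
Proof. by case: gD => /(_ n)[_ h] _ _ _; exact: h. Qed.
Lemma grN n x : D n x -> D n (- x).
Proof. by move=> h; rewrite -[- x]add0r; apply: grB => //; exact: gr0. Qed.
Lemma grD n x y : D n x -> D n y -> D n (x + y).
Proof. by move=> hx hy; rewrite -[y]opprK; apply: grB => //; exact: grN. Qed.
Lemma gr1 : D 0 1. Proof. by case: gD => _ []. Qed.
Lemma grM m n x y : D m x -> D n y -> D (m + n) (x * y).
Proof. by case: gD => _ [_ h] _ _; exact: h. Qed.
Lemma gr_sum n (T : Type) (r : seq T) (P : pred T) G :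
  (forall i, P i -> D n (G i)) -> D n (\sum_(i <- r | P i) G i).
Proof. by move=> h; elim/big_ind: _ => //; [exact: gr0 | exact: grD]. Qed.

Variables (S : R -> Prop) (homS : forall s, S s -> exists n, D n s).

Definition quo_deg (n : int) (z : quo S) : Prop :=
  exists2 x, D n x & z = qpi S x.

Let idealgen_hom u : idealgen S u ->
  exists t : seq (int * R),
    (forall p, p \in t -> D p.1 p.2 /\ idealgen S p.2) /\ u = \sum_(p <- t) p.2.
Proof.
elim=> [|v w _ [t [ht ->]] _ [t' [ht' ->]]|a s b Ss].
- by exists [::]; split=> //; rewrite big_nil.
- exists (t ++ t'); split; last by rewrite big_cat.
  by move=> p; rewrite mem_cat => /orP[/ht|/ht'].
case: gD => _ _ hdec _; have [k Dk] := homS Ss.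
have [s1 [y [hy ->]]] := hdec a; have [s2 [z [hz ->]]] := hdec b.
exists [seq (n + k + m, y n * s * z m) | n <- s1, m <- s2]; split.
  move=> p /allpairsP[[n m] /= [_ _ ->]] /=; split; last exact: idealgenM.
  by apply: grM => //; exact: grM.
rewrite big_allpairs_dep /= !mulr_suml; apply: eq_bigr => n _.
by rewrite mulr_sumr.
Qed.

Let idealgen_comp (s : seq int) (y : int -> R) : uniq s ->
  (forall n, D n (y n)) -> idealgen S (\sum_(n <- s) y n) ->
  forall n, n \in s -> idealgen S (y n).
Proof.
move=> us hy /idealgen_hom[t [ht et]] n ns.
pose z n := \sum_(p <- t | p.1 == n) p.2.
have hz m : D m (z m) /\ idealgen S (z m).
  rewrite /z big_seq_cond; split.
    by apply: gr_sum => p /andP[/ht[h _] /eqP <-].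
  elim/big_ind: _ => [|v w|p /andP[/ht[]]//]; first exact: idealgen0.
  exact: idealgenD.
pose s' := undup (s ++ map fst t).
have us' : uniq s' by exact: undup_uniq.
pose w m := (if m \in s then y m else 0) - z m.
have sw : \sum_(m <- s') w m = 0.
  rewrite sumrB (@sum_fibers _ _ t fst snd) //; last first.
    by move=> m mt; rewrite mem_undup mem_cat mt orbT.
  apply/eqP; rewrite subr_eq0 -et -big_mkcond -big_filter /=; apply/eqP.
  apply: perm_big; apply: uniq_perm => //; first exact: filter_uniq.
  by move=> m; rewrite mem_filter mem_undup mem_cat; case: (m \in s).
have hw m : D m (w m).
  by rewrite /w; apply: grB; [case: ifP => _ //; exact: gr0 | case: (hz m)].
have ns' : n \in s' by rewrite mem_undup mem_cat ns.
case: gD => _ _ _ /(_ s' w us' hw sw n ns') /eqP.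
by rewrite /w ns subr_eq0 => /eqP ->; case: (hz n).
Qed.

Lemma quo_grading : is_grading quo_deg.
Proof.
split.
- move=> n; split; first by exists 0; [exact: gr0 | rewrite raddf0].
  by move=> _ _ [x Dx ->] [y Dy ->]; exists (x - y); [exact: grB | rewrite raddfB].
- split; first by exists 1; [exact: gr1 | rewrite rmorph1].
  move=> m n _ _ [x Dx ->] [y Dy ->].
  by exists (x * y); [exact: grM | rewrite rmorphM].
- elim/qpiW=> x; case: gD => _ _ /(_ x)[s [y [hy ->]]] _.
  exists s, (fun n => qpi S (y n)); split; last exact: raddf_sum.
  by move=> n; exists (y n).
move=> s y us.
move=> hy.
have /choice[x hx] : forall n, exists x, D n x /\ y n = qpi S x.
  by move=> n; have [x Dx e] := hy n; exists x.
under eq_bigr => n _ do rewrite (proj2 (hx n)).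
rewrite -raddf_sum => /qpi_eq0 h n ns.
rewrite (proj2 (hx n)); apply/qpi_eq0.
by apply: (idealgen_comp us _ h) => // m; case: (hx m).
Qed.
End GradedTheory.

Definition quoGraded (A : gradedRing) (S : A -> Prop)
    (homS : forall s, S s -> exists n, gr_deg n s) : gradedRing :=
  GradedRing (quo_grading (gr_axiom A) homS).

Section FreeRing.
Variable F : fieldType.

(* Some u stands for the symbol [u] and None for eta. *)
Definition KMWgen : choiceType := option (nz F).
(* The free associative unital ring on KMWgen. *)
Definition KMWfree : pzRingType := {malg int[{fmonom KMWgen}]}.

Definition gendeg (x : KMWgen) : int := if x is Some _ then 1 else - 1.
Definition worddeg (w : {fmonom KMWgen}) : int := \sum_(x <- (w : seq KMWgen)) gendeg x.

Definition KMWfree_deg (n : int) (p : KMWfree) : Prop :=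
  forall w, w \in msupp p -> worddeg w = n.

Lemma worddeg1 : worddeg (@mone _) = 0.
Proof. by rewrite /worddeg fm1 big_nil. Qed.
Lemma worddegM v w : worddeg (mmul v w) = worddeg v + worddeg w.
Proof. by rewrite /worddeg fmM big_cat. Qed.

Lemma KMWfree_degP n (p : KMWfree) :
  KMWfree_deg n p <-> (forall w, worddeg w != n -> p@_w = 0).
Proof.
split=> h w; first by move/eqP=> hw; apply: mcoeff_outdom; apply/negP=> /h.
by rewrite -mcoeff_neq0 => /eqP hw; apply/eqP/negPn/negP => /h.
Qed.

Lemma KMWfree_grading : is_grading KMWfree_deg.
Proof.
split.
- move=> n; split; first by move=> w; rewrite msupp0 inE.
  move=> x y /KMWfree_degP hx /KMWfree_degP hy; apply/KMWfree_degP => w hw.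
  by rewrite mcoeffB hx // hy // subr0.
- split; first by move=> w; rewrite msuppU1 inE => /eqP ->; exact: worddeg1.
  move=> m n x y hx hy w /msuppM_le[v [v' [/hx <- /hy <- ->]]].
  exact: worddegM.
- move=> p; pose s := undup (map worddeg (msupp p)).
  exists s, (fun n => \sum_(w <- msupp p | worddeg w == n) << p@_w *g w >>).
  split; last first.
    rewrite {1}[p]monalgE; apply/esym/sum_fibers; first exact: undup_uniq.
    by move=> n; rewrite mem_undup.
  move=> n; apply/KMWfree_degP => v hv; rewrite raddf_sum big1 // => w /eqP e.
  by rewrite /= mcoeffU; case: eqP => // ev; rewrite -ev e eqxx in hv.
move=> s y us hy /malgP sy n ns; apply/malgP => w; rewrite mcoeff0.
have [e|ne] := eqVneq (worddeg w) n; last by have /KMWfree_degP -> := hy n.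
have := sy w; rewrite mcoeff0 raddf_sum (bigD1_seq n) //= big1 ?addr0 //.
by move=> m mn; have /KMWfree_degP -> // := hy m; rewrite e eq_sym.
Qed.
End FreeRing.

Section KTheory.
Variable F : fieldType.

Definition fsym (u : nz F) : KMWfree F := << fmu (Some u) >>.
Definition feta : KMWfree F := << fmu None >>.
Definition fh : KMWfree F := feta * fsym (nzN (nz1 F)) + 2%:R.

Inductive KMWrel : KMWfree F -> Prop :=
| KMW_steinberg a (h : val a != 1) : KMWrel (fsym a * fsym (nz1B h))
| KMW_twist a b :
    KMWrel (fsym (nzM a b) - (fsym a + fsym b + feta * fsym a * fsym b))
| KMW_etaC u : KMWrel (feta * fsym u - fsym u * feta)
| KMW_etah : KMWrel (feta * fh).

Lemma fsym_deg u : KMWfree_deg 1 (fsym u).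
Proof.
by move=> w; rewrite msuppU1 inE => /eqP ->; rewrite /worddeg fmU big_seq1.
Qed.
Lemma feta_deg : KMWfree_deg (- 1) feta.
Proof.
by move=> w; rewrite msuppU1 inE => /eqP ->; rewrite /worddeg fmU big_seq1.
Qed.
Let gD := KMWfree_grading F.
Lemma fh_deg : KMWfree_deg 0 fh.
Proof.
apply: (grD gD); first by have := grM gD feta_deg (@fsym_deg (nzN (nz1 F))); rewrite addNr.
by apply: (grD gD); exact: (gr1 gD).
Qed.

Lemma KMWrel_hom s : KMWrel s -> exists n, KMWfree_deg n s.
Proof.
case=> [a h|a b|u|].
- by exists (1 + 1); apply: (grM gD); exact: fsym_deg.
- exists 1; apply: (grB gD); first exact: fsym_deg.
  apply: (grD gD); first by apply: (grD gD); exact: fsym_deg.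
  have := grM gD (grM gD feta_deg (@fsym_deg a)) (@fsym_deg b).
  by rewrite addNr add0r.
- exists (- 1 + 1); apply: (grB gD); first exact: (grM gD feta_deg (@fsym_deg _)).
  by rewrite addrC; exact: (grM gD (@fsym_deg _) feta_deg).
- by exists (- 1 + 0); apply: (grM gD feta_deg fh_deg).
Qed.

Definition KMW : gradedRing :=
  @quoGraded (GradedRing gD) KMWrel KMWrel_hom.

Definition KMWsym (u : nz F) : KMW := qpi KMWrel (fsym u).
Definition KMWeta : KMW := qpi KMWrel feta.
Definition KMWh : KMW := KMWeta * KMWsym (nzN (nz1 F)) + 2%:R.

Lemma KMWh_hom s : s = KMWh -> exists n, gr_deg n s.
Proof.
move=> ->; exists 0, fh; first exact: fh_deg.
by rewrite /fh rmorphD rmorphM rmorph_nat.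
Qed.

Definition KW : gradedRing := quoGraded KMWh_hom.
Definition KWsym (u : nz F) : KW := qpi (fun s => s = KMWh) (KMWsym u).
Definition KWeta : KW := qpi (fun s => s = KMWh) KMWeta.

Lemma KWsym_deg u : gr_deg 1 (KWsym u).
Proof. by exists (KMWsym u) => //; exists (fsym u) => //; exact: fsym_deg. Qed.
Lemma KWeta_deg : gr_deg (- 1) KWeta.
Proof. by exists KMWeta => //; exists feta => //; exact: feta_deg. Qed.
End KTheory.

(* Laurent polynomials, i.e. the direct sum of copies of R indexed by Z, with
   the multiplication of R bringing degrees m and n to degree m + n. *)
Section Laurent.
Variable R : pzRingType.

Definition laurent := {malg R[int]}.
HB.instance Definition _ := GRing.Zmodule.on laurent.
Implicit Types p q r : laurent.

Definition lmul p q : laurent :=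
  \sum_(i <- msupp p) \sum_(j <- msupp q) << p@_i * q@_j *g i + j >>.
Definition lone : laurent := << 1 *g 0 >>.

Lemma lmulw (d1 d2 : {fset int}) p q : (msupp p `<=` d1)%fset -> (msupp q `<=` d2)%fset ->
  lmul p q = \sum_(i <- d1) \sum_(j <- d2) << p@_i * q@_j *g i + j >>.
Proof.
move=> le1 le2; rewrite /lmul (big_fset_incl _ le1) /=.
  apply/eq_bigr => i _; apply/big_fset_incl => // k _ /mcoeff_outdom ->.
  by rewrite mulr0 monalgU0.
move=> k _ /mcoeff_outdom pk.
by rewrite big1 // => k' _; rewrite pk mul0r monalgU0.
Qed.

Lemma lmulUU a b i j :
  lmul << a *g i >> << b *g j >> = << a * b *g i + j >>.
Proof. by rewrite (lmulw msuppU_le msuppU_le) !big_seq_fset1 !mcoeffUU. Qed.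

Lemma lmulDl : left_distributive lmul +%R.
Proof.
move=> p q r; rewrite (lmulw (msuppD_le _ _) (fsubset_refl _)).
rewrite [lmul p r](lmulw (fsubsetUl _ (msupp q)) (fsubset_refl _)).
rewrite [lmul q r](lmulw (fsubsetUr (msupp p) _) (fsubset_refl _)).
rewrite -big_split /=; apply/eq_bigr=> i _.
rewrite -big_split /=; apply/eq_bigr=> j _.
by rewrite mcoeffD mulrDl monalgUD.
Qed.
Lemma lmulDr : right_distributive lmul +%R.
Proof.
move=> r p q; rewrite (lmulw (fsubset_refl _) (msuppD_le _ _)).
rewrite [lmul r p](lmulw (fsubset_refl _) (fsubsetUl _ (msupp q))).
rewrite [lmul r q](lmulw (fsubset_refl _) (fsubsetUr (msupp p) _)).
rewrite -big_split /=; apply/eq_bigr=> i _.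
rewrite -big_split /=; apply/eq_bigr=> j _.
by rewrite mcoeffD mulrDr monalgUD.
Qed.
Lemma lmul0p p : lmul 0 p = 0.
Proof. by rewrite /lmul msupp0 big_seq_fset0. Qed.
Lemma lmulp0 p : lmul p 0 = 0.
Proof. by rewrite /lmul big1 // => i _; rewrite msupp0 big_seq_fset0. Qed.
Lemma lmul_suml (T : Type) (s : seq T) (G : T -> laurent) q :
  lmul (\sum_(i <- s) G i) q = \sum_(i <- s) lmul (G i) q.
Proof.
exact: (big_morph (lmul^~ q) (fun _ _ => lmulDl _ _ _) (lmul0p _)).
Qed.
Lemma lmul_sumr (T : Type) (s : seq T) (G : T -> laurent) q :
  lmul q (\sum_(i <- s) G i) = \sum_(i <- s) lmul q (G i).
Proof.
exact: (big_morph (lmul q) (fun _ _ => lmulDr _ _ _) (lmulp0 _)).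
Qed.

Lemma laurentW (P : laurent -> Prop) :
  (forall p q, P p -> P q -> P (p + q)) -> P 0 ->
  (forall a i, P << a *g i >>) -> forall p, P p.
Proof. by move=> hD h0 hU p; rewrite [p]monalgE; elim/big_ind: _. Qed.

Lemma lmulA : associative lmul.
Proof.
move=> p q r.
elim/laurentW: p => [p p' h h'| |a i]; first by rewrite !lmulDl h h'.
  by rewrite !lmul0p.
elim/laurentW: q => [q q' h h'| |b j]; first by rewrite lmulDl !lmulDr lmulDl h h'.
  by rewrite lmul0p !lmulp0 lmul0p.
elim/laurentW: r => [r r' h h'| |c k]; first by rewrite !lmulDr h h'.
  by rewrite !lmulp0.
by rewrite !lmulUU mulrA addrA.
Qed.
Lemma lmul1 : left_id lone lmul.
Proof.
elim/laurentW=> [p q h h'| |a i]; first by rewrite lmulDr h h'.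
  exact: lmulp0.
by rewrite lmulUU mul1r add0r.
Qed.
Lemma lmulr1 : right_id lone lmul.
Proof.
elim/laurentW=> [p q h h'| |a i]; first by rewrite lmulDl h h'.
  exact: lmul0p.
by rewrite lmulUU mulr1 addr0.
Qed.
HB.instance Definition _ := GRing.Zmodule_isPzRing.Build laurent
  lmulA lmul1 lmulr1 lmulDl lmulDr.

Lemma laurentME p q :
  p * q = \sum_(i <- msupp p) \sum_(j <- msupp q) << p@_i * q@_j *g i + j >>.
Proof. by []. Qed.
Lemma laurent1E : 1 = << 1 *g 0 >> :> laurent.
Proof. by []. Qed.
End Laurent.

Section Istar.
Variable F : fieldType.

Definition Istar_pred : pred (laurent (W F)) :=
  fun p => `[< forall n : int, Ipow n p@_n >].

Lemma Istar_predP p : reflect (forall n : int, Ipow n p@_n) (p \in Istar_pred).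
Proof. exact: asboolP. Qed.

Lemma Istar_subring_closed : subring_closed Istar_pred.
Proof.
split.
- apply/Istar_predP => n; rewrite laurent1E mcoeffU.
  by case: eqP => [<- //|_]; exact: Ipow0.
- move=> p q /Istar_predP hp /Istar_predP hq; apply/Istar_predP => n.
  by rewrite mcoeffB; exact: IpowB.
move=> p q /Istar_predP hp /Istar_predP hq; apply/Istar_predP => n.
rewrite laurentME raddf_sum; apply: Ipow_sum => i _.
rewrite raddf_sum; apply: Ipow_sum => j _; rewrite /= mcoeffU.
by case: eqP => [<-|_]; [exact: IpowM | exact: Ipow0].
Qed.
HB.instance Definition _ :=
  GRing.isSubringClosed.Build (laurent (W F)) Istar_pred Istar_subring_closed.

Record Istar_ring := IstarRing {
  Istar_val :> laurent (W F);
  _ : Istar_val \in Istar_pred }.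
HB.instance Definition _ := [isSub for Istar_val].
HB.instance Definition _ := [Choice of Istar_ring by <:].
HB.instance Definition _ :=
  GRing.SubChoice_isSubPzRing.Build _ _ Istar_ring Istar_subring_closed.

Lemma Istar_val0 : Istar_val 0 = 0. Proof. exact: (raddf0 \val). Qed.
Lemma Istar_val1 : Istar_val 1 = 1. Proof. exact: (rmorph1 \val). Qed.
Lemma Istar_valB x y : Istar_val (x - y) = Istar_val x - Istar_val y.
Proof. exact: (raddfB \val). Qed.
Lemma Istar_valM x y : Istar_val (x * y) = Istar_val x * Istar_val y.
Proof. exact: (rmorphM \val). Qed.
Lemma Istar_val_sum (T : Type) (r : seq T) (P : pred T) G :
  Istar_val (\sum_(i <- r | P i) G i) = \sum_(i <- r | P i) Istar_val (G i).
Proof. exact: (raddf_sum \val). Qed.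

Lemma Istar_mono_subproof n w : Ipow n w -> << w *g n >> \in Istar_pred.
Proof.
move=> h; apply/Istar_predP => m; rewrite mcoeffU.
by case: eqP => [<-|_] //; exact: Ipow0.
Qed.
(* The element w of I^n(F), placed in degree n. *)
Definition Istar_mono n w (h : Ipow n w) : Istar_ring :=
  IstarRing (Istar_mono_subproof h).

Definition Istar_deg (n : int) (p : Istar_ring) : Prop :=
  forall m : int, m != n -> (Istar_val p)@_m = 0.

Lemma Istar_grading : is_grading Istar_deg.
Proof.
split.
- move=> n; split; first by move=> m _; rewrite Istar_val0 mcoeff0.
  by move=> x y hx hy m mn; rewrite Istar_valB mcoeffB hx ?hy ?subrr.
- split; first by move=> m m0; rewrite Istar_val1 laurent1E mcoeffU eq_sym (negPf m0).
  move=> m n x y hx hy k hk.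
  rewrite Istar_valM laurentME raddf_sum big1 // => i _; rewrite raddf_sum big1 // => j _.
  rewrite /= mcoeffU; case: eqP => // ek.
  have [im|/hx ->] := eqVneq i m; last by rewrite mul0r.
  have [jn|/hy ->] := eqVneq j n; last by rewrite mulr0.
  by rewrite -ek im jn eqxx in hk.
- move=> x; exists (msupp (Istar_val x)).
  have hx n : Ipow n (Istar_val x)@_n.
    by have /Istar_predP := valP x.
  exists (fun n => Istar_mono (hx n)); split.
    by move=> n m mn; rewrite mcoeffU eq_sym (negPf mn).
  by apply/val_inj; rewrite /= Istar_val_sum {1}[Istar_val x]monalgE.
move=> s y us hy sy n ns; apply/val_inj; rewrite [RHS](raddf0 \val) /=.
apply/malgP => m; rewrite mcoeff0.
have [->|mn] := eqVneq m n; last exact: hy.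
have /(congr1 (fun p : Istar_ring => (Istar_val p)@_n)) := sy.
rewrite Istar_val0 mcoeff0 Istar_val_sum raddf_sum (bigD1_seq n) //= big1 ?addr0 //.
by move=> k kn; apply: hy; rewrite eq_sym.
Qed.

Definition Istar : gradedRing := GradedRing Istar_grading.

Lemma pfister_Ipow1 a : Ipow 1 (@pfister F a).
Proof. exact/Ipow1/fundI_pfister. Qed.
Definition Istar_pfister (a : nz F) : Istar := Istar_mono (pfister_Ipow1 a).
(* The element of I^(-1)(F) = W(F) through which eta acts: as <<ab>> =
   <<a>> + <<b>> - <<a>> <<b>>, KMW_twist holds in I^* with eta = -1. *)
Lemma N1_IpowN1 : @Ipow F (- 1) (- 1). Proof. by []. Qed.
Definition Istar_eta : Istar := Istar_mono N1_IpowN1.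

Lemma Istar_mono_deg n w (h : Ipow n w) : Istar_deg n (Istar_mono h).
Proof. by move=> m mn; rewrite mcoeffU eq_sym (negPf mn). Qed.
End Istar.

(* Main.v *)
(* The maps K^W_n(F) -> I^n(F) are onto, so all is the injectivity of K^W_n(F) -> W(F).
   K^W(F) is a commutative F_2-algebra in which squares have trivial symbols and
   [a][b] = [a + b]([a] + [b]).

   Given finitely many elements, let F^2 = F_0 < F_1 < ... < F_r be a tower of
   subfields with F_i = F_(i-1)(x_i) containing them. Symbols with more than r
   entries in F_r vanish, and modulo eta every element of degree n is a sum of
   symbols [q_1]...[q_n] whose entries lie at distinct levels of the tower. Order
   the sets of n levels lexicographically from the top. The sum of two symbols with
   the same set of levels is, modulo lower ones, zero or again such a symbol: up to
   lower symbols both live over a common field Z with [Z : F^2] = 2^n, over which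
   two n-fold symbols always have n - 1 slots in common (as for Pfister forms, by
   {t, u} = {t + u, t u}), and their sum can be computed.

   To detect a leading symbol in W(F), use that for every F^2-linear f : F -> F
   there is an additive map W(F) -> F sending <a> to f(a)/a; on a symmetric Gram
   matrix M it is the sum of the (M^-1)_ii f(M_ii), whose invariance under isometry
   is special to characteristic 2. If f is a product of n derivations it kills
   I^(n+1), and a derivation at each level of a set of n levels, vanishing on the
   field below, gives an f that is nonzero on the symbols with this set of levels
   and zero on the lower ones. So an element of degree n that vanishes in W(F) is a
   multiple of eta, say eta z with z of degree n + 1 over the same tower; as z
   vanishes in W(F) too, one reaches degrees above r, where nothing is left. *)
Require Import Defs.
From HB Require Import structures.
From mathcomp Require Import all_boot all_order all_algebra.
From mathcomp Require Import perm finmap boolp classical_sets.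
From mathcomp.multinomials Require Import monalg.
From mathcomp Require Import ring zify.

Set Implicit Arguments.
Unset Strict Implicit.
Unset Printing Implicit Defensive.

Import GRing.Theory.
Local Open Scope ring_scope.

(** * Inseparable towers *)

Section Subfields.
Variable F : fieldType.
Hypothesis two0 : 2%:R = 0 :> F.

Lemma addFF (a : F) : a + a = 0.
Proof. by rewrite -mulr2n -mulr_natl two0 mul0r. Qed.

Lemma addF_eq0 (a b : F) : (a + b == 0) = (a == b).
Proof.
apply/eqP/eqP=> [h|->]; last exact: addFF.
by rewrite -[a]addr0 -(addFF b) addrA h add0r.
Qed.

Lemma sqrFD (a b : F) : (a + b) ^+ 2 = a ^+ 2 + b ^+ 2.
Proof. by rewrite sqrrD mulr2n addFF addr0. Qed.

(* Such a K is closed under inversion, as 1/a = a (1/a)^2. *)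
Definition sqsubfield (K : F -> Prop) : Prop :=
  [/\ forall a, K (a ^+ 2), forall a b, K a -> K b -> K (a + b)
    & forall a b, K a -> K b -> K (a * b)].

(** For a field [K] containing F^2 this is K(x), as x^2 already lies in [K]. *)
Definition adj (K : F -> Prop) (x y : F) : Prop :=
  exists a b, [/\ K a, K b & y = a + b * x].

Definition isqr (a : F) : Prop := exists b, a = b ^+ 2.

(** The field F^2(x_1, ..., x_r), as a tower whose top generator is the head of the list. *)
Fixpoint fld (xs : seq F) : F -> Prop :=
  if xs is x :: xs' then adj (fld xs') x else isqr.

Section Closure.
Variable K : F -> Prop.
Hypothesis sK : sqsubfield K.

Lemma sub_sqr a : K (a ^+ 2). Proof. by case: sK. Qed.
Lemma subD a b : K a -> K b -> K (a + b). Proof. by case: sK => _ h _; exact: h. Qed.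
Lemma subM a b : K a -> K b -> K (a * b). Proof. by case: sK => _ _ h; exact: h. Qed.
Lemma sub0 : K 0. Proof. by have := sub_sqr 0; rewrite expr0n. Qed.
Lemma sub1 : K 1. Proof. by have := sub_sqr 1; rewrite expr1n. Qed.
Lemma subV a : K a -> K a^-1.
Proof.
have [->|a0] := eqVneq a 0; first by rewrite invr0.
by move=> Ka; rewrite (_ : a^-1 = a * a^-1 ^+ 2); [exact: subM (sub_sqr _) | field].
Qed.
Lemma subdiv a b : K a -> K b -> K (a / b).
Proof. by move=> Ka Kb; apply: subM => //; exact: subV. Qed.
Lemma subDl a b : K a -> K (a + b) -> K b.
Proof. by move=> Ka Kab; rewrite -[b]add0r -(addFF a) -addrA; exact: subD. Qed.

Lemma sub_adj x y : K y -> adj K x y.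
Proof. by move=> Ky; exists y, 0; rewrite mul0r addr0; split=> //; exact: sub0. Qed.
Lemma adj_gen x : adj K x x.
Proof. by exists 0, 1; rewrite add0r mul1r; split=> //; [exact: sub0|exact: sub1]. Qed.
Lemma adj_shift x c : K c -> adj K x (x + c).
Proof. by move=> Kc; exists c, 1; rewrite mul1r addrC; split=> //; exact: sub1. Qed.

Lemma adj_sub x : sqsubfield (adj K x).
Proof.
split=> [a|_ _ [a [b [Ka Kb ->]]] [a' [b' [Ka' Kb' ->]]]
         |_ _ [a [b [Ka Kb ->]]] [a' [b' [Ka' Kb' ->]]]].
- exact/sub_adj/sub_sqr.
- by exists (a + a'), (b + b'); split; [exact: subD | exact: subD | ring].
exists (a * a' + b * b' * x ^+ 2), (a * b' + a' * b); split; last by ring.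
  by apply: subD; [exact: subM | apply: subM (sub_sqr _); exact: subM].
by apply: subD; exact: subM.
Qed.

Lemma adj_least (L : F -> Prop) x : sqsubfield L -> (forall y, K y -> L y) -> L x ->
  forall y, adj K x y -> L y.
Proof.
move=> [_ LD LM] KL Lx _ [a [b [Ka Kb ->]]].
by apply: LD; [exact: KL | apply: LM => //; exact: KL].
Qed.

Lemma adj_new x c : ~ K x -> K c -> ~ K (x + c).
Proof. by move=> nx Kc Kxc; apply: nx; apply: (@subDl c) => //; rewrite addrC. Qed.

(** Normal form of slots: once the factor from [K] is absorbed, a slot that is new at this level is
    a translate of [x]. *)
Lemma adj_newP x y : adj K x y -> ~ K y ->
  exists a c, [/\ K a, a != 0, K c & y = a * (x + c)].
Proof.
move=> [a [b [Ka Kb ->]]] ny.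
have b0 : b != 0 by apply/eqP=> b0; apply: ny; rewrite b0 mul0r addr0.
by exists b, (a / b); split=> //; [exact: subdiv | field].
Qed.

Lemma adj_exchange x y : adj K x y -> ~ K y -> adj K y x.
Proof.
move=> hy ny; have [a [c [Ka a0 Kc ->]]] := adj_newP hy ny.
exists c, a^-1; split=> //; first exact: subV.
by rewrite mulKf // addrCA addFF addr0.
Qed.
End Closure.

Lemma new_neq0 K a : sqsubfield K -> ~ K a -> a != 0.
Proof. by move=> sK nK; apply/eqP => e; apply: nK; rewrite e; exact: sub0. Qed.

Lemma isqr_sub : sqsubfield isqr.
Proof.
split=> [a|_ _ [a ->] [b ->]|_ _ [a ->] [b ->]]; first by exists a.
  by exists (a + b); rewrite sqrFD.
by exists (a * b); rewrite exprMn.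
Qed.

Lemma fld_sub xs : sqsubfield (fld xs).
Proof. by elim: xs => [|x xs IH] /=; [exact: isqr_sub | exact: adj_sub]. Qed.

Lemma mem_fld xs : {in xs, forall x, fld xs x}.
Proof.
elim: xs => //= x xs IH y; have sx := fld_sub xs; rewrite inE => /orP[/eqP->|/IH].
  exact: adj_gen.
exact: sub_adj.
Qed.

Lemma sub_fld K xs : sqsubfield K -> {in xs, forall x, K x} -> forall y, fld xs y -> K y.
Proof.
move=> sK; elim: xs => [|x xs IH] h /=; first by move=> _ [b ->]; exact: sub_sqr.
apply: adj_least => //; last by apply: h; rewrite inE eqxx.
by apply: IH => y yxs; apply: h; rewrite inE yxs orbT.
Qed.

Lemma adj_mono K L x : (forall y, K y -> L y) -> forall y, adj K x y -> adj L x y.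
Proof. by move=> KL _ [a [b [Ka Kb ->]]]; exists a, b; split=> //; exact: KL. Qed.

Lemma adj_sub_exchange K x y : sqsubfield K -> adj K x y -> ~ K y ->
  forall t, adj K x t -> adj K y t.
Proof.
move=> sK hy ny; apply: adj_least; [exact: adj_sub | exact: sub_adj|].
exact: adj_exchange.
Qed.

Lemma adj_swap K x y : sqsubfield K ->
  forall t, adj (adj K x) y t -> adj (adj K y) x t.
Proof.
move=> sK; have sKy := adj_sub sK y; have sKyx := adj_sub sKy x.
apply: adj_least => //; last exact/(sub_adj sKy)/adj_gen.
apply: adj_least => //; last exact: adj_gen.
by move=> t Kt; apply/(sub_adj sKy)/sub_adj.
Qed.
End Subfields.

(** * Symbols over a tower *)

Section Symbols.
Variables (F : fieldType) (B : comPzRingType) (s : F -> B) (eta : B).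
Hypothesis two0 : 2%:R = 0 :> F.
Hypothesis two0B : 2%:R = 0 :> B.
(* With the junk value s 0 = 0, s_key needs no nonvanishing hypothesis. *)
Hypothesis s0 : s 0 = 0.
Hypothesis sM : forall a b, a != 0 -> b != 0 -> s (a * b) = s a + s b + eta * s a * s b.
Hypothesis s_sqr : forall a, s a * s a = 0.
Hypothesis s_st : forall a, s a * s (1 + a) = 0.

Lemma addBB (u : B) : u + u = 0.
Proof. by rewrite -mulr2n -mulr_natl two0B mul0r. Qed.

Lemma addBK (u v : B) : u + (u + v) = v.
Proof. by rewrite addrA addBB add0r. Qed.

Lemma s_of_sqr a : s (a ^+ 2) = 0.
Proof.
have [->|a0] := eqVneq a 0; first by rewrite expr0n.
by rewrite expr2 sM // addBB -mulrA s_sqr mulr0 addr0.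
Qed.

Lemma s_Msqr a b : b != 0 -> s (a * b ^+ 2) = s a.
Proof.
have [->|a0 b0] := eqVneq a 0; first by rewrite mul0r.
by rewrite sM ?expf_neq0 // s_of_sqr mulr0 !addr0.
Qed.

Lemma sV a : s a^-1 = s a.
Proof.
have [->|a0] := eqVneq a 0; first by rewrite invr0.
by rewrite -(@s_Msqr a^-1 a) //; congr s; field.
Qed.

(* The Steinberg relation [a/e][b/e] = 0 for e = a + b. *)
Lemma s_key a b : s a * s b = s (a + b) * (s a + s b).
Proof.
have [->|a0] := eqVneq a 0; first by rewrite s0 !add0r mul0r s_sqr.
have [->|b0] := eqVneq b 0; first by rewrite s0 !addr0 mulr0 s_sqr.
have [e0|e0] := eqVneq (a + b) 0.
  move/eqP: e0; rewrite (addF_eq0 two0) => /eqP ->.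
  by rewrite (addFF two0) s0 mul0r s_sqr.
have := s_st (a / (a + b)).
have -> : 1 + a / (a + b) = b / (a + b).
  rewrite -{1}(divff e0) -mulrDl; congr (_ / _).
  by rewrite addrAC (addFF two0) add0r.
rewrite !sM ?invr_neq0 // sV; set A := s a; set C := s b; set E := s (a + b).
have EE : E * E = 0 by exact: s_sqr.
have -> : (A + E + eta * A * E) * (C + E + eta * C * E) =
  A * C + E * (A + C) + (eta * A * C * E + eta * A * C * E)
  + E * E * (1 + eta * A + eta * C + eta ^+ 2 * A * C) by ring.
rewrite EE mul0r addBB !addr0 => h.
by rewrite -[RHS](addBK (A * C)) h addr0.
Qed.

(** By [s_key] the right side is [a][b] + eta [a + b][a][b], and a second use of [s_key] produces
    [a + b]^2 = 0 in the last term. *)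
Lemma s_slot a b : a != 0 -> b != 0 -> s a * s b = s (a + b) * s (a * b).
Proof.
move=> a0 b0; rewrite sM // mulrDr -s_key -mulrA (mulrCA _ eta).
by rewrite [X in eta * (_ * X)]s_key mulrA !mulrA -(mulrA eta) s_sqr mulr0 !mul0r addr0.
Qed.

(** Slots may be rescaled by any factor whose symbol is killed by the other slots. *)
Lemma s_absorb k a b : a != 0 -> b != 0 -> k * s a = 0 -> k * s (a * b) = k * s b.
Proof.
move=> a0 b0 h; rewrite sM // !mulrDr h add0r -(mulrA eta) (mulrCA k eta) (mulrA k) h.
by rewrite mul0r mulr0 addr0.
Qed.

Definition symb (q : seq F) : B := \prod_(a <- q) s a.

Lemma symb_cons a q : symb (a :: q) = s a * symb q. Proof. exact: big_cons. Qed.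
Lemma symb_nil : symb [::] = 1. Proof. exact: big_nil. Qed.

(** The elements of degree [n] with all slots in [K]; [n] is an integer because the power of eta may
    exceed the number of slots. *)
Inductive symspan (K : F -> Prop) (n : int) : B -> Prop :=
| symspan0 : symspan K n 0
| symspanD u v : symspan K n u -> symspan K n v -> symspan K n (u + v)
| symspanG j q : {in q, forall a, K a} -> (size q)%:Z = n + j%:Z ->
    symspan K n (eta ^+ j * symb q).

Lemma symspan_sy K q : {in q, forall a, K a} -> symspan K (size q)%:Z (symb q).
Proof. by move=> h; rewrite -[symb q]mul1r -(expr0 eta); apply: symspanG; rewrite // addr0. Qed.

Lemma symspan1 K : symspan K 0 1.
Proof. by rewrite -symb_nil; exact: (@symspan_sy _ [::]). Qed.

Lemma symspan_s K a : K a -> symspan K 1 (s a).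
Proof.
move=> Ka; rewrite -[s a]mulr1 -symb_nil -symb_cons; apply: (@symspan_sy _ [:: a]).
by move=> b; rewrite inE => /eqP ->.
Qed.

Lemma symspan_eta K : symspan K (- 1) eta.
Proof.
rewrite -[eta]mulr1 -symb_nil -[X in X * _](expr1 eta); exact: symspanG.
Qed.

Lemma symspan_sub (K L : F -> Prop) n z : (forall a, K a -> L a) -> symspan K n z -> symspan L n z.
Proof.
move=> KL; elim=> [|u v _ hu _ hv|j q h e]; [exact: symspan0 | exact: symspanD|].
by apply: symspanG => // a aq; apply/KL/h.
Qed.

Lemma symspanM K m n u v : symspan K m u -> symspan K n v -> symspan K (m + n) (u * v).
Proof.
move=> hu hv; elim: hu => [|u1 u2 _ h1 _ h2|j q h e].
- by rewrite mul0r; exact: symspan0.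
- by rewrite mulrDl; exact: symspanD.
elim: hv => [|v1 v2 _ h1 _ h2|j' q' h' e'].
- by rewrite mulr0; exact: symspan0.
- by rewrite mulrDr; exact: symspanD.
rewrite mulrACA -exprD /symb -big_cat; apply: symspanG; last by rewrite size_cat; lia.
by move=> a; rewrite mem_cat => /orP[/h|/h'].
Qed.

Lemma symspanMe K m n k u v : k = m + n -> symspan K m u -> symspan K n v -> symspan K k (u * v).
Proof. by move=> ->; exact: symspanM. Qed.

(** * Symbols over a simple extension *)

Section Adjoin.
Variables (K : F -> Prop) (x : F).
Hypothesis sK : sqsubfield K.

(** Over K(x) one slot outside [K] is enough, as [s_key] gives [x + c][x + c'] = [c + c']([x + c] +
    [x + c']). *)
Inductive adjspan (n : int) : B -> Prop :=
| adjspan0 z : symspan K n z -> adjspan n z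
| adjspanD w c z : symspan K (n - 1) w -> K c -> adjspan n z -> adjspan n (w * s (x + c) + z).

Lemma adjspanA n u v : adjspan n u -> adjspan n v -> adjspan n (u + v).
Proof.
move=> hu hv; elim: hu => [z hz|w c z hw Kc _ IH]; last by rewrite -addrA; exact: adjspanD.
elim: hv => [y hy|w c y hw Kc _ IH]; first by apply/adjspan0/symspanD.
by rewrite addrCA; exact: adjspanD.
Qed.

Lemma adjspan_gen n w c : symspan K (n - 1) w -> K c -> adjspan n (w * s (x + c)).
Proof. by move=> hw Kc; rewrite -[_ * _]addr0; apply: adjspanD => //; apply/adjspan0/symspan0. Qed.

Lemma adjspanM m n u v : adjspan m u -> adjspan n v -> adjspan (m + n) (u * v).
Proof.
move=> hu hv; elim: hu => [z hz|w c z hw Kc _ IH].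
  elim: hv => [y hy|w c y hw Kc _ IH]; first by apply/adjspan0/symspanM.
  rewrite mulrDr mulrA; apply: adjspanA => //; apply: adjspan_gen => //.
  by apply: symspanMe hz hw; lia.
rewrite mulrDl; apply: adjspanA => //; elim: hv => [y hy|w' c' y hw' Kc' _ {}IH].
  by rewrite mulrAC; apply: adjspan_gen => //; apply: symspanMe hw hy; lia.
rewrite mulrDr; apply: adjspanA => //.
rewrite mulrACA [s _ * _]s_key (_ : x + c + (x + c') = c + c'); last first.
  by rewrite addrACA (addFF two0) add0r.
have h : symspan K (m + n - 1) (w * w' * s (c + c')).
  apply: (@symspanMe _ (m - 1 + (n - 1)) 1); [lia | exact: symspanM |].
  by apply/symspan_s; apply: subD.
by rewrite mulrA mulrDr; apply: adjspanA; exact: adjspan_gen.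
Qed.

Lemma adjspan_s y : adj K x y -> adjspan 1 (s y).
Proof.
move=> [a [b [Ka Kb ->]]]; have [->|b0] := eqVneq b 0.
  by rewrite mul0r addr0; apply/adjspan0/symspan_s.
have -> : a + b * x = b * (x + a / b) by field.
have Kc : K (a / b) by exact: subdiv.
have Qc : adjspan 1 (s (x + a / b)).
  by rewrite -[s _]mul1r; apply: adjspan_gen => //; rewrite subrr; exact: symspan1.
(* [x] may lie in [K], so this slot can be 0. *)
have [->|c0] := eqVneq (x + a / b) 0; first by rewrite mulr0 s0; apply/adjspan0/symspan0.
rewrite sM //; apply: adjspanA; first by apply: adjspanA => //; apply/adjspan0/symspan_s.
rewrite -[1%R](add0r 1); apply: adjspanM => //; apply/adjspan0.
by apply: (@symspanMe _ (- 1) 1); [lia | exact: symspan_eta | exact: symspan_s].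
Qed.

Lemma symspan_adj n z : symspan (adj K x) n z -> adjspan n z.
Proof.
elim=> [|u v _ hu _ hv|j q h e]; [exact/adjspan0/symspan0 | exact: adjspanA|].
have -> : n = - j%:Z + (size q)%:Z by lia.
apply: adjspanM.
  apply: adjspan0; rewrite -[_ ^+ _]mulr1 -symb_nil; apply: symspanG => //=; lia.
elim: q h {e} => [|a q IH] h; first by rewrite symb_nil; apply/adjspan0/symspan1.
rewrite symb_cons (_ : (size (a :: q))%:Z = 1 + (size q)%:Z); last by rewrite /=; lia.
apply: adjspanM; first by apply/adjspan_s/h; rewrite inE eqxx.
by apply: IH => b bq; apply: h; rewrite inE bq orbT.
Qed.
End Adjoin.

(** Each level of the tower supplies at most one slot, and slots in F^2 have trivial symbols. *)
Lemma symspan_fld0 xs n z : (size xs)%:Z < n -> symspan (fld xs) n z -> z = 0.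
Proof.
elim: xs n z => [|x xs IH] n z hn.
  elim=> [//|u v _ -> _ ->|j q h e]; first by rewrite addr0.
  case: q h e => [|a q] h e; first by move: hn e => /=; lia.
  have [b ->] := h a (mem_head _ _).
  by rewrite symb_cons s_of_sqr mul0r mulr0.
move/(symspan_adj (fld_sub two0 xs)); elim=> [y hy|w c y hw _ _ ->].
  by apply: IH hy; move: hn => /=; lia.
by rewrite addr0 (IH _ _ _ hw) ?mul0r //; move: hn => /=; lia.
Qed.

Lemma symb_fld0 xs q : (size xs < size q)%N -> {in q, forall a, fld xs a} -> symb q = 0.
Proof. by move=> hn hq; apply: (@symspan_fld0 xs) (symspan_sy hq); lia. Qed.

(** There is one slot more than there are generators of the field. *)
Lemma symb_mul_fld q a : fld q a -> symb q * s a = 0.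
Proof.
move=> ha; rewrite mulrC -symb_cons; apply: (@symb_fld0 q) => // b.
rewrite inE => /orP[/eqP-> //|]; exact: mem_fld.
Qed.

(* For the tower F_i = F^2(x_1, ..., x_i) listed top first in xs, b marks the
   levels i at which q has an entry, which must lie in F_i but not in F_(i-1). *)
Fixpoint adapted (xs : seq F) (b : seq bool) (q : seq F) : Prop :=
  match xs, b, q with
  | [::], [::], [::] => True
  | x :: xs', false :: b', q => adapted xs' b' q
  | x :: xs', true :: b', y :: q' =>
      [/\ adj (fld xs') x y, ~ fld xs' y & adapted xs' b' q']
  | _, _, _ => False
  end.

(** The slots then generate, level by level, the same strictly increasing chain of fields as
    [zs]. *)
Definition flag zs := adapted zs (nseq (size zs) true).

Lemma adapted_size xs b q : adapted xs b q -> size b = size xs /\ size q = count id b.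
Proof.
elim: xs b q => [|x xs IH] [|[] b] [|y q] //=.
- by case=> _ _ /IH /= [-> <-].
- by move=> /IH /= [-> <-].
- by move=> /IH /= [-> <-].
Qed.

Lemma adapted_fld xs b q : adapted xs b q -> {in q, forall a, fld xs a}.
Proof.
elim: xs b q => [|x xs IH] [|[] b] [|y q] //=.
- case=> hy _ /IH h a; rewrite inE => /orP[/eqP-> //|/h].
  exact: (sub_adj (fld_sub two0 _)).
- by move=> /IH h a /h; exact: (sub_adj (fld_sub two0 _)).
Qed.

Lemma flag_size zs q : flag zs q -> size q = size zs.
Proof. by move/adapted_size=> [_ ->]; rewrite count_nseq mul1n. Qed.

(** This carries the outcome of a computation over fld zs back to the tower [xs]. A slot is a (z +
    c) with a, c in the lower part of fld zs; if it dropped to a lower level of [xs], then so would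
    z. *)
Lemma adapted_flag xs b zs q : adapted xs b zs -> flag zs q -> adapted xs b q.
Proof.
rewrite /flag; elim: xs b zs q => [|x xs IH] [|[] b] [|z zs] //= [|y q] //=.
- move=> [hz nz hzs] [hy ny hq]; split; last exact: IH hq.
    apply: adj_least hy => //; first exact: (adj_sub (fld_sub two0 _)).
    move=> t /(sub_fld (fld_sub two0 xs) (adapted_fld hzs)).
    exact: (sub_adj (fld_sub two0 _)).
  have sX := fld_sub two0 xs.
  have [a [c [Ka a0 Kc ->]]] := adj_newP (fld_sub two0 zs) hy ny.
  have zx := sub_fld sX (adapted_fld hzs).
  move=> h; apply: nz; apply: (subDl two0 sX (zx _ Kc)).
  rewrite addrC -(mulKf a0 (z + c)); apply: subM => //.
  by apply: subV => //; exact: zx.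
- move=> h [hy ny hq]; by apply: (IH _ (z :: zs)).
Qed.

(** * Symbols with all but one slot in common *)

Definition linked zs k k' lam t t' : Prop :=
  [/\ size zs = (size lam).+1 /\ (forall a, fld lam a -> fld zs a),
      [/\ fld zs t, ~ fld lam t & forall a, fld zs a -> adj (fld lam) t a],
      [/\ fld zs t', ~ fld lam t' & forall a, fld zs a -> adj (fld lam) t' a],
      symb k = symb lam * s t & symb k' = symb lam * s t'].

(** From K = L(t) and K(z) = K(w) one gets K(z) = L(w)(t): a new common slot [w] is moved below
    [t]. *)
Lemma link_step (K L : F -> Prop) z w t :
  sqsubfield K -> sqsubfield L -> (forall a, L a -> K a) ->
  adj K z w -> ~ K w -> K t -> ~ L t -> (forall a, K a -> adj L t a) ->
  ~ adj L w t /\ (forall a, adj K z a -> adj (adj L w) t a).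
Proof.
move=> sK sL LK zw nw Kt nt Lt; split.
  move=> [a [b [La Lb e]]]; have [b0|b0] := eqVneq b 0.
    by apply: nt; rewrite e b0 mul0r addr0.
  apply: nw; rewrite -(mulKf b0 w); apply: subM => //; first by apply: subV => //; exact: LK.
  by apply: (subDl two0 sK (LK _ La)); rewrite -e.
move=> a /(adj_sub_exchange two0 sK zw nw) h.
by apply: adj_swap => //; apply: adj_mono h.
Qed.

(** Induction on the levels. Below the top the symbols become {mu, t} and {mu, t'}, and the top
    slots may be taken as z + c and z + c'. It remains to make {t, z + c} and {t', z + c'} share a
    slot, which they do already if c = c' or t = t'. *)
Lemma linking zs k k' : zs != [::] -> flag zs k -> flag zs k' ->
  exists lam t t', linked zs k k' lam t t'.
Proof.
elim: zs k k' => [//|z l IH] [|y k] [|y' k'] _ //=.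
rewrite /flag /= => -[hy ny hk] [hy' ny' hk']; rewrite -/(flag l k) in hk.
rewrite -/(flag l k') in hk'.
have sl := fld_sub two0 l; have sz := adj_sub sl z.
have [l0|l0] := eqVneq l [::].
  move: hk hk'; rewrite /flag l0; case: k => // _; case: k' => // _.
  exists [::], y, y'; split; rewrite ?symb_cons ?symb_nil ?mul1r ?mulr1 //=.
  - by split=> // a h; rewrite l0 in sl; exact: sub_adj.
  - rewrite l0 in ny hy; split=> // a; exact: (adj_sub_exchange two0 (isqr_sub two0)).
  - rewrite l0 in ny' hy'; split=> // a; exact: (adj_sub_exchange two0 (isqr_sub two0)).
have [mu [t [t' [[sm ml] [lt nt tl] [lt' nt' tl'] e e']]]] := IH _ _ l0 hk hk'.
have sL := fld_sub two0 mu.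
have [b [c [lb b0 lc Ey]]] := adj_newP sl hy ny.
have [b' [c' [lb' b0' lc' Ey']]] := adj_newP sl hy' ny'.
have k0 a q : {in q, forall a, fld l a} -> size q = size l -> fld l a -> symb q * s a = 0.
  move=> hq sq la; rewrite mulrC -symb_cons; apply: (@symb_fld0 l); first by rewrite /= sq.
  by move=> d; rewrite inE => /orP[/eqP-> //|/hq].
have nz d : fld l d -> ~ fld l (z + d).
  move=> ld; apply: adj_new => //; rewrite -(addr0 z) => h.
  apply: ny; rewrite Ey; apply: subM => //; apply: subD => //.
  by rewrite -(addr0 z).
have E : symb (y :: k) = symb mu * s t * s (z + c).
  rewrite symb_cons mulrC Ey s_absorb ?e ?(new_neq0 sl (nz _ lc)) //.
  by rewrite -e; apply: k0 => //; [exact: adapted_fld hk | exact: flag_size].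
have E' : symb (y' :: k') = symb mu * s t' * s (z + c').
  rewrite symb_cons mulrC Ey' s_absorb ?e' ?(new_neq0 sl (nz _ lc')) //.
  by rewrite -e'; apply: k0 => //; [exact: adapted_fld hk' | exact: flag_size].
have zc d : fld l d -> adj (fld l) z (z + d) by exact: adj_shift.
have Lw w : adj (fld l) z w -> forall a, adj (fld mu) w a -> adj (fld l) z a.
  by move=> zw; apply: adj_least => // a /ml; exact: sub_adj.
have [cc|cc] := eqVneq c c'.
  exists ((z + c) :: mu), t, t'.
  have [n1 h1] := link_step sl sL ml (zc _ lc) (nz _ lc) lt nt tl.
  have [n2 h2] := link_step sl sL ml (zc _ lc) (nz _ lc) lt' nt' tl'.
  split; rewrite /=; [|split=> //; exact: sub_adj|split=> //; exact: sub_adj| |].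
  - by split; [rewrite sm | apply: Lw; exact: zc].
  - by rewrite E symb_cons mulrC mulrA.
  - by rewrite E' -cc symb_cons mulrC mulrA.
have [tt|tt] := eqVneq t t'.
  exists (t :: mu), (z + c), (z + c'); split; rewrite /=.
  - split; first by rewrite sm.
    apply: adj_least => //; last exact: sub_adj.
    by move=> a /ml; exact: sub_adj.
  - split; first exact: zc.
      move=> h; apply: (nz c) => //; apply: adj_least h => //.
    move=> a /(adj_sub_exchange two0 sl (zc _ lc) (nz _ lc)).
    exact: adj_mono.
  - split; first exact: zc.
      move=> h; apply: (nz c') => //; apply: adj_least h => //.
    move=> a /(adj_sub_exchange two0 sl (zc _ lc') (nz _ lc')).
    exact: adj_mono.
  - by rewrite E symb_cons (mulrC (s t)).
  - by rewrite E' -tt symb_cons (mulrC (s t)).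
have t0 := new_neq0 sL nt; have t0' := new_neq0 sL nt'.
have g0 : t + t' != 0 by rewrite (addF_eq0 two0).
have e0 : c + c' != 0 by rewrite (addF_eq0 two0).
pose g := (t + t') / (c + c').
have lg : fld l g by apply: subdiv => //; apply: subD.
have g1 : g != 0 by rewrite mulf_neq0 ?invr_neq0.
(* w is the common slot: s_slot turns {t, g u} into {w, t g u} and likewise for
   t' and u' = z + c', since w = t' + g u' as well. *)
pose w := t + g * (z + c).
have wE : w = t' + g * (z + c').
  apply/eqP; rewrite -(addF_eq0 two0) /w.
  rewrite (_ : _ + _ = t + t' + g * (c + c') + (g * z + g * z)); last by ring.
  by rewrite /g mulfVK // !(addFF two0).
have zw : adj (fld l) z w.
  by apply: subD => //; [exact: sub_adj | apply: subM => //; [exact: sub_adj | exact: zc]].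
have nw : ~ fld l w.
  move=> h; apply: (nz c) => //; rewrite -(mulKf g1 (z + c)); apply: subM => //.
    exact: subV.
  exact: (subDl two0 sl lt).
have w0 := new_neq0 sl nw.
(* For r = t or t', the sum r + w is g u or g u', so the remaining slot is r (r + w) = r^2 + r w.
   Over F^2(mu, w) it generates the same field as r. *)
have fin r : fld l r -> ~ fld mu r -> (forall a, fld l a -> adj (fld mu) r a) ->
  [/\ adj (fld l) z (r * (r + w)), ~ adj (fld mu) w (r * (r + w)) &
    forall a, adj (fld l) z a -> adj (adj (fld mu) w) (r * (r + w)) a].
  move=> lr nr rl; have [n1 h1] := link_step sl sL ml zw nw lr nr rl.
  have sW := adj_sub sL w; have Ww := adj_gen sL w.
  have nrw : ~ adj (fld mu) w (r * (r + w)).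
    rewrite mulrDr -expr2 => h; apply: n1; rewrite -(mulfK w0 r).
    by apply: subdiv => //; apply: (subDl two0 sW _ h); exact: sub_sqr.
  split=> // [|a /h1 h].
    by apply: subM => //; [|apply: subD => //]; exact: sub_adj.
  apply: (adj_sub_exchange two0 sW _ nrw) h.
  exists (r ^+ 2), w; split=> //; [exact: sub_sqr | ring].
exists (w :: mu), (t * (t + w)), (t' * (t' + w)); split; rewrite /=.
- by split; [rewrite sm | exact: (Lw _ zw)].
- exact: fin.
- exact: fin.
- have u0 := new_neq0 sl (nz _ lc).
  have kg : symb mu * s t * s g = 0.
    by rewrite -e; apply: k0 => //; [exact: adapted_fld hk | exact: flag_size].
  have gu0 := mulf_neq0 g1 u0.
  rewrite E -(s_absorb g1 u0 kg) -mulrA s_slot // symb_cons mulrA.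
  rewrite (mulrC (s w)); congr (_ * s (t * _)).
  by rewrite /w addrA (addFF two0) add0r.
have u0 := new_neq0 sl (nz _ lc').
have kg : symb mu * s t' * s g = 0.
  by rewrite -e'; apply: k0 => //; [exact: adapted_fld hk' | exact: flag_size].
have gu0 := mulf_neq0 g1 u0.
rewrite E' -(s_absorb g1 u0 kg) -mulrA s_slot // -wE symb_cons mulrA.
rewrite (mulrC (s w)); congr (_ * s (t' * _)).
by rewrite wE addrA (addFF two0) add0r.
Qed.

(** For [top_sum]: [x] and [p] stand for symbols of two translates of the top generator, [S] for the
    symbol of their difference, [g] and [e] for symbols from the field below; [k] kills products of
    two of the latter. *)
Lemma s_prod_expand k S g e x p : k * g * e = 0 -> k * g * S = 0 -> k * e * S = 0 ->
  x * p = S * (x + p) ->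
  k * ((g + x + eta * g * x) * (e + p + eta * e * p)) = k * (g + S) * p + k * (e + S) * x.
Proof.
move=> h1 h2 h3 xp.
transitivity (k * g * e * (1 + eta * p + eta * x + eta ^+ 2 * x * p) + k * g * p
  + k * e * x + k * (x * p) + eta * (k * g + k * e) * (x * p)); first by ring.
rewrite xp h1 mul0r add0r.
transitivity (k * (g + S) * p + k * (e + S) * x
  + eta * (k * g * S + k * e * S) * (x + p)); first by ring.
by rewrite h2 h3 addr0 mulr0 mul0r addr0.
Qed.

(** * Sums of symbols in the top degree of a tower *)

Section Top.
Variables (z : F) (l : seq F).
Hypothesis nz : ~ fld l z.
Let sl : sqsubfield (fld l) := fld_sub two0 l.

Lemma top_new d : fld l d -> ~ fld l (z + d).
Proof. by move=> ld; apply: adj_new. Qed.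

Let new0 d : fld l d -> z + d != 0.
Proof. by move=> ld; exact: (new_neq0 sl (top_new ld)). Qed.

(** As [k] has as many slots as [l], it kills [a] for a in fld l. By [s_key] it also kills
    [z + c][z + c'], so the sum is the symbol of the product (z + c)(z + c'), which is (c + c')(z +
    d) because z^2 lies in fld l. *)
Let sum_eq k c c' : c != c' -> fld l c -> fld l c' -> {in k, forall a, fld l a} ->
  size k = size l ->
  exists2 d, fld l d & symb k * s (z + c) + symb k * s (z + c') = symb k * s (z + d).
Proof.
move=> cc lc lc' hk sk.
have e0 : c + c' != 0 by rewrite (addF_eq0 two0).
have le : fld l (c + c') by exact: subD.
have ke : symb k * s (c + c') = 0.
  rewrite mulrC -symb_cons; apply: (@symb_fld0 l); first by rewrite /= sk.
  by move=> d; rewrite inE => /orP[/eqP-> //|/hk].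
have lp : fld l ((z ^+ 2 + c * c') / (c + c')).
  by apply: subdiv => //; apply: subD => //; [exact: sub_sqr | exact: subM].
exists ((z ^+ 2 + c * c') / (c + c')) => //.
rewrite -(s_absorb e0 (new0 lp) ke).
have -> : (c + c') * (z + (z ^+ 2 + c * c') / (c + c')) = (z + c) * (z + c') by field.
rewrite sM ?new0 // !mulrDr -mulrA (mulrCA _ eta) s_key.
have -> : z + c + (z + c') = c + c' by rewrite addrACA (addFF two0) add0r.
by rewrite (mulrA (symb k) (s (c + c'))) ke mul0r mulr0 addr0.
Qed.

(** By [linking] the symbols are {mu, t, u} and {mu, T, u'} with u = z + c, u' = z + c'. Scaling u
    and u' by g gives both the common slot g (z + d), and the sum becomes {mu, g (z + d), e (z +
    p)}, the product of the two other slots being e (z + p) up to a square. Expanding by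
    [s_prod_expand] leaves a multiple of [z + d] and one of [z + p]; the latter is zero by the
    choice of T. *)
Lemma top_sum k k' c c' : flag l k -> flag l k' -> fld l c -> fld l c' ->
  exists w d, [/\ symspan (fld l) (size l)%:Z w, fld l d
    & symb k * s (z + c) + symb k' * s (z + c') = w * s (z + d)].
Proof.
move=> hk hk' lc lc'.
have Sk q : flag l q -> symspan (fld l) (size l)%:Z (symb q).
  by move=> hq; rewrite -(flag_size hq); apply: symspan_sy; exact: adapted_fld hq.
have [cc|cc] := eqVneq c c'.
  exists (symb k + symb k'), c; split=> //; last by rewrite -cc mulrDl.
  by apply: symspanD; exact: Sk.
have e0 : c + c' != 0 by rewrite (addF_eq0 two0).
have [kk|kk] := eqVneq (symb k) (symb k').
  have [d ld E] := sum_eq cc lc lc' (adapted_fld hk) (flag_size hk).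
  by exists (symb k), d; split; [exact: Sk | | rewrite -kk].
have l0 : l != [::].
  apply: contra_neq kk => l0; move: hk hk'; rewrite l0.
  by case: k => // _; case: k' => // _.
have [mu [t [t' [[sm ml] [lt nt tl] [lt' nt' tl'] E E']]]] := linking l0 hk hk'.
have sL := fld_sub two0 mu.
have t0 := new_neq0 sL nt.
have [a [b [a_mu b_mu t'E]]] := tl _ lt'.
have b0 : b != 0.
  by apply/eqP=> b0; apply: nt'; rewrite t'E b0 mul0r addr0.
have N1 d : fld mu d -> symb mu * s d = 0 by exact: symb_mul_fld.
have a0 : a != 0.
  apply: contra_neq kk => a0; rewrite E E' t'E a0 add0r.
  by rewrite s_absorb // N1.
pose u := z + c; pose u' := z + c'.
have u0 : u != 0 by exact: new0.
have u0' : u' != 0 by exact: new0.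
(* Scaling t' by r does not change {mu, t'} and puts r t' u^2 + t u'^2 in fld mu,
   which kills one of the two symbols that remain at the end. *)
pose r := u' ^+ 2 / (u ^+ 2 * b).
have r_mu : fld mu r.
  by apply: subdiv => //; [exact: sub_sqr | apply: subM => //; exact: sub_sqr].
have r0 : r != 0 by rewrite mulf_neq0 ?invr_eq0 ?mulf_neq0 ?expf_neq0.
have t0' := new_neq0 sL nt'.
pose T := r * t'.
have T0 : T != 0 by exact: mulf_neq0.
have lT : fld l T by apply: subM => //; exact: ml.
have {}E' : symb k' = symb mu * s T by rewrite E' s_absorb // N1.
have g0 : t + T != 0.
  by rewrite (addF_eq0 two0); apply: contra_neq kk => tT; rewrite E E' tT.
have [g gE] : exists g, g = (t + T) / (c + c') by eexists.
have g1 : g != 0 by rewrite gE mulf_neq0 ?invr_neq0.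
have le : fld l (c + c') by exact: subD.
have lg : fld l g by rewrite gE; apply: subdiv => //; exact: subD.
(* Chosen so that t + g u = T + g u' = g (z + d) and u u' = (c + c')(z + p). *)
pose d := c + t / g; pose p := (z ^+ 2 + c * c') / (c + c').
have ld : fld l d by apply: subD => //; exact: subdiv.
have lp : fld l p.
  by apply: subdiv => //; apply: subD => //; [exact: sub_sqr | exact: subM].
have rho : g * (d + p) = u' ^+ 2 * (a / b) / (c + c') ^+ 2.
  have two x : 2%:R * x = 0 :> F by rewrite two0 mul0r.
  have rhoE : T * u ^+ 2 + t * u' ^+ 2 = u' ^+ 2 * (a / b).
    transitivity (u' ^+ 2 * (a / b) + 2%:R * (t * u' ^+ 2)); last by rewrite two addr0.
    by rewrite /T /r t'E; field; apply/andP.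
  rewrite -rhoE; apply: (canRL (mulfK (expf_neq0 2 e0))).
  transitivity (T * (z ^+ 2 + c ^+ 2 + 2%:R * (c * c')) +
    t * (z ^+ 2 + c' ^+ 2 + 2%:R * (c ^+ 2 + 2%:R * c * c'))).
    by rewrite /d /p gE; field; apply/andP; split.
  by rewrite /u /u' !(sqrFD two0) !two !addr0.
have rho0 : g * (d + p) != 0.
  by rewrite rho !mulf_neq0 ?invr_neq0 ?expf_neq0.
have gp0 : d + p != 0 by apply: contra_neq rho0 => ->; rewrite mulr0.
have wE : t + g * u = g * (z + d) by rewrite /u /d; field.
have wE' : T + g * u' = g * (z + d).
  apply/eqP; rewrite -(addF_eq0 two0) -wE /u /u'.
  rewrite (_ : _ + _ = t + T + g * (c + c') + (g * z + g * z)); last by ring.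
  by rewrite gE mulfVK // !(addFF two0).
pose e := (c + c') * t * T.
have le' : fld l e by rewrite /e; apply: subM => //; exact: subM.
have ee0 : e != 0 := mulf_neq0 (mulf_neq0 e0 t0) T0.
have ltV x y : fld l x -> fld l y -> symb mu * s x * s y = 0.
  move=> lx ly; rewrite (_ : _ * _ = s x * (s y * symb mu)); last by ring.
  rewrite -!symb_cons; apply: (@symb_fld0 l).
    by rewrite /= sm.
  move=> v; rewrite !inE => /or3P[/eqP->|/eqP->|] //.
  by move=> vmu; apply: ml; exact: mem_fld.
have lmu v : v \in mu -> adj (fld l) z v.
  by move=> vmu; apply: (sub_adj sl); apply: ml; exact: mem_fld.
have N3 x y v : adj (fld l) z x -> adj (fld l) z y -> adj (fld l) z v ->
    symb mu * s x * s y * s v = 0.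
  move=> hx hy hv.
  rewrite (_ : _ * _ = s x * (s y * (s v * symb mu))); last by ring.
  rewrite -!symb_cons; apply: (@symb_fld0 (z :: l)); first by rewrite /= sm.
  by move=> i; rewrite !inE => /or4P[/eqP->|/eqP->|/eqP->|/lmu].
have zY x : fld l x -> adj (fld l) z x by exact: sub_adj.
have zc x : fld l x -> adj (fld l) z (z + x) by exact: adj_shift.
have sz := adj_sub sl z.
have gu0 := mulf_neq0 g1 u0; have gu0' := mulf_neq0 g1 u0'.
have zd0 := new0 ld; have zp0 := new0 lp.
exists (symb mu * (s e + s (d + p))), d; split=> //.
  have Smu : symspan (fld l) (size mu)%:Z (symb mu).
    by apply: symspan_sy => v vmu; apply: ml; exact: mem_fld.
  apply: (@symspanMe _ (size mu)%:Z 1 _ _ _ _ Smu); first by rewrite sm -addn1 PoszD.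
  by apply: symspanD; apply: symspan_s => //; exact: subD.
rewrite E E' -/u -/u' -(s_absorb g1 u0 (ltV _ _ lt lg)) -(s_absorb g1 u0' (ltV _ _ lT lg)).
rewrite -!mulrA (s_slot t0 gu0) (s_slot T0 gu0') wE wE' !(mulrA (symb mu)) -mulrDr.
have -> : symb mu * s (g * (z + d)) * (s (t * (g * u)) + s (T * (g * u'))) =
    symb mu * s (g * (z + d)) * s ((t * (g * u)) * (T * (g * u'))).
  rewrite (sM (mulf_neq0 t0 gu0) (mulf_neq0 T0 gu0')).
  set S1 := s (t * _); set S2 := s (T * _).
  transitivity (symb mu * s (g * (z + d)) * (S1 + S2)
    + eta * (symb mu * s (g * (z + d)) * S1 * S2)); last by ring.
  rewrite N3 ?mulr0 ?addr0 //; apply: subM => //; try exact: zY; try exact: zc.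
  - by apply: subM; [exact: sz | exact: zY | exact: zc].
  - by apply: subM; [exact: sz | exact: zY | exact: zc].
have -> : t * (g * u) * (T * (g * u')) = e * (z + p) * g ^+ 2.
  by rewrite /e /p /u /u'; field.
rewrite s_Msqr // -mulrA sM // sM //.
rewrite (@s_prod_expand _ (s (d + p))) ?ltV //; last first.
- by rewrite s_key addrACA (addFF two0) add0r.
- exact: subD.
- exact: subD.
have gdp : symb mu * (s g + s (d + p)) = 0.
  have : symb mu * s (g * (d + p)) = 0.
    apply: N1; rewrite rho; apply: subdiv => //; last exact: sub_sqr.
    by apply: subM => //; [exact: sub_sqr | exact: subdiv].
  rewrite sM // mulrDr (_ : symb mu * (eta * _ * _) = eta * (symb mu * s g * s (d + p))).
    by rewrite ltV ?mulr0 ?addr0 //; exact: subD.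
  by ring.
by rewrite gdp mul0r add0r.
Qed.

(** The terms are added one at a time: [top_sum] writes the sum of two symbols as w [z + d], and the
    hypothesis on [l] turns w into a single symbol or 0. *)
Lemma symspan_top_step : (forall w, symspan (fld l) (size l)%:Z w ->
    w = 0 \/ exists2 q, flag l q & w = symb q) ->
  forall w, symspan (fld (z :: l)) (size (z :: l))%:Z w ->
    w = 0 \/ exists2 q, flag (z :: l) q & w = symb q.
Proof.
move=> IH w /(symspan_adj sl).
have E : (size (z :: l))%:Z - 1 = (size l)%:Z by rewrite /= -addn1 PoszD addrK.
have fl c k : fld l c -> flag l k -> flag (z :: l) ((z + c) :: k).
  by move=> lc hk; split=> //; [exact: adj_shift | exact: top_new].
elim=> [y hy|u c y].
  by left; apply: (@symspan_fld0 l) hy; rewrite /= -addn1 PoszD; lia.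
rewrite E => hu lc _ IHy; case: (IH _ hu) => [->|[k hk ->]]; first by rewrite mul0r add0r.
case: IHy => [->|[[|v k'] hq ->]].
- by right; exists ((z + c) :: k); [exact: fl | rewrite addr0 symb_cons mulrC].
- by [].
case: hq => hv nv hk'; rewrite -/(flag l k') in hk'.
have [a [c' [la a0 lc' Ev]]] := adj_newP sl hv nv.
have -> : symb (v :: k') = symb k' * s (z + c').
  rewrite symb_cons mulrC Ev s_absorb ?new0 //.
  rewrite mulrC -symb_cons; apply: (@symb_fld0 l); first by rewrite /= (flag_size hk').
  by move=> d; rewrite inE => /orP[/eqP-> //|/(adapted_fld hk')].
have [w' [d [hw' ld ->]]] := top_sum hk hk' lc lc'.
case: (IH _ hw') => [->|[q hq ->]]; first by left; rewrite mul0r.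
by right; exists ((z + d) :: q); [exact: fl | rewrite symb_cons mulrC].
Qed.
End Top.

Lemma symspan_top zs w : symspan (fld zs) (size zs)%:Z w ->
  w = 0 \/ exists2 q, flag zs q & w = symb q.
Proof.
elim: zs w => [|z l IH] w.
  elim=> [|u v _ hu _ hv|j q h e]; first by left.
    case: hu => [->|[[|//] _ ->]]; first by rewrite add0r.
    case: hv => [->|[[|//] _ ->]]; first by rewrite addr0; right; exists [::].
    by left; rewrite addBB.
  case: q h e => [|a q] h e.
    by right; exists [::] => //; case: j e => // _; rewrite expr0 mul1r.
  by have [b ->] := h a (mem_head _ _); left; rewrite symb_cons s_of_sqr mul0r mulr0.
(* If [z] is redundant, the degree exceeds the number of generators in [l] and everything
   vanishes. *)
have [lz|nz] := pselect (fld l z); last exact: (symspan_top_step nz IH).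
move=> hw; left; apply: (@symspan_fld0 l (size (z :: l))%:Z); first by rewrite /=; lia.
apply: symspan_sub hw => a; apply: adj_least => //; exact: fld_sub.
Qed.

(** * The lexicographic filtration by sets of levels *)

Fixpoint maskval (b : seq bool) : nat :=
  if b is c :: b' then (c * 2 ^ size b' + maskval b')%N else 0%N.

Lemma maskval_lt b : (maskval b < 2 ^ size b)%N.
Proof.
elim: b => [//|c b IH] /=; rewrite expnS mul2n -addnn.
by case: c => /=; [rewrite mul1n ltn_add2l | rewrite mul0n add0n ltn_addl].
Qed.

Lemma maskval_inj b b' : size b = size b' -> maskval b = maskval b' -> b = b'.
Proof.
elim: b b' => [|c b IH] [|c' b'] //= [sb]; rewrite sb.
have := maskval_lt b; have := maskval_lt b'; rewrite sb => h' h e.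
suff cc : c = c' by move: e; rewrite cc => /addnI /(IH _ sb) ->.
by move: e; case: c; case: c' => //; rewrite mul1n mul0n; lia.
Qed.

Fixpoint indep (xs : seq F) : Prop :=
  if xs is x :: xs' then ~ fld xs' x /\ indep xs' else True.

Lemma symspan_eta_factor K n z : n < 0 -> symspan K n z ->
  exists2 w, symspan K (n + 1) w & z = eta * w.
Proof.
move=> n0; elim=> [|u v _ [u' hu ->] _ [v' hv ->]|j q h e].
- by exists 0; [exact: symspan0 | rewrite mulr0].
- by exists (u' + v'); [exact: symspanD | rewrite mulrDr].
case: j e => [|j] e; first by move: n0; lia.
by exists (eta ^+ j * symb q); [apply: symspanG => //; lia | rewrite exprS mulrA].
Qed.

(* The span of the symbols whose mask is below k in the binary order (top level
   most significant), modulo multiples of eta. *)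
Inductive maskspan (xs : seq F) (k n : nat) : B -> Prop :=
| maskspan0 : maskspan xs k n 0
| maskspanD u v : maskspan xs k n u -> maskspan xs k n v -> maskspan xs k n (u + v)
| maskspanE w : symspan (fld xs) n.+1%:Z w -> maskspan xs k n (eta * w)
| maskspanG b q : adapted xs b q -> (maskval b < k)%N -> size q = n -> maskspan xs k n (symb q).

Lemma maskspan_mono xs k k' n z : (k <= k')%N -> maskspan xs k n z -> maskspan xs k' n z.
Proof.
move=> kk; elim=> [|u v _ hu _ hv|w h|b q h hk e];
  [exact: maskspan0 | exact: maskspanD | exact: maskspanE | ].
by apply: maskspanG h _ e; exact: leq_trans hk kk.
Qed.

Lemma maskspan_cons x xs k n z : maskspan xs k n z -> maskspan (x :: xs) k n z.
Proof.
elim=> [|u v _ hu _ hv|w h|b q h hk e]; [exact: maskspan0 | exact: maskspanD | apply: maskspanE|].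
  by apply: symspan_sub h => a; apply: sub_adj; exact: fld_sub.
exact: (@maskspanG _ _ _ (false :: b)).
Qed.

Lemma maskspan_s x xs k n u w : adj (fld xs) x u -> ~ fld xs u -> maskspan xs k n w ->
  maskspan (x :: xs) (2 ^ size xs + k) n.+1 (s u * w).
Proof.
move=> xu nu; elim=> [|v v' _ hv _ hv'|v h|b q h hk e].
- by rewrite mulr0; exact: maskspan0.
- by rewrite mulrDr; exact: maskspanD.
- rewrite mulrCA; apply: maskspanE; apply: (@symspanMe _ 1 n.+1%:Z); first by lia.
    exact: symspan_s.
  by apply: symspan_sub h => a; apply: sub_adj; exact: fld_sub.
rewrite -symb_cons; apply: (@maskspanG _ _ _ (true :: b)); rewrite /= ?e //.
by have [-> _] := adapted_size h; rewrite mul1n ltn_add2l.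
Qed.

(** The bound [2 ^ size xs] excludes no mask. Adapted form is reached level by level, since
    [adjspan] leaves at most one slot at the top. *)
Lemma symspan_maskspan xs n z : indep xs ->
  symspan (fld xs) n%:Z z -> maskspan xs (2 ^ size xs) n z.
Proof.
elim: xs n z => [|x xs IH] n z.
  move=> _; elim=> [|u v _ hu _ hv|j [|a q] h e]; [exact: maskspan0 | exact: maskspanD | |].
    case: j e => [|j] /= e; last by lia.
    rewrite expr0 mul1r; apply: (@maskspanG _ _ _ [::]) => //=; lia.
  have [b ->] := h a (mem_head _ _); rewrite symb_cons s_of_sqr mul0r mulr0; exact: maskspan0.
move=> [nx ix]; have sX := fld_sub two0 xs; move/(symspan_adj sX); elim=> [y hy|w c y hw Kc _ hy].
  by apply: maskspan_mono (maskspan_cons x (IH _ _ ix hy)); rewrite leq_exp2l //=.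
apply: maskspanD hy; case: n hw => [|n] hw.
  (* Here [w] has degree -1, so that the term is a multiple of eta. *)
  have [w' hw' ->] := symspan_eta_factor (isT : 0%:Z - 1 < 0) hw.
  rewrite -mulrA; apply: maskspanE; apply: (@symspanMe _ 0 1) => //.
    by apply: symspan_sub hw' => a; exact: sub_adj.
  by apply/symspan_s/adj_shift.
have {}hw : maskspan xs (2 ^ size xs) n w.
  by apply: IH => //; rewrite (_ : n%:Z = n.+1%:Z - 1) //; lia.
rewrite mulrC (_ : 2 ^ _ = 2 ^ size xs + 2 ^ size xs)%N.
  by apply: maskspan_s => //; [exact: adj_shift | exact: adj_new].
by rewrite /= expnS mul2n -addnn.
Qed.

(** In the expansion of [a u], the term with [a] alone has no slot at the top level and is therefore
    lower in the order; the last term is a multiple of eta. *)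
Lemma maskspan_slot x xs b k k1 a u n : indep (x :: xs) ->
  {in k, forall a, fld xs a} -> size k = n -> {in k1, forall a, fld xs a} ->
  fld xs a -> a != 0 -> adj (fld xs) x u -> ~ fld xs u ->
  maskspan xs (maskval b) n (symb k + symb k1) -> size b = size xs ->
  maskspan (x :: xs) (2 ^ size xs + maskval b) n.+1 (symb (a * u :: k) + symb (u :: k1)).
Proof.
move=> ind hk sk hk1 xa a0 xu nu hU sb.
have sX := fld_sub two0 xs.
have u0 := new_neq0 sX nu.
have Sk : symspan (fld xs) n%:Z (symb k) by rewrite -sk; exact: symspan_sy.
rewrite !symb_cons sM // (_ : _ + _ = s a * symb k + s u * (symb k + symb k1) +
  eta * (s a * s u * symb k)); last by ring.
apply: maskspanD; first apply: maskspanD.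
- apply: (@maskspan_mono _ (2 ^ size xs)); first exact: leq_addr.
  apply/maskspan_cons/symspan_maskspan; first by case: ind.
  by apply: (@symspanMe _ 1 n%:Z) => //; exact: symspan_s.
- exact: maskspan_s.
apply: maskspanE; apply: (@symspanMe _ 2 n%:Z); first by lia.
  by apply: (@symspanMe _ 1 1) => //; apply: symspan_s => //; exact: sub_adj.
by apply: symspan_sub Sk => c; exact: sub_adj.
Qed.

(* If u = z + c and u' = z + c' with e = c + c', then u/e and u'/e differ by 1, so
   that they generate the same field; scaling by 1/e changes a symbol by lower ones. *)
Lemma common_flag xs b k k' : indep xs -> adapted xs b k -> adapted xs b k' ->
  exists zs k1 k1', [/\ adapted xs b zs, flag zs k1, flag zs k1',
    maskspan xs (maskval b) (size k) (symb k + symb k1)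
  & maskspan xs (maskval b) (size k) (symb k' + symb k1')].
Proof.
elim: xs b k k' => [|x xs IH] [|[] b] k k' //= ind.
- case: k => // _; case: k' => // _; exists [::], [::], [::].
  by split=> //; rewrite addBB; exact: maskspan0.
- case: k => // u k [xu nu hk]; case: k' => // u' k' [xu' nu' hk'].
  have [nx ix] := ind; have sX := fld_sub two0 xs.
  have [zs [k1 [k1' [hzs f1 f1' U1 U1']]]] := IH _ _ _ ix hk hk'.
  have [sb sk] := adapted_size hk; have [_ sk'] := adapted_size hk'.
  have [a [c [xa a0 xc Eu]]] := adj_newP sX xu nu.
  have [a' [c' [xa' a0' xc' Eu']]] := adj_newP sX xu' nu'.
  have zx d : fld zs d -> fld xs d := sub_fld sX (adapted_fld hzs) (y := d).
  have k1x : {in k1, forall d, fld xs d} by move=> d /(adapted_fld f1)/zx.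
  have k1x' : {in k1', forall d, fld xs d} by move=> d /(adapted_fld f1')/zx.
  rewrite sb mul1n /=.
  have gen z e : adj (fld xs) x z -> ~ fld xs z -> fld zs e -> flag (z :: zs) (z + e :: k1')
      /\ flag (z :: zs) (z :: k1).
    move=> xz nz ze; have sZ := fld_sub two0 zs; have nzs : ~ fld zs z by move/zx.
    split; split=> //; [exact: adj_shift | exact: adj_new | exact: adj_gen].
  have [cc|cc] := eqVneq c c'.
    have xz : adj (fld xs) x (x + c) by exact: adj_shift.
    have nz : ~ fld xs (x + c) by exact: adj_new.
    have [h h'] := gen _ _ xz nz (sub0 (fld_sub two0 zs)); rewrite addr0 in h.
    exists (x + c :: zs), (x + c :: k1), (x + c :: k1'); split=> //.
      by rewrite Eu; apply: maskspan_slot => //; exact: adapted_fld hk.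
    rewrite Eu' -cc; apply: maskspan_slot => //; first exact: adapted_fld hk'.
    by rewrite sk sk'.
  have e0 : c + c' != 0 by rewrite (addF_eq0 two0).
  have xe : fld xs (c + c') by exact: subD.
  pose z := (x + c) / (c + c').
  have xz : adj (fld xs) x z.
    apply: subM; [exact: adj_sub | exact: adj_shift |].
    by apply: sub_adj => //; exact: subV.
  have nz : ~ fld xs z.
    move=> h; apply: (adj_new two0 sX nx xc).
    by rewrite -(mulfVK e0 (x + c)); exact: subM.
  have [h h'] := gen _ _ xz nz (sub1 (fld_sub two0 zs)).
  have z1 : z + 1 = (x + c') / (c + c').
    rewrite -{1}(divff e0) -mulrDl addrACA addrA (addrAC x) -addrA (addFF two0) addr0.
    by [].
  exists (z :: zs), (z :: k1), (z + 1 :: k1'); split=> //.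
    rewrite (_ : u = a * (c + c') * z); last by rewrite Eu /z; field.
    by apply: maskspan_slot; rewrite ?mulf_neq0 //; [exact: adapted_fld hk | exact: subM].
  rewrite (_ : u' = a' * (c + c') * (z + 1)); last by rewrite Eu' z1; field.
  apply: maskspan_slot; rewrite ?mulf_neq0 ?sk ?sk' -?sk //; first exact: adapted_fld hk'.
  - exact: subM.
  - by apply: subD => //; [exact: adj_sub | apply: sub_adj => //; exact: sub1].
  - by apply: adj_new => //; exact: sub1.
move=> hk hk'; have [zs [k1 [k1' [hzs f1 f1' U1 U1']]]] := IH _ _ _ ind.2 hk hk'.
by exists zs, k1, k1'; split=> //; rewrite mul0n; exact: maskspan_cons.
Qed.

(** Up to lower terms both symbols have top degree over the common field fld zs, where [symspan_top]
    applies to their sum. *)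
Lemma adapted_sum xs b k k' : indep xs -> adapted xs b k -> adapted xs b k' ->
  exists2 w, w = 0 \/ exists2 q, adapted xs b q & w = symb q
    & maskspan xs (maskval b) (size k) (symb k + symb k' + w).
Proof.
move=> ind hk hk'.
have [zs [k1 [k1' [hzs f1 f1' U1 U1']]]] := common_flag ind hk hk'.
have Sf q : flag zs q -> symspan (fld zs) (size zs)%:Z (symb q).
  by move=> hq; rewrite -(flag_size hq); apply: symspan_sy; exact: adapted_fld hq.
exists (symb k1 + symb k1'); last by rewrite addrACA; exact: maskspanD.
have [->|[q hq ->]] := symspan_top (symspanD (Sf _ f1) (Sf _ f1')); first by left.
by right; exists q => //; exact: adapted_flag hq.
Qed.

(** All terms of value [k] have the same mask by [maskval_inj], so [adapted_sum] merges them into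
    one leading symbol. *)
Lemma maskspan_succ xs k n z : indep xs -> maskspan xs k.+1 n z ->
  exists2 w, w = 0 \/ exists b q, [/\ adapted xs b q, maskval b = k, size q = n & w = symb q]
    & maskspan xs k n (z + w).
Proof.
move=> ind; elim=> [|u v _ [w hw Uw] _ [w' hw' Uw']|w h|b q h hk e].
- by exists 0; [left | rewrite addr0; exact: maskspan0].
- case: hw Uw => [->|[b [q [hq kb sq ->]]]] Uw.
    by exists w' => //; rewrite addr0 in Uw; rewrite -addrA; exact: maskspanD.
  case: hw' Uw' => [->|[b' [q' [hq' kb' sq' ->]]]] Uw'.
    exists (symb q); first by right; exists b, q.
    by rewrite addr0 in Uw'; rewrite addrAC; exact: maskspanD.
  have bb : b = b'.
    by apply: maskval_inj; rewrite ?kb ?kb' // (adapted_size hq).1 (adapted_size hq').1.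
  rewrite -bb in hq'; have [y hy Uy] := adapted_sum ind hq hq'.
  exists y.
    case: hy => [->|[r hr ->]]; [by left | right; exists b, r; split=> //].
    by rewrite (adapted_size hr).2 -sq (adapted_size hq).2.
  rewrite kb sq in Uy.
  rewrite (_ : _ + y = u + symb q + (v + symb q') + (symb q + symb q' + y)).
    by apply: maskspanD => //; exact: maskspanD.
  rewrite (addrACA u) -[RHS]addrA; congr (_ + _).
  by rewrite addrA addBB add0r.
- by exists 0; [left | rewrite addr0; exact: maskspanE].
have [bk|bk] := eqVneq (maskval b) k.
  by exists (symb q); [right; exists b, q | rewrite addBB; exact: maskspan0].
by exists 0; [left | rewrite addr0; apply: maskspanG h _ e; move: hk bk; lia].
Qed.

(* Z is to be the vanishing in W(F); hZ says that it detects leading symbols. *)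
Lemma maskspan_descend (Z : B -> Prop) xs k n z : indep xs ->
  (forall b q y, adapted xs b q -> size q = n -> maskspan xs (maskval b) n y -> ~ Z (symb q + y)) ->
  Z z -> maskspan xs k n z -> exists2 w, symspan (fld xs) n.+1%:Z w & z = eta * w.
Proof.
move=> ind hZ Zz; elim: k => [|k IH].
  elim=> [|u v _ [u' hu ->] _ [v' hv ->]|w h|b q _ //].
  - by exists 0; [exact: symspan0 | rewrite mulr0].
  - by exists (u' + v'); [exact: symspanD | rewrite mulrDr].
  - by exists w.
move/(maskspan_succ ind)=> [w [->|[b [q [hq kb sq ->]]]]]; first by rewrite addr0.
rewrite -kb => /(hZ _ _ _ hq sq) []; by rewrite addrCA addBB addr0.
Qed.

Lemma indep_cover (t : seq F) : exists2 xs, indep xs & {in t, forall a, fld xs a}.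
Proof.
elim: t => [|a t [xs ix hx]]; first by exists [::].
have [xa|na] := pselect (fld xs a).
  by exists xs => // b; rewrite inE => /orP[/eqP-> //|/hx].
exists (a :: xs) => // b; rewrite inE => /orP[/eqP->|/hx] //=.
  exact: (adj_gen (fld_sub two0 xs)).
by apply: sub_adj; exact: fld_sub.
Qed.

Lemma symspan_cover n z : symspan (fun=> True) n z -> exists2 t : seq F,
  True & forall K, {in t, forall a, K a} -> symspan K n z.
Proof.
elim=> [|u v _ [t _ ht] _ [t' _ ht']|j q _ e].
- by exists [::] => // K _; exact: symspan0.
- exists (t ++ t') => // K h; apply: symspanD.
    by apply: ht => a at_; apply: h; rewrite mem_cat at_.
  by apply: ht' => a at_; apply: h; rewrite mem_cat at_ orbT.
by exists q => // K h; exact: symspanG.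
Qed.

End Symbols.

(** * Differential operators *)

Section Detection.
Variable F : fieldType.
Hypothesis two0 : 2%:R = 0 :> F.

Definition deriv (D : F -> F) : Prop :=
  (forall a b, D (a + b) = D a + D b) /\ (forall a b, D (a * b) = D a * b + a * D b).

Lemma deriv_sqr D a : deriv D -> D (a ^+ 2) = 0.
Proof. by move=> [_ h]; rewrite expr2 h mulrC (addFF two0). Qed.

(* With M maximal among the subfields containing K but not x, F = M + M x and
   one takes the derivation a + b x |-> b. *)
Lemma deriv_ex (K : F -> Prop) x : sqsubfield K -> ~ K x ->
  exists D, [/\ deriv D, forall a, K a -> D a = 0 & D x = 1].
Proof.
move=> sK nx.
(* The union with [K] lets the empty chain, whose union is empty, satisfy the hypothesis of Zorn's
   lemma. *)
pose P (M : set F) := sqsubfield (fun a => M a \/ K a) /\ ~ M x.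
have [|M [[sM nMx] maxM]] := @Zorn_bigcup F P.
  move=> C CP tot; split; last by move=> [X CX Xx]; case: (CP _ CX) => _; apply.
  have up X a : C X -> X a \/ K a -> (\bigcup_(X in C) X)%classic a \/ K a.
    by move=> CX [Xa|]; [left; exists X | right].
  have two a b : (\bigcup_(X in C) X)%classic a \/ K a -> (\bigcup_(X in C) X)%classic b \/ K b ->
      (K a /\ K b) \/ exists2 X, C X & (X a \/ K a) /\ (X b \/ K b).
    move=> [[X CX Xa]|Ka] [[Y CY Yb]|Kb].
    - right; case: (tot _ _ CX CY) => h.
        by exists Y => //; split; left=> //; exact: h.
      by exists X => //; split; left=> //; exact: h.
    - by right; exists X => //; split; [left | right].
    - by right; exists Y => //; split; [right | left].
    - by left.
  split=> [a|a b ha hb|a b ha hb]; first by right; exact: sub_sqr.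
    case: (two _ _ ha hb) => [[Ka Kb]|[X CX [Xa Xb]]]; first by right; exact: subD.
    by apply: (up X) => //; case: (CP _ CX) => sX _; exact: (subD sX).
  case: (two _ _ ha hb) => [[Ka Kb]|[X CX [Xa Xb]]]; first by right; exact: subM.
  by apply: (up X) => //; case: (CP _ CX) => sX _; exact: (subM sX).
pose L a := M a \/ K a.
have nLx : ~ L x by case.
have full y : adj L x y.
  have [Ly|nLy] := pselect (L y); first exact: sub_adj.
  have [hx|hx] := pselect (adj L y x); first exact: adj_exchange.
  exfalso; apply: (maxM (adj L y)).
    split; last by move=> /(_ y (adj_gen sM y)) My; apply: nLy; left.
    by move=> a Ma; apply: (sub_adj sM); left.
  split=> //; have -> : (fun a => adj L y a \/ K a) = adj L y; last exact: adj_sub.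
  apply/funext=> a; apply/propext; split=> [[//|Ka]|h]; last by left.
  by apply: (sub_adj sM); right.
have uniq a b a' b' : L a -> L b -> L a' -> L b' -> a + b * x = a' + b' * x -> b = b'.
  move=> La Lb La' Lb' e; apply/eqP; rewrite -(addF_eq0 two0).
  apply: contra_notT nLx => b0.
  rewrite -(mulKf b0 x); apply: (subM sM); first by apply: (subV sM); exact: (subD sM).
  suff -> : (b + b') * x = a + a' by exact: (subD sM).
  apply/eqP; rewrite -(addF_eq0 two0) (_ : _ + _ = a + b * x + (a' + b' * x)); last by ring.
  by rewrite e (addFF two0).
have /choice[D hD] : forall y, exists b, exists2 a, L a /\ L b & y = a + b * x.
  by move=> y; have [a [b [La Lb ->]]] := full y; exists b, a.
have DE a b : L a -> L b -> D (a + b * x) = b.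
  by move=> La Lb; have [a' [La' Lb'] /esym] := hD (a + b * x); exact: uniq.
have DK a : K a -> D a = 0.
  move=> Ka; have -> : D a = D (a + 0 * x) by rewrite mul0r addr0.
  apply: DE; first by right.
  exact: (sub0 sM).
exists D; split=> //; last first.
  have -> : D x = D (0 + 1 * x) by rewrite add0r mul1r.
  by apply: DE; [exact: (sub0 sM) | exact: (sub1 sM)].
split=> a b; have [a' [La' Lb'] Ea] := hD a; have [b' [Lc' Ld'] Eb] := hD b.
  rewrite {1}Ea {1}Eb addrACA -mulrDl; apply: DE; exact: (subD sM).
set d := D a in Ea Lb' *; set e := D b in Eb Ld' *.
have -> : a * b = (a' * b' + d * e * x ^+ 2) + (d * b' + a' * e) * x.
  by rewrite Ea Eb; ring.
rewrite DE.
- rewrite Ea Eb [RHS](_ : _ = d * b' + a' * e + (d * e * x + d * e * x)); last by ring.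
  by rewrite (addFF two0) addr0.
- by apply: (subD sM); apply: (subM sM) => //; [exact: (subM sM) | exact: (sub_sqr sM)].
- by apply: (subD sM); exact: (subM sM).
Qed.

Definition sqlin (f : F -> F) : Prop :=
  (forall a b, f (a + b) = f a + f b) /\ (forall a b, f (a ^+ 2 * b) = a ^+ 2 * f b).

(** This is y^(-1) [f, y], the commutator with multiplication by [y], the sign being irrelevant in
    characteristic 2. *)
Definition ad (y : F) (f : F -> F) : F -> F := fun u => y^-1 * f (y * u) + f u.

Fixpoint adl (f : F -> F) (q : seq F) : F -> F :=
  if q is y :: q' then adl (ad y f) q' else f.

(* f is a differential operator of order at most k. *)
Fixpoint dord (k : nat) (f : F -> F) : Prop :=
  if k is k'.+1 then forall y, y != 0 -> dord k' (ad y f)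
  else forall u, f u = u * f 1.

Lemma sqlin_ad y f : sqlin f -> sqlin (ad y f).
Proof.
move=> [fD fM]; split=> a b; rewrite /ad ?mulrDr ?fD; first by ring.
by rewrite mulrCA !fM; ring.
Qed.

Lemma adC y z f : ad y (ad z f) = ad z (ad y f).
Proof. by apply/funext=> u; rewrite /ad (mulrCA z y); ring. Qed.

Lemma adl_ad y f q : adl (ad y f) q = ad y (adl f q).
Proof. by elim: q f => //= z q IH f; rewrite adC IH. Qed.

Lemma dord_adl k j f q : dord (k + j) f -> size q = k -> {in q, forall y, y != 0} ->
  dord j (adl f q).
Proof.
elim: q k f => [|y q IH] [|k] f //= h [e] hq.
apply: (IH k) => //; first by apply: h; apply: hq; rewrite inE eqxx.
by move=> z zq; apply: hq; rewrite inE zq orbT.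
Qed.

Lemma ad_dord0 y f : dord 0 f -> y != 0 -> ad y f = fun=> 0.
Proof.
move=> h y0; apply/funext=> u; rewrite /ad h [f u]h -mulrA mulKf //.
exact: addFF.
Qed.

Lemma adl_dord k f q : dord k f -> size q = k.+1 -> {in q, forall y, y != 0} ->
  adl f q 1 = 0.
Proof.
case: q => // y q h [e] hq; rewrite /= adl_ad ad_dord0 //; last first.
  by apply: hq; rewrite inE eqxx.
apply: (@dord_adl k); rewrite ?addn0 // => z zq.
by apply: hq; rewrite inE zq orbT.
Qed.

Lemma dordD k f g : dord k f -> dord k g -> dord k (fun u => f u + g u).
Proof.
elim: k f g => [|k IH] f g /=; first by move=> hf hg u; rewrite hf hg mulrDr.
move=> hf hg y y0; rewrite (_ : ad y _ = fun u => ad y f u + ad y g u).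
  by apply: IH; [exact: hf | exact: hg].
by apply/funext=> u; rewrite /ad; ring.
Qed.

Lemma dordZ k c f : dord k f -> dord k (fun u => c * f u).
Proof.
elim: k f => [|k IH] f /=; first by move=> hf u; rewrite hf mulrCA.
move=> hf y y0; rewrite (_ : ad y _ = fun u => c * ad y f u); first by apply: IH; exact: hf.
by apply/funext=> u; rewrite /ad; ring.
Qed.

Lemma dord0 k : dord k (fun=> 0).
Proof.
elim: k => [|k IH] /= y; first by rewrite mulr0.
by move=> _; rewrite (_ : ad y _ = fun=> 0) //; apply/funext=> u; rewrite /ad mulr0 addr0.
Qed.

Lemma dordS k f : dord k f -> dord k.+1 f.
Proof.
elim: k f => [|k IH] f h; first by move=> y y0; rewrite ad_dord0 //; exact: dord0.
by move=> y y0; apply: IH; exact: h.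
Qed.

(** By the Leibniz rule [ad y] of the composite sends u to ad y E (D u) + y^(-1) E (D y * u), and
    neither term has larger order than [E]: the first by induction, the second because
    multiplications do not raise the order. *)
Lemma dord_comp k E D : (forall a b, E (a + b) = E a + E b) -> dord k E -> deriv D ->
  dord k.+1 (fun u => E (D u)).
Proof.
move=> ED hE hD; have E0 : E 0 = 0.
  by apply: (addrI (E 0)); rewrite -ED !addr0.
elim: k E ED E0 hE => [|k IH] E ED E0 hE y y0.
  rewrite (_ : ad y _ = fun u => y^-1 * (D y * E 1) * u).
    by move=> u; rewrite mulr1 mulrC.
  apply/funext=> u; rewrite /ad; case: hD => _ ->; rewrite ED hE [E (y * _)]hE [E (D u)]hE.
  rewrite (_ : _ + _ = y^-1 * (D y * E 1) * u + (y^-1 * (y * (D u * E 1)) + D u * E 1));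
    last by ring.
  by rewrite mulKf // (addFF two0) addr0.
have -> : ad y (fun u => E (D u)) =
    fun u => ad y E (D u) + y^-1 * E (D y * u).
  by apply/funext=> u; rewrite /ad; case: hD => _ ->; rewrite ED; ring.
apply: (@dordD k.+1).
  apply: IH; [| by rewrite /ad mulr0 E0 mulr0 addr0 | exact: hE].
  by move=> a b; rewrite /ad mulrDr !ED; ring.
have [t0|t0] := eqVneq (D y) 0.
  rewrite (_ : (fun u => _) = fun=> 0); first exact: dord0.
  by apply/funext=> u; rewrite t0 mul0r E0 mulr0.
(* Multiplication by D y is moved out of [E] at the cost of a commutator, which requires D y to be
   nonzero. *)
rewrite (_ : (fun u => _) = fun u => (y^-1 * D y) * (ad (D y) E u + E u)).
  by apply/dordZ/dordD => //; apply: dordS; exact: hE.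
apply/funext=> u; rewrite /ad -addrA (addFF two0) addr0 -!mulrA.
by rewrite mulVKf.
Qed.

Lemma adl_comp (K : F -> Prop) E D q : (forall y u, K y -> D (y * u) = y * D u) ->
  {in q, forall y, K y} -> adl (fun u => E (D u)) q = fun u => adl E q (D u).
Proof.
move=> DK; elim: q E => [//|y q IH] E hq /=.
have -> : ad y (fun u => E (D u)) = fun u => ad y E (D u).
  by apply/funext=> u; rewrite /ad DK //; apply: hq; rewrite inE eqxx.
by apply: IH => z zq; apply: hq; rewrite inE zq orbT.
Qed.

Lemma sqlin_adl f q : sqlin f -> sqlin (adl f q).
Proof. by elim: q f => //= y q IH f hf; apply/IH/sqlin_ad. Qed.

Lemma adapted_neq0 (xs : seq F) b q : adapted xs b q -> {in q, forall y, y != 0}.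
Proof.
elim: xs b q => [|x xs IH] [|[] b] [|y q] //=; last exact: IH.
move=> [_ ny /IH h] z; rewrite inE => /orP[/eqP->|/h //].
exact: (new_neq0 (fld_sub two0 xs) ny).
Qed.

(** At each level in [b], the operator for the lower levels is precomposed with a derivation
    vanishing on the field below. A slot y at this level contributes the factor D(y)/y, while a
    symbol without such a slot is killed because D(1) = 0. *)
Lemma detect xs b : indep xs -> size b = size xs ->
  exists f, [/\ sqlin f, dord (count id b) f,
    forall q, adapted xs b q -> adl f q 1 != 0
  & forall b' q, adapted xs b' q -> (maskval b' < maskval b)%N -> size q = count id b ->
      adl f q 1 = 0].
Proof.
elim: xs b => [|x xs IH] [|c b] //=.
  move=> _ _; exists id; split=> //; first by move=> u; rewrite mulr1.
  by case=> // _; exact: oner_neq0.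
move=> [nx ix] [sb]; have [E [[ED EM] hE nE zE]] := IH _ ix sb.
have sX := fld_sub two0 xs.
case: c => /=; last first.
  exists E; split=> // -[//|[] b'] [|y q] //.
  - move=> [_ _ h] /=; rewrite mul0n mul1n add0n.
    by have [sb' _] := adapted_size h; have := maskval_lt b; rewrite sb sb'; lia.
  - by move=> /zE h /h.
  - by move=> /zE h /h.
have [D [hD DK Dx]] := deriv_ex sX nx.
have D1 : D 1 = 0 by apply: DK; exact: sub1.
have Dlin y u : fld xs y -> D (y * u) = y * D u.
  by move=> Ky; case: hD => _ ->; rewrite DK // mul0r add0r.
have E0 : E 0 = 0 by apply: (addrI (E 0)); rewrite -ED !addr0.
have val b' y q : adapted xs b' q -> size q = count id b -> ~ fld xs y ->
    adl (fun u => E (D u)) (y :: q) 1 = y^-1 * D y * adl E q 1.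
  move=> hq sq ny; rewrite /= adl_ad (adl_comp E Dlin (adapted_fld two0 hq)).
  (* The commutators with [q] use up the order of [E], leaving multiplication by a scalar. *)
  have h : dord 0 (adl E q).
    by apply: (@dord_adl (count id b)); rewrite ?addn0 //; exact: adapted_neq0 hq.
  by rewrite /ad mulr1 D1 h [adl E q 0]h mul0r addr0 mulrA.
exists (fun u => E (D u)); split.
- split=> u v; first by case: hD => -> _; rewrite ED.
  case: hD => hA hM; have hD : deriv D by [].
  by rewrite hM deriv_sqr // mul0r add0r EM.
- exact: dord_comp.
- case=> [|y q] // [xy ny hq]; rewrite (val b) ?(adapted_size hq).2 //.
  have [a [d [xa a0 xd Ey]]] := adj_newP sX xy ny.
  rewrite !mulf_neq0 ?nE // ?invr_neq0 ?(new_neq0 sX ny) //.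
  case: hD => hA _; rewrite Ey Dlin // hA Dx DK // addr0 mulr1 //.
case=> // -[] b' [|y q] //=.
- move=> [xy ny hq] h [sq]; move: (val b' y q hq sq ny) => /= ->.
  rewrite (zE b') ?mulr0 //; move: h; rewrite sb (adapted_size hq).1; lia.
- move=> hq _ sq; move: (adl_comp E Dlin (adapted_fld two0 hq)) => /= ->; rewrite D1.
  have [hA _] : sqlin (adl E (y :: q)) by exact: sqlin_adl.
  by apply: (addrI (adl E (y :: q) 0)); rewrite -hA !addr0.
Qed.
End Detection.

(** * Invariants of the Witt group *)

Section Psi.
Variable F : fieldType.
Hypothesis two0 : 2%:R = 0 :> F.

(** Off-diagonal terms cancel in pairs. *)
Lemma sum_sym n (g : 'I_n -> 'I_n -> F) : (forall i j, g i j = g j i) ->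
  \sum_i \sum_j g i j = \sum_i g i i.
Proof.
elim: n g => [|n IH] g gC; first by rewrite !big_ord0.
rewrite big_ord_recl [RHS]big_ord_recl big_ord_recl -addrA; congr (_ + _).
under [X in _ + X]eq_bigr => i _ do rewrite big_ord_recl.
rewrite big_split /= (IH (fun i j => g (lift ord0 i) (lift ord0 j))) //.
rewrite addrA (eq_bigr (fun i => g (lift ord0 i) ord0)) => [|i _]; last exact: gC.
by rewrite (addFF two0) add0r.
Qed.

Lemma diag_congr m n (S : 'M[F]_n) (P : 'M[F]_(m, n)) i : S^T = S ->
  (P *m S *m P^T) i i = \sum_k P i k ^+ 2 * S k k.
Proof.
move=> sS; rewrite mxE.
under eq_bigr => j _ do rewrite !mxE mulr_suml.
rewrite sum_sym => [|j k]; last by rewrite -{1}sS mxE; ring.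
by apply: eq_bigr => k _; ring.
Qed.

Lemma sqr_sum n (a : 'I_n -> F) : (\sum_k a k) ^+ 2 = \sum_k a k ^+ 2.
Proof.
by elim/big_rec2: _ => [|k y z _ <-]; [rewrite expr0n | rewrite (sqrFD two0)].
Qed.

Variable f : F -> F.
Hypothesis hf : sqlin f.

Lemma sqlin0 : f 0 = 0.
Proof. by case: hf => fD _; apply: (addrI (f 0)); rewrite -fD !addr0. Qed.

Lemma sqlin_sum n (a b : 'I_n -> F) :
  f (\sum_k a k ^+ 2 * b k) = \sum_k a k ^+ 2 * f (b k).
Proof.
case: hf => fD fM; elim/big_rec2: _ => [|k y z _ <-]; first exact: sqlin0.
by rewrite fD fM.
Qed.

(* For diagonal Gram matrices this is the sum of the f(a)/a. *)
Definition psi (A : ipspace F) : F := \sum_i invmx (gram A) i i * f (gram A i i).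

(** The diagonals of the Gram matrix and of its inverse transform by the squared entries of P and of
    Q^T. As [f] is F^2-linear, these squares come out, and by Frobenius they combine to the squared
    entries of Q P = 1. *)
Lemma psi_iso A B : isometric A B -> psi A = psi B.
Proof.
move/isometricP=> [P [Q [PQ QP e]]].
have eV : invmx (gram A) = Q^T *m invmx (gram B) *m Q^T^T.
  rewrite trmxK; apply: (can_inj (mulmxK (gram_unit A))); rewrite mulVmx ?gram_unit //.
  rewrite -e !mulmxA -(mulmxA _ Q) QP mulmx1 -(mulmxA Q^T) mulVmx ?gram_unit // mulmx1.
  by rewrite -trmx_mul PQ trmx1.
rewrite /psi -{2}e eV.
have sV : (invmx (gram B))^T = invmx (gram B) by rewrite trmx_inv gram_sym.
under eq_bigr => i _.
  rewrite (diag_congr _ _ sV) (diag_congr _ _ (gram_sym B)) sqlin_sum mulr_suml.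
  under eq_bigr => k _ do rewrite mulr_sumr.
  over.
rewrite exchange_big /=; apply: eq_bigr => k _.
rewrite exchange_big /=.
have QPE l : \sum_i Q^T i k ^+ 2 * P i l ^+ 2 = (k == l)%:R.
  have := congr1 (fun M : 'M_(ipdim B) => M k l ^+ 2) QP.
  rewrite [LHS]/= !mxE sqr_sum -natrX => e1; under eq_bigr => i _ do rewrite mxE -exprMn.
  by rewrite e1; case: (k == l).
transitivity (\sum_l (k == l)%:R * (invmx (gram B) k k * f (gram B l l))).
  by apply: eq_bigr => l _; rewrite -QPE mulr_suml; apply: eq_bigr => i _; ring.
rewrite (bigD1 k) //= eqxx mul1r big1 ?addr0 // => l lk.
by rewrite eq_sym (negPf lk) mul0r.
Qed.

Lemma psi_sum A B : psi (ipsum A B) = psi A + psi B.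
Proof.
have e : invmx (block_mx (gram A) 0 0 (gram B)) =
    block_mx (invmx (gram A)) 0 0 (invmx (gram B)).
  apply: (can_inj (mulmxK (ipsum_subproof2 A B))).
  rewrite mulVmx ?ipsum_subproof2 // mulmx_block !mulmx0 !mul0mx !addr0 !add0r.
  by rewrite !mulVmx ?gram_unit // -scalar_mx_block.
rewrite /psi big_split_ord /= [gram (ipsum A B)]/= e; congr (_ + _); apply: eq_bigr => i _.
  by rewrite !block_mxEul.
by rewrite !block_mxEdr.
Qed.
End Psi.

(** * The invariant on W(F) and its values on products of Pfister forms *)

Section WittPsi.
Variable F : fieldType.
Hypothesis two0 : 2%:R = 0 :> F.

Definition scaled (u : F) (f : F -> F) : F -> F := fun t => u^-1 * f (u * t).

Lemma sqlin_scaled u f : sqlin f -> sqlin (scaled u f).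
Proof.
move=> [fD fM]; split=> a b; rewrite /scaled ?mulrDr ?fD; first by ring.
by rewrite mulrCA fM; ring.
Qed.

Lemma psi_tens_line f (u : nz F) A : sqlin f ->
  psi f (iptens (ipline (valP u)) A) = psi (scaled (val u) f) A.
Proof.
move=> hf; have u0 := valP u.
have s : (val u *: gram A)^T = val u *: gram A by rewrite linearZ /= gram_sym.
have iu : val u *: gram A \in unitmx.
  by rewrite unitmxE detZ unitrM -unitmxE gram_unit unitfE expf_neq0.
rewrite (@psi_iso _ two0 _ hf _ (mkipspace s iu)).
  apply: eq_bigr => i _; rewrite [gram _]/= invmxZ // !mxE /scaled; ring.
pose g (x : 'I_(ipdim A)) : 'I_1 * 'I_(ipdim A) := (ord0, x).
have bg : bijective g by exists snd => [//|[i j]]; rewrite /g /= (ord1 i).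
have bid : bijective (@id 'I_(ipdim A)) by exists id.
apply: (@isometric_gen _ (iptens (ipline u0) A) (mkipspace s iu)
  _ _ _ (bij_comp (bij_tens _ _) bg) bid).
by move=> i j; rewrite /comp /g gram_tens !mxE eqxx mulr1n.
Qed.

Section Functional.
Variable f : F -> F.
Hypothesis hf : sqlin f.

Definition psiI (x : isoclass F) : F := psi f (repr x).
Lemma psiIE A : psiI (cls A) = psi f A.
Proof. exact/psi_iso/repr_cls. Qed.
Lemma psiID x y : psiI (x + y) = psiI x + psiI y.
Proof. by elim/clsW: x => A; elim/clsW: y => B; rewrite clsD !psiIE psi_sum. Qed.

Definition psiG (z : GW F) : F := psiI (repr z).1 + psiI (repr z).2.
Lemma psiGE x y : psiG (gsub x y) = psiI x + psiI y.
Proof.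
have [k /(congr1 psiI)] := repr_gsub x y; rewrite !psiID => /addIr h.
apply/eqP; rewrite -(addF_eq0 two0) /psiG.
set p := repr _ in h *.
rewrite (_ : _ + _ = psiI p.1 + psiI y + (psiI x + psiI p.2)); last by ring.
by rewrite h (addFF two0).
Qed.
Lemma psiGD x y : psiG (x + y) = psiG x + psiG y.
Proof.
elim/gsubW: x => a b; elim/gsubW: y => c d; rewrite gsubD !psiGE !psiID; ring.
Qed.
Lemma psiGN x : psiG (- x) = psiG x.
Proof. by elim/gsubW: x => a b; rewrite gsubN !psiGE addrC. Qed.

Lemma nzN_id (a : nz F) : nzN a = a.
Proof.
apply/val_inj => /=; apply/eqP; rewrite -(addF_eq0 two0) addrC subrr //.
Qed.

Lemma GWline1 : GWline (nz1 F) = 1.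
Proof.
by rewrite /GWline /GWcls -gsub1 -cls1; congr (gsub (cls (ipline _)) _); exact: bool_irrelevance.
Qed.

Definition psiW (w : W F) : F := psiG (repr w).
Lemma psiWE z : psiW (qpi _ z) = psiG z.
Proof.
apply/eqP; rewrite -(addF_eq0 two0) /psiW -[psiG z]psiGN -psiGD.
elim: (repr_qpi (fun x : GW F => x = 1 + GWline (nzN (nz1 F))) z)
    => [|u v _ /eqP hu _ /eqP hv|a s b ->].
- by rewrite -gsub0 psiGE (addFF two0).
- by rewrite psiGD hu hv addr0.
(* As -1 = 1, the relation is 1 + 1, and its multiples are doubles. *)
by rewrite nzN_id GWline1 mulrDr mulr1 mulrDl psiGD (addFF two0).
Qed.
Lemma psiWD x y : psiW (x + y) = psiW x + psiW y.
Proof.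
by elim/qpiW: x => x; elim/qpiW: y => y; rewrite -raddfD !psiWE psiGD.
Qed.
Lemma psiW0 : psiW 0 = 0.
Proof. by apply: (addrI (psiW 0)); rewrite -psiWD !addr0. Qed.
Lemma psiW1 : psiW 1 = f 1.
Proof.
rewrite -(rmorph1 (qpi _)) psiWE -gsub1 psiGE -cls1 -cls0 !psiIE /psi.
by rewrite big_ord0 addr0 big_ord1 [gram _]/= invmx_scalar !mxE eqxx !mulr1n invr1 mul1r.
Qed.
End Functional.

Lemma psiW_line f u w : sqlin f -> psiW f (Wline u * w) = psiW (scaled (val u) f) w.
Proof.
move=> hf; have hs := sqlin_scaled (val u) hf.
elim/qpiW: w => w; elim/gsubW: w => a b.
rewrite -rmorphM !psiWE // /GWline /GWcls gsubM !mul0r !addr0 !psiGE //.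
by elim/clsW: a => A; elim/clsW: b => C; rewrite !clsM !psiIE // !psi_tens_line.
Qed.

Lemma WDD (w : W F) : w + w = 0.
Proof.
elim/qpiW: w => w; rewrite -raddfD; apply/qpi_eq0.
have := @idealgenM _ (fun x : GW F => x = 1 + GWline (nzN (nz1 F))) w _ 1 erefl.
by rewrite nzN_id GWline1 mulr1 mulrDr mulr1.
Qed.

Lemma WN (w : W F) : - w = w.
Proof. by apply/eqP; rewrite eq_sym -addr_eq0 WDD. Qed.

Lemma pfisterE2 (a : nz F) : pfister a = 1 + Wline a.
Proof. by rewrite /pfister nzN_id. Qed.

(** Multiplication by <y> conjugates [f] by y, so the factor <<y>> = 1 + <y> replaces [f] by its
    commutator. This ties powers of I(F) to the order of [f]. *)
Lemma psiW_pfister f (y : nz F) w : sqlin f ->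
  psiW f (pfister y * w) = psiW (ad (val y) f) w.
Proof.
move=> hf; have hs := sqlin_scaled (val y) hf; have ha := sqlin_ad (val y) hf.
rewrite pfisterE2 mulrDl mul1r psiWD // psiW_line //.
elim/qpiW: w => w; elim/gsubW: w => a b; rewrite !psiWE // !psiGE //.
elim/clsW: a => A; elim/clsW: b => C; rewrite !psiIE // /psi.
rewrite addrACA -!big_split; congr (_ + _); apply: eq_bigr => i _ /=.
  by rewrite /ad /scaled; ring.
by rewrite /ad /scaled; ring.
Qed.

Definition ext0 (T : nmodType) (g : nz F -> T) (a : F) : T :=
  if insub a is Some u then g u else 0.

Lemma ext0E (T : nmodType) (g : nz F -> T) u : ext0 g (val u) = g u.
Proof. by rewrite /ext0 valK. Qed.
Lemma ext0_0 (T : nmodType) (g : nz F -> T) : ext0 g 0 = 0.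
Proof. by rewrite /ext0 insubF // eqxx. Qed.
Lemma nzP (a : F) : a != 0 -> exists u : nz F, a = val u.
Proof. by move=> a0; exists (exist _ a a0). Qed.

Lemma psiW_symbol f q : sqlin f -> {in q, forall y, y != 0} ->
  psiW f (symb (ext0 (@pfister F)) q) = adl f q 1.
Proof.
elim: q f => [|y q IH] f hf hq; first by rewrite symb_nil psiW1.
have /nzP[u Ey] : y != 0 by apply: hq; rewrite inE eqxx.
rewrite symb_cons Ey ext0E psiW_pfister //= IH //; first exact: sqlin_ad.
by move=> z zq; apply: hq; rewrite inE zq orbT.
Qed.
End WittPsi.

(** * Diagonalization *)

Section WittSpan.
Variable F : fieldType.
Hypothesis two0 : 2%:R = 0 :> F.

Definition Wcls (A : ipspace F) : W F := qpi _ (GWcls A).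

Lemma Wcls_iso A B : isometric A B -> Wcls A = Wcls B.
Proof. by move=> h; congr (qpi _ (gsub _ _)); apply/clsP. Qed.

Lemma WclsD A B : Wcls (ipsum A B) = Wcls A + Wcls B.
Proof. by rewrite /Wcls -raddfD; congr qpi; rewrite gsubD addr0 clsD. Qed.

Lemma isometric_congr m n (M : 'M[F]_m) (N : 'M[F]_n) sM iM sN iN P Q :
  P *m Q = 1%:M -> Q *m P = 1%:M -> P *m N *m P^T = M ->
  isometric (@mkipspace F m M sM iM) (@mkipspace F n N sN iN).
Proof. by move=> PQ QP e; apply/isometricP; exists P, Q. Qed.

Lemma Wline_add (a b c d : nz F) : val c = val a + val b ->
  val d = val a * val b * val c -> Wline a + Wline b = Wline c + Wline d.
Proof.
move=> Ec Ed; rewrite -!WclsD; apply/esym/Wcls_iso.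
have c0 := valP c; rewrite Ec in c0.
(* For e, f orthogonal of norms a, b, the vectors e + f and b e + a f are orthogonal of norms a + b
   and a b (a + b). *)
apply: (@isometric_congr _ _ _ _ _ _ _ _
  (block_mx 1%:M 1%:M (val b)%:M (val a)%:M)
  ((val a + val b)^-1 *: block_mx (val a)%:M 1%:M (val b)%:M 1%:M)).
- rewrite -scalemxAr mulmx_block !mul1mx !mulmx1 -!scalar_mxM -!raddfD /=.
  rewrite (mulrC (val b)) (addFF two0) (addFF two0) (addrC (val b)) !raddf0.
  by rewrite -scalar_mx_block scale_scalar_mx mulVf.
- rewrite -scalemxAl mulmx_block !mul1mx !mulmx1 -!raddfD /=.
  rewrite !(addFF two0) (addrC (val b)) !raddf0.
  by rewrite -scalar_mx_block scale_scalar_mx mulVf.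
rewrite tr_block_mx !tr_scalar_mx !mulmx_block !mulmx0 !mul1mx !mulmx1 !add0r !addr0.
rewrite -!scalar_mxM -!raddfD /=; congr block_mx.
- by rewrite -Ec.
- by rewrite (mulrC (sval b)) (addFF two0) raddf0.
- by rewrite (mulrC (sval b)) (addFF two0) raddf0.
- by rewrite [RHS]/gram /= Ed Ec; congr scalar_mx => /=; ring.
Qed.

Lemma mul_add1_expand (R : comPzRingType) (x y : R) : (1 + x) * (1 + y) = x + y + (1 + x * y).
Proof. by ring. Qed.

(** The product is <a> + <b> + 1 + <ab>, where <a> + <b> = 1 + <ab> by [Wline_add]. *)
Lemma pfister_steinberg (a b : nz F) : val a + val b = 1 -> pfister a * pfister b = 0.
Proof.
move=> ab; rewrite !(pfisterE2 two0).
have e : Wline a * Wline b = Wline (nzM a b).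
  by rewrite /Wline -GWlineM; apply/esym/(rmorphM (qpi _)).
rewrite mul_add1_expand e.
rewrite (@Wline_add a b (nz1 F) (nzM a b)) /= ?ab ?mulr1 //.
by rewrite {1}/Wline GWline1 (rmorph1 (qpi _)) (WDD two0).
Qed.

Lemma split_line n (M : 'M[F]_n.+1) (sM : M^T = M) (iM : M \in unitmx) i : M i i != 0 ->
  exists (a : nz F) (A : ipspace F), ipdim A = n /\
    isometric (mkipspace sM iM) (ipsum (ipline (valP a)) A).
Proof.
move=> Mi.
pose N : 'M[F]_(1 + n) := \matrix_(j, k) M (tperm ord0 i j) (tperm ord0 i k).
have sN : N^T = N by apply/matrixP=> j k; rewrite !mxE -{1}sM mxE.
have NE : N = xcol ord0 i (xrow ord0 i M) by apply/matrixP=> j k; rewrite !mxE.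
have iN : N \in unitmx by rewrite NE xcolE xrowE !unitmx_mul !unitmx_perm iM.
have iso1 : isometric (mkipspace sM iM) (mkipspace sN iN).
  apply: (@isometric_bij _ (mkipspace sM iM) (mkipspace sN iN) (tperm ord0 i)).
    by exists (tperm ord0 i) => j; exact: tpermK.
  by move=> j k; rewrite /gram /= mxE !tpermK.
pose a : F := N 0 0.
have a0 : a != 0 by rewrite /a mxE tpermL.
have ulN : ulsubmx N = a%:M.
  apply/matrixP=> j k; rewrite !ord1 [RHS]mxE eqxx mulr1n [LHS]mxE [LHS]mxE.
  by congr (N _ _); apply: val_inj.
pose C := ursubmx N.
have dlN : dlsubmx N = C^T by rewrite /C trmx_ursub sN.
have NB : N = block_mx a%:M C C^T (drsubmx N) by rewrite -ulN -dlN submxK.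
(* The Schur complement of the pivot [a], that is, the form on the complement of the first
   vector. *)
pose S := drsubmx N - a^-1 *: (C^T *m C).
have sS : S^T = S.
  by rewrite /S linearB /= linearZ /= trmx_mul trmxK trmx_drsub sN.
pose L : 'M[F]_(1 + n) := block_mx 1%:M 0 (- a^-1 *: C^T) 1%:M.
pose L' : 'M[F]_(1 + n) := block_mx 1%:M 0 (a^-1 *: C^T) 1%:M.
have LL' : L *m L' = 1%:M.
  rewrite mulmx_block !mul1mx !mulmx1 !mul0mx !mulmx0 !addr0 !add0r scaleNr addNr.
  by rewrite -scalar_mx_block.
have L'L : L' *m L = 1%:M.
  rewrite mulmx_block !mul1mx !mulmx1 !mul0mx !mulmx0 !addr0 !add0r scaleNr addrN.
  by rewrite -scalar_mx_block.
have E : L *m N *m L^T = block_mx a%:M 0 0 S.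
  rewrite NB tr_block_mx !mulmx_block !trmx1 !trmx0 !mul1mx !mulmx1 !mul0mx !mulmx0.
  rewrite !addr0 mul_mx_scalar scalerA mulrN mulfV // scaleN1r addNr mul0mx add0r.
  rewrite linearZ /= trmxK -scalemxAr mul_scalar_mx scalerA mulNr mulVf //.
  rewrite scaleN1r addNr; congr block_mx.
  by rewrite /S addrC -scalemxAl scaleNr.
have iS : S \in unitmx.
  have : L *m N *m L^T \in unitmx.
    have iL := mulmx1_unit LL'.
    by rewrite !unitmx_mul unitmx_tr iL.1 iN.
  by rewrite E unitmxE det_ublock unitrM -!unitmxE => /andP[].
exists (exist _ a a0), (mkipspace sS iS); split=> //.
apply: isometric_trans iso1 _; apply: isometric_sym.
exact: (isometric_congr _ _ _ _ LL' L'L).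
Qed.
Lemma Wcls0 (A : ipspace F) : ipdim A = 0%N -> Wcls A = 0.
Proof.
move=> e; transitivity (Wcls (ipzero F)); last first.
  by rewrite /Wcls /GWcls cls0 gsub0 raddf0.
apply: Wcls_iso; apply/isometricP; exists 0, 0; split; apply/matrixP=> i.
- by exfalso; case: i => k; rewrite e.
- by case: i.
- by exfalso; case: i => k; rewrite e.
Qed.

(* With e_0 a basis vector of an alternating form A and f a generator of <1>, the
   complement of f + e_0 in A + <1> is not alternating. *)
Lemma alternating_exchange n (M : 'M[F]_n) (sM : M^T = M) (iM : M \in unitmx) (i : 'I_n) :
  (forall j, M j j = 0) ->
  exists (N : 'M[F]_n) (sN : N^T = N) (iN : N \in unitmx),
    (exists j, N j j != 0) /\ Wcls (mkipspace sM iM) = Wcls (mkipspace sN iN).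
Proof.
move=> alt.
pose d : 'rV[F]_n := delta_mx 0 i; pose m : 'cV[F]_n := col i M.
have mE : M *m d^T = m by rewrite trmx_delta -colE.
have mT : d *m M = m^T by rewrite -mE trmx_mul trmxK sM.
have dm : d *m m = 0.
  by rewrite -rowE; apply/matrixP=> j k; rewrite !mxE alt.
have mdT : m^T *m d^T = 0 by rewrite -trmx_mul dm trmx0.
have mm k l (X : 'M[F]_(k, l)) : X + X = 0.
  by apply/matrixP=> a b; rewrite !mxE (addFF two0).
pose N := M + m *m m^T.
have sN : N^T = N by rewrite /N linearD /= trmx_mul trmxK sM.
(* The rows are f + e_i, of norm 1, and the projections e_j + m_j (f + e_i) of the e_j to its
   complement. *)
pose P : 'M[F]_(1 + n) := block_mx 1%:M d m (1%:M + m *m d).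
pose Q : 'M[F]_(1 + n) := block_mx 1%:M d m 1%:M.
have PQ : P *m Q = 1%:M.
  rewrite mulmx_block !mul1mx !mulmx1 dm addr0 mm mulmxDl mul1mx -mulmxA dm mulmx0 addr0.
  by rewrite mm addrC -addrA mm addr0 -scalar_mx_block.
have QP : Q *m P = 1%:M.
  rewrite mulmx_block !mul1mx !mulmx1 dm addr0 mulmxDr mulmx1 mulmxA dm mul0mx addr0.
  by rewrite !mm addrC -addrA mm addr0 -scalar_mx_block.
have E : P *m block_mx 1%:M 0 0 M *m P^T = block_mx 1%:M 0 0 N.
  rewrite tr_block_mx trmx1 linearD /= trmx1 trmx_mul !mulmx_block !mulmx0.
  rewrite !mul1mx !mulmx1 !add0r !addr0 mT (mulmxDl 1%:M) !mul1mx -(mulmxA m) mT.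
  congr block_mx.
  - by rewrite mdT addr0.
  - by rewrite mulmxDr mulmx1 mulmxA mdT mul0mx addr0 mm.
  - by rewrite mulmxDl mE -mulmxA mdT mulmx0 addr0 mm.
  rewrite mulmxDr mulmx1 mulmxA mulmxDl mE -(mulmxA m) mdT mulmx0 addr0.
  by rewrite -(addrA M) mm addr0 addrC.
have iN : N \in unitmx.
  have : P *m block_mx 1%:M 0 0 M *m P^T \in unitmx.
    have iP := mulmx1_unit PQ.
    rewrite !unitmx_mul unitmx_tr iP.1 andbT unitmxE det_ublock unitrM -!unitmxE unitmx1 iM.
    by [].
  by rewrite E unitmxE det_ublock unitrM -!unitmxE => /andP[].
exists N, sN, iN; split.
  have [j Mj] : exists j, M j i != 0.
    apply: contrapT => h.
    have m0 : m = 0.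
      apply/matrixP=> j k; rewrite !mxE; apply/eqP; apply: contrapT => hj.
      by apply: h; exists j; apply/negP.
    have : d = 0.
      by apply: (can_inj (mulmxK iM)); rewrite mT m0 trmx0 mul0mx.
    by move/matrixP/(_ 0 i)/eqP; rewrite !mxE !eqxx oner_eq0.
  exists j; rewrite !mxE big_ord1 !mxE alt add0r -expr2 expf_neq0 //.
apply: (addrI (Wcls (ipone F))); rewrite -!WclsD; apply/esym/Wcls_iso.
exact: (isometric_congr _ _ _ _ PQ QP).
Qed.

(** Lines are split off one by one; an alternating form is first exchanged for a non-alternating one
    with the same class and dimension. *)
Lemma W_span (P : W F -> Prop) : P 0 -> (forall u v, P u -> P v -> P (u + v)) ->
  (forall a, P (Wline a)) -> forall w, P w.
Proof.
move=> P0 PD Pl.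
have eta A : A = mkipspace (gram_sym A) (gram_unit A) :> ipspace F.
  by apply/val_inj; case: A => -[].
have diag n (M : 'M[F]_n) (sM : M^T = M) (iM : M \in unitmx) : P (Wcls (mkipspace sM iM)).
  elim: n M sM iM => [|n IH] M sM iM; first by rewrite Wcls0.
  have nalt (N : 'M[F]_n.+1) (sN : N^T = N) (iN : N \in unitmx) j :
      N j j != 0 -> P (Wcls (mkipspace sN iN)).
    move=> /(split_line sN iN)[a [A [dA /Wcls_iso ->]]]; rewrite WclsD; apply: PD.
      exact: Pl.
    rewrite (eta A); move: (gram A) (gram_sym A) (gram_unit A); rewrite dA.
    exact: IH.
  have [[j Mj]|alt] := pselect (exists j, M j j != 0); first exact: nalt Mj.
  have [|N [sN [iN [[j Nj] ->]]]] := @alternating_exchange _ M sM iM ord0.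
    by move=> j; apply/eqP; apply: contrapT => hj; apply: alt; exists j; apply/negP.
  exact: nalt Nj.
elim/qpiW=> z; elim/gsubW: z => x y; elim/clsW: x => A; elim/clsW: y => B.
have -> : gsub (cls A) (cls B) = GWcls A - GWcls B by rewrite gsubN gsubD addr0 add0r.
have e : qpi _ (GWcls A - GWcls B) = Wcls A - Wcls B :> W F := raddfB (qpi _) _ _.
have PW C : P (Wcls C) by rewrite (eta C); exact: diag.
by rewrite e (WN two0 (Wcls B)); exact: PD.
Qed.

(** As 2 = 0 in W(F), adding 1 to each of an even number of lines does not change their sum. *)
Lemma fundI_span (w : W F) : fundI w -> exists t : seq (nz F), w = \sum_(a <- t) pfister a.
Proof.
have [t ->] : exists t : seq (nz F), w = \sum_(a <- t) Wline a.
  elim/W_span: w => [|u v [t ->] [t' ->]|a]; first by exists [::]; rewrite big_nil.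
    by exists (t ++ t'); rewrite big_cat.
  by exists [:: a]; rewrite big_seq1.
move=> ht; exists t.
have rk : Wrank2 (\sum_(a <- t) Wline a) = (size t)%:R :> 'Z_2.
  elim: t {ht} => [|a t IH]; first by rewrite !big_nil; exact: (raddf0 (@Wrank2 F)).
  by rewrite big_cons Wrank2D IH /Wline Wrank2E GWrank_line -natr1 addrC.
have ev : ~~ odd (size t).
  by move: ht; rewrite /fundI rk; case: odd (odd_double_half (size t)) => // <-;
    rewrite natrD -mul2n natrM pchar_Zp //.
have -> : \sum_(a <- t) pfister a = (1 *+ size t) + \sum_(a <- t) Wline a.
  elim: t {ht rk ev} => [|a t IH]; first by rewrite !big_nil addr0.
  by rewrite !big_cons IH (pfisterE2 two0) mulrS addrACA.
rewrite -(odd_double_half (size t)) (negPf ev) add0n -addnn mulrnDr (WDD two0) add0r //.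
Qed.
End WittSpan.

(** * The universal property of Witt K-theory *)

Section FreeHom.
Variables (F : fieldType) (S : pzRingType) (phi : KMWgen F -> S).

Definition wordval (w : seq (KMWgen F)) : S := \prod_(x <- w) phi x.
Definition freehom (p : KMWfree F) : S := \sum_(w <- msupp p) wordval w *~ p@_w.

Lemma freehomw (d : {fset {fmonom KMWgen F}}) (p : KMWfree F) : (msupp p `<=` d)%fset ->
  freehom p = \sum_(w <- d) wordval w *~ p@_w.
Proof.
by move=> le; rewrite /freehom (big_fset_incl _ le) //= => w _ /mcoeff_outdom ->.
Qed.

Lemma freehomB : zmod_morphism freehom.
Proof.
move=> p q; pose d := (msupp (p - q) `|` (msupp p `|` msupp q))%fset.
rewrite !(@freehomw d); first last.
- exact: fsubsetUl.
- by rewrite fsubsetU // fsubsetUl orbT.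
- by rewrite fsubsetU // fsubsetUr orbT.
by rewrite -sumrB; apply: eq_bigr => w _; rewrite mcoeffB mulrzBr.
Qed.

Lemma freehom0 : freehom 0 = 0.
Proof. by have := freehomB 0 0; rewrite !subrr. Qed.
Lemma freehomN p : freehom (- p) = - freehom p.
Proof. by have := freehomB 0 p; rewrite freehom0 !sub0r. Qed.
Lemma freehomD p q : freehom (p + q) = freehom p + freehom q.
Proof. by rewrite -{1}[q]opprK freehomB freehomN opprK. Qed.
Lemma freehom_sum (T : Type) (r : seq T) (G : T -> KMWfree F) :
  freehom (\sum_(i <- r) G i) = \sum_(i <- r) freehom (G i).
Proof. exact: (big_morph freehom freehomD freehom0). Qed.

Lemma freehomU c w : freehom << c *g w >> = wordval w *~ c.
Proof. by rewrite (freehomw msuppU_le) big_seq_fset1 mcoeffUU. Qed.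

Lemma freehomM : monoid_morphism freehom.
Proof.
split; first by rewrite freehomU /wordval fm1 big_nil.
move=> p q; rewrite [p * q]malgME freehom_sum [freehom p]/freehom mulr_suml.
apply: eq_bigr => v _; rewrite freehom_sum [freehom q]/freehom mulr_sumr.
apply: eq_bigr => w _; rewrite freehomU /wordval fmM big_cat /=.
by rewrite mulrzAl mulrzAr -mulrzA mulrC.
Qed.

Lemma freehom_sym a : freehom (Defs.fsym a) = phi (Some a).
Proof. by rewrite freehomU /wordval fmU big_seq1. Qed.
Lemma freehom_eta : freehom (@feta F) = phi None.
Proof. by rewrite freehomU /wordval fmU big_seq1. Qed.
End FreeHom.

(** Words outside the support of [p] are left out, so that [P] may record the degree of [p]. *)
Lemma free_span F (P : KMWfree F -> Prop) (p : KMWfree F) : P 0 ->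
  (forall p q, P p -> P q -> P (p - q)) ->
  (forall w : {fmonom KMWgen F}, w \in msupp p ->
    P (\prod_(x <- (w : seq (KMWgen F))) << fmu x >>)) -> P p.
Proof.
move=> P0 PB Pw.
have PN q : P q -> P (- q) by move=> h; rewrite -[- q]add0r; exact: PB.
have PD q r : P q -> P r -> P (q + r) by move=> hq hr; rewrite -[r]opprK; apply/PB/PN.
rewrite [p]monalgE big_seq; elim/big_ind: _ => // w wp.
have wE : << w >> = \prod_(x <- (w : seq _)) << fmu x >> :> KMWfree F.
  case: w {wp} => w /=; elim: w => [|x w IH].
    by rewrite big_nil; apply/(congr1 (fun m => << m >>)); apply/val_inj; rewrite /= fm1.
  rewrite big_cons -IH [RHS]malgM_def fgmulUU mulr1; congr << _ *g _ >>.
  by apply/val_inj; rewrite /= fmM fmU.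
have Pn n : P << n%:Z *g w >>.
  elim: n => [|n IH]; first by rewrite monalgU0.
  have -> : << n.+1%:Z *g w >> = << w >> + << n%:Z *g w >> :> KMWfree F.
    by rewrite intS; exact: monalgUD.
  apply: PD; last exact: IH.
  by rewrite wE; exact: Pw wp.
by case: (p@_w) => n //; rewrite NegzE monalgUN; exact: PN.
Qed.

Section QuoHom.
Variables (R S : pzRingType) (T : R -> Prop) (h : R -> S).
Hypotheses (hB : zmod_morphism h) (hM : monoid_morphism h) (hT : forall t, T t -> h t = 0).

Definition quohom (z : quo T) : S := h (repr z).

Lemma quohomE x : quohom (qpi T x) = h x.
Proof.
have h0 : h 0 = 0 by have := hB 0 0; rewrite !subrr.
have hD a b : h (a + b) = h a + h b.
  have hN c : h (- c) = - h c by have := hB 0 c; rewrite h0 !sub0r.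
  by rewrite -{1}[b]opprK hB hN opprK.
apply/eqP; rewrite -subr_eq0 -hB; apply/eqP.
elim: (repr_qpi T x) => [//|u v _ hu _ hv|a s b Ts]; first by rewrite hD hu hv addr0.
by case: hM => _ hM2; rewrite !hM2 (hT Ts) mulr0 mul0r.
Qed.

Lemma quohomB : zmod_morphism quohom.
Proof. by elim/qpiW=> x; elim/qpiW=> y; rewrite -raddfB !quohomE hB. Qed.
Lemma quohomM : monoid_morphism quohom.
Proof.
split; first by rewrite -(rmorph1 (qpi T)) quohomE; case: hM.
by elim/qpiW=> x; elim/qpiW=> y; rewrite -rmorphM !quohomE; case: hM.
Qed.
End QuoHom.

Section Universal.
Variables (F : fieldType) (S : pzRingType) (sg : nz F -> S) (et : S).
Hypotheses (Sst : forall a (h : val a != 1), sg a * sg (nz1B h) = 0)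
  (Stw : forall a b, sg (nzM a b) = sg a + sg b + et * sg a * sg b)
  (SetaC : forall u, et * sg u = sg u * et)
  (Sh : et * sg (nzN (nz1 F)) + 2%:R = 0).

Let phi (x : KMWgen F) : S := if x is Some a then sg a else et.

Lemma KW_universal : exists f : KW F -> S,
  [/\ zmod_morphism f, monoid_morphism f, forall a, f (KWsym a) = sg a & f (KWeta F) = et].
Proof.
have hB := freehomB phi; have hM := freehomM phi.
have fM x y : freehom phi (x * y) = freehom phi x * freehom phi y by case: hM.
have fh : freehom phi (fh F) = 0.
  rewrite /fh (freehomD phi) (fM (@feta F)) (freehom_eta phi) (freehom_sym phi) /= -[RHS]Sh.
  congr (_ + _).
  by rewrite mulr2n freehomD; case: hM => ->.
have h1 t : KMWrel t -> freehom phi t = 0.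
  have fE : freehom phi (@feta F) = et := freehom_eta phi.
  have fS a : freehom phi (Defs.fsym a) = sg a := freehom_sym phi a.
  case=> [a h|a b|u|].
  - by rewrite (fM (Defs.fsym a) (Defs.fsym _)) (fS a) (fS (nz1B h)) Sst.
  - rewrite (hB (Defs.fsym (nzM a b))) (fS (nzM a b)) Stw -{1}(fS a) -{1}(fS b).
    rewrite -(freehomD phi (Defs.fsym a)) -fE -(fS a) -(fM (@feta F) (Defs.fsym a)).
    rewrite -(fS b) -(fM (_ * _)) -(freehomD phi (_ + _)); exact: subrr.
  - apply: (etrans (hB _ _)); apply/eqP; rewrite subr_eq0; apply/eqP.
    apply: (etrans (fM _ _)); apply: (etrans (congr2 *%R fE (fS u))).
    by apply: (etrans (SetaC u)); apply: (etrans (esym (congr2 *%R (fS u) fE)));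
      exact: esym (fM _ _).
  - by rewrite (fM (@feta F) (Defs.fh F)) fh mulr0.
have B1 := quohomB hB hM h1; have M1 := quohomM hB hM h1.
have E1 := quohomE hB hM h1.
have h2 t : t = KMWh F -> quohom (freehom phi) t = 0.
  move=> ->; rewrite -fh -E1; congr quohom.
  by rewrite /fh rmorphD rmorphM rmorph_nat.
exists (quohom (quohom (T := @KMWrel F) (freehom phi))); split.
- exact: quohomB.
- exact: quohomM.
- by move=> a; rewrite /KWsym (quohomE B1 M1 h2) /KMWsym E1 freehom_sym.
- by rewrite /KWeta (quohomE B1 M1 h2) /KMWeta E1 freehom_eta.
Qed.
End Universal.

(** * Injectivity *)

Section Relations.
Variables (F : fieldType) (R : pzRingType) (sg : nz F -> R) (et : R).
Hypothesis two0 : 2%:R = 0 :> F.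
Hypotheses (Sst : forall a (h : val a != 1), sg a * sg (nz1B h) = 0)
  (Stw : forall a b, sg (nzM a b) = sg a + sg b + et * sg a * sg b)
  (SetaC : forall u, et * sg u = sg u * et)
  (Sh : et * sg (nzN (nz1 F)) + 2%:R = 0).

(** * Consequences of the relations in characteristic 2 *)

(** As -1 = 1, the relation h = 0 reads eta [1] = -2, whence [1] = [1] + [1] - 2 [1] = 0. *)
Lemma rel_sg1 : sg (nz1 F) = 0.
Proof.
move: Sh; rewrite nzN_id // => /eqP; rewrite addr_eq0 => /eqP h.
have := Stw (nz1 F) (nz1 F); rewrite h mulNr mulr_natl mulr2n subrr => <-.
by congr sg; apply/val_inj; rewrite /= mulr1.
Qed.

Lemma rel_two : 2%:R = 0 :> R.
Proof. by move: Sh; rewrite nzN_id // rel_sg1 mulr0 add0r. Qed.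

Lemma rel_add x : x + x = 0 :> R.
Proof. by rewrite -mulr2n -mulr_natl rel_two mul0r. Qed.

(** The classical argument for [a][-a] = 0: the Steinberg relations for a and 1/a are compared
    through 1 - a = (1 - 1/a) a. *)
Lemma rel_sgsg a : sg a * sg a = 0.
Proof.
have [a1|a1] := eqVneq (val a) 1.
  have -> : a = nz1 F by apply/val_inj.
  by rewrite rel_sg1 mul0r.
pose b : nz F := exist _ (val a)^-1 (invr_neq0 (valP a)).
have b1 : val b != 1 by rewrite /= invr_eq1.
have ac : sg a * sg (nz1B b1) = 0.
  have : sg (nzM a b) = 0.
    by rewrite -rel_sg1; congr sg; apply/val_inj; rewrite /= mulfV ?(valP a).
  rewrite Stw -addrA => /eqP; rewrite addr_eq0 => /eqP ->.
  by rewrite mulNr mulrDl -mulrA Sst mulr0 addr0 oppr0.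
have := Sst a1; have -> : nz1B a1 = nzM (nz1B b1) a.
  apply/val_inj; rewrite /= mulrBl mul1r mulVf ?(valP a) //.
  by apply/eqP; rewrite -(addF_eq0 two0); apply/eqP; ring.
by rewrite Stw !mulrDr ac add0r !mulrA -SetaC -(mulrA et) ac mulr0 mul0r addr0.
Qed.

(** Since eta [a][b] is symmetric in a and b, it annihilates [a] and [b] on both sides, and [ab]^2 =
    0 reduces to [a][b] + [b][a] = 0. *)
Lemma rel_comm a b : sg a * sg b = sg b * sg a.
Proof.
have nC : nzM a b = nzM b a by apply/val_inj; rewrite /= mulrC.
have eC : et * sg a * sg b = et * sg b * sg a.
  have := Stw a b; rewrite nC Stw (addrC (sg b)) => /addrI ->; done.
have := rel_sgsg (nzM a b); rewrite Stw.
move: (sg a) (sg b) (rel_sgsg a) (rel_sgsg b) (SetaC a) (SetaC b) eC => A B AA BB eA eB eC.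
set E := et * A * B.
have AE : A * E = 0 by rewrite /E !mulrA -eA -(mulrA et) AA mulr0 mul0r.
have EA : E * A = 0 by rewrite /E eC -mulrA AA mulr0.
have BE : B * E = 0 by rewrite /E eC !mulrA -eB -(mulrA et) BB mulr0 mul0r.
have EB : E * B = 0 by rewrite /E -mulrA BB mulr0.
have EE : E * E = 0 by rewrite {2}/E eA !mulrA EA !mul0r.
rewrite !mulrDl !mulrDr AA BB AE BE EA EB EE !addr0 !add0r => /eqP.
rewrite addr_eq0 => /eqP ->; apply/eqP.
by rewrite eq_sym -addr_eq0; apply/eqP; exact: rel_add.
Qed.

Definition rgen (x : KMWgen F) : R := if x is Some a then sg a else et.

Lemma rgen_comm x y : rgen x * rgen y = rgen y * rgen x.
Proof.
by case: x => [a|]; case: y => [b|] //=; exact: rel_comm.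
Qed.

Inductive wspan (n : int) : R -> Prop :=
| wspan0 : wspan n 0
| wspanB u v : wspan n u -> wspan n v -> wspan n (u - v)
| wspanW w : \sum_(x <- w) gendeg x = n -> wspan n (wordval rgen w).

Hypothesis gen : forall P : R -> Prop, P 0 -> (forall u v, P u -> P v -> P (u - v)) ->
  (forall w, P (wordval rgen w)) -> forall x, P x.

Lemma rel_mulC (x y : R) : x * y = y * x.
Proof.
have wC w z : rgen z * wordval rgen w = wordval rgen w * rgen z.
  rewrite /wordval; elim: w => [|v w IH]; first by rewrite big_nil mulr1 mul1r.
  by rewrite big_cons mulrA rgen_comm -mulrA IH mulrA.
elim/gen: x => [|u v hu hv|w]; first by rewrite mulr0 mul0r.
  by rewrite mulrBl mulrBr hu hv.
elim/gen: y => [|u v hu hv|v]; first by rewrite mulr0 mul0r.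
  by rewrite mulrBl mulrBr hu hv.
have {wC} := wC v; move: (wordval _ v) => y wC.
rewrite /wordval; elim: w => [|z w IH]; first by rewrite big_nil mulr1 mul1r.
by rewrite big_cons -mulrA IH mulrA wC -mulrA.
Qed.

Definition relcom : comPzRingType :=
  HB.pack_for comPzRingType (R : Type) R (GRing.PzRing_hasCommutativeMul.Build R rel_mulC).

Let s : F -> relcom := ext0 sg.
Let eta : relcom := et.

Lemma rels0 : s 0 = 0. Proof. exact: ext0_0. Qed.
Lemma relsM a b : a != 0 -> b != 0 -> s (a * b) = s a + s b + eta * s a * s b.
Proof.
move=> /nzP[u ->] /nzP[v ->]; rewrite (_ : val u * val v = val (nzM u v)) //.
by rewrite /s !ext0E; exact: Stw.
Qed.
Lemma rels_sqr a : s a * s a = 0.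
Proof.
have [->|/nzP[u ->]] := eqVneq a 0; first by rewrite rels0 mul0r.
by rewrite /s !ext0E; exact: rel_sgsg.
Qed.
Lemma rels_st a : s a * s (1 + a) = 0.
Proof.
have [->|/nzP[u ->]] := eqVneq a 0; first by rewrite rels0 mul0r.
have [->|u1] := eqVneq (val u) 1; first by rewrite (addFF two0) rels0 mulr0.
rewrite (_ : 1 + val u = val (nz1B u1)); first by rewrite /s !ext0E; exact: Sst.
by apply/eqP; rewrite -(addF_eq0 two0) addrACA subrr addr0 (addFF two0).
Qed.
Lemma relcom_two : 2%:R = 0 :> relcom. Proof. exact: rel_two. Qed.

Lemma wspan_symspan n x : wspan n x -> symspan s eta (fun=> True) n (x : relcom).
Proof.
elim=> [|u v _ hu _ hv|w e]; first exact: symspan0.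
  suff -> : (u - v : relcom) = (u : relcom) + v by exact: symspanD.
  by congr (_ + _); apply/eqP; rewrite eq_sym -addr_eq0; apply/eqP; exact: rel_add.
rewrite -e => {e}; elim: w => [|[a|] w IH].
- by rewrite /wordval !big_nil; exact: symspan1.
- rewrite /wordval !big_cons; apply: (@symspanM _ _ s eta _ 1) IH.
  by rewrite -[rgen _]/(sg a) -(ext0E sg a); exact: (@symspan_s _ _ s eta).
rewrite /wordval !big_cons; apply: (@symspanM _ _ s eta _ (- 1)) IH.
exact: (@symspan_eta _ _ s eta).
Qed.

(* For n > 0 each eta can be absorbed: eta [a][b] = [ab] - [a] - [b]. *)
Lemma wspan_pos (P : R -> Prop) m x : P 0 -> (forall u v, P u -> P v -> P (u + v)) ->
  (forall t : seq (nz F), P (\prod_(a <- t) sg a)) -> wspan m.+1%:Z x -> P x.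
Proof.
move=> P0 PD Pt /wspan_symspan.
have main j q : size q = (m.+1 + j)%N -> P (eta ^+ j * symb s q : relcom).
  elim: j q => [|j IH] q sq.
    rewrite expr0 mul1r.
    have [z0|z0] := boolP (0 \in q).
      rewrite (_ : symb _ q = 0) //; elim: q z0 {sq} => // y q IH.
      by rewrite inE symb_cons => /orP[/eqP <-|/IH ->]; rewrite ?mulr0 // rels0 mul0r.
    have [t ->] : exists t : seq (nz F), q = map val t.
      elim: q z0 {sq} => [|y q IH]; first by exists [::].
      rewrite inE negb_or eq_sym => /andP[/nzP[u ->] /IH[t ->]].
      by exists (u :: t).
    rewrite (_ : symb s _ = \prod_(a <- t) sg a) //.
    elim: t {z0 sq} => [|u t IH]; first by rewrite symb_nil big_nil.
    by rewrite /= symb_cons big_cons IH /s ext0E.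
  case: q sq => [|a [|b q]] sq; [by move: sq => /=; lia | by move: sq => /=; lia|].
  have [->|a0] := eqVneq a 0; first by rewrite symb_cons rels0 mul0r mulr0.
  have [->|b0] := eqVneq b 0; first by rewrite !symb_cons rels0 mul0r !mulr0.
  rewrite (_ : _ * _ = eta ^+ j * symb s (a * b :: q) +
      (eta ^+ j * symb s (a :: q) + eta ^+ j * symb s (b :: q))).
    by apply: (PD); [|apply: PD]; apply: IH; move: sq => /=; lia.
  have E : eta * s a * s b = s (a * b) + (s a + s b).
    by rewrite relsM // addrC addrA (addBB relcom_two) add0r.
  rewrite -!mulrDr !symb_cons -!mulrDl -E exprS; ring.
elim=> [|u v _ hu _ hv|j q _ e] //; first exact: PD.
by apply: main; move: e; rewrite -PoszD => -[->].
Qed.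

Variable g : R -> W F.
Hypotheses (gB : zmod_morphism g) (gM : monoid_morphism g)
  (g_sg : forall a, g (sg a) = pfister a) (g_et : g et = 1).

Lemma witthom0 : g 0 = 0. Proof. by have := gB 0 0; rewrite !subrr. Qed.
Lemma witthomD u v : g (u + v) = g u + g v.
Proof.
have gN w : g (- w) = - g w by have := gB 0 w; rewrite witthom0 !sub0r.
by rewrite -{1}[v]opprK gB gN opprK.
Qed.

Lemma witthom_symb q : g (symb s q : R) = symb (ext0 (@pfister F)) q.
Proof.
have [g1 gMM] := gM; elim: q => [|a q IH]; first by rewrite !symb_nil.
rewrite !symb_cons -IH; apply: (etrans (gMM _ _)); congr (_ * _).
have [->|/nzP[u ->]] := eqVneq a 0; first by rewrite rels0 ext0_0; exact: witthom0.
by rewrite /s !ext0E g_sg.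
Qed.

Lemma witthom_eta x : g (et * x) = g x.
Proof. by case: gM => _ gMM; rewrite gMM g_et mul1r. Qed.

(** Up to factors eta, which become 1 in W(F), each term is a product of at least k + 1 Pfister
    forms, hence of more commutators than an operator of order [k] survives. *)
Lemma psiW_high k f n x : sqlin f -> dord k f -> (n = k.+1%:Z) ->
  symspan s eta (fun=> True) n x -> psiW f (g (x : R)) = 0.
Proof.
move=> hf hk ->; elim=> [|u v _ hu _ hv|j q _ e].
- by rewrite witthom0 psiW0.
- by rewrite [g _]witthomD psiWD // hu hv addr0.
have -> : g (eta ^+ j * symb s q : relcom) = g (symb s q : R).
  elim: j {e} => [|j IH]; first by rewrite expr0 mul1r.
  by rewrite exprS -mulrA -IH; exact: witthom_eta.
rewrite witthom_symb.
have [z0|z0] := boolP (0 \in q).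
  rewrite (_ : symb _ q = 0) ?psiW0 //; elim: q z0 {e} => // y q IH.
  rewrite inE symb_cons => /orP[/eqP <-|/IH ->]; last by rewrite mulr0.
  by rewrite ext0_0 mul0r.
have hq : {in q, forall y, y != 0} by move=> y yq; apply: contraNneq z0 => <-.
rewrite psiW_symbol //; apply: (@adl_dord _ _ (k + j)) => //;
  last by move: e; rewrite -PoszD => -[->]; rewrite addSn.
by elim: j {e} => [|j IH]; rewrite ?addn0 // addnS; exact: dordS.
Qed.

Lemma rel_inj_fld xs m x : indep xs -> symspan s eta (fld xs) m%:Z x -> g (x : R) = 0 ->
  x = 0.
Proof.
(* Dividing by eta raises the degree, so the induction is on its distance to the height of the
   tower. *)
move=> ix; have [N hN] := ubnP ((size xs).+1 - m); elim: N m x hN => // N IH m x hN hx gx.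
have [mx|mx] := ltnP (size xs) m.
  apply: (symspan_fld0 two0 relcom_two rels0 relsM rels_sqr rels_st _ hx); lia.
have hZ b q y : adapted xs b q -> size q = m -> maskspan s eta xs (maskval b) m y ->
    ~ g (symb s q + y : relcom) = 0.
  move=> hq sq Uy gz; have [f [lf of_ nf zf]] := detect two0 ix (adapted_size hq).1.
  have cb : count id b = m by rewrite -(adapted_size hq).2.
  rewrite cb in of_ zf.
  have fU z : maskspan s eta xs (maskval b) m z -> psiW f (g (z : R)) = 0.
    elim=> [|u v _ hu _ hv|w h|b' q' hq' bb sq'].
    - by rewrite witthom0 psiW0.
    - by rewrite [g _]witthomD psiWD // hu hv addr0.
    - rewrite [g _]witthom_eta; apply: (@psiW_high m _ m.+1%:Z) => //.
      by apply: symspan_sub h.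
    rewrite witthom_symb psiW_symbol //; [exact: zf hq' bb sq' | exact: adapted_neq0 hq'].
  have e : g (symb s q + y : relcom) = symb (ext0 (@pfister F)) q + g (y : R).
    by apply: (etrans (witthomD _ _)); rewrite witthom_symb.
  move: gz; rewrite e => /(congr1 (psiW f)); rewrite psiWD // (fU y Uy) addr0 psiW0 //.
  rewrite psiW_symbol //; last exact: adapted_neq0 hq.
  by apply/eqP; exact: nf.
have Ux := symspan_maskspan two0 relcom_two rels0 relsM rels_sqr rels_st ix hx.
have [w hw xw] : exists2 w, symspan s eta (fld xs) m.+1%:Z w & x = eta * w.
  apply: (@maskspan_descend _ _ s eta two0 relcom_two rels0 relsM rels_sqr rels_st
    (fun z => g (z : R) = 0)).
  - exact: ix.
  - exact: hZ.
  - exact: gx.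
  exact: Ux.
rewrite xw (IH m.+1 w) ?mulr0 //; first by lia.
by rewrite -gx xw; apply/esym/witthom_eta.
Qed.

Lemma rel_inj n x : wspan n x -> g x = 0 -> x = 0.
Proof.
move/wspan_symspan; rewrite -/(symspan s eta _ _ (x : relcom)).
have main m y : symspan s eta (fun=> True) m%:Z y -> g (y : R) = 0 -> y = 0.
  move=> /symspan_cover[t _ ht]; have [xs ix /ht] := indep_cover two0 t.
  exact: rel_inj_fld.
case: n => [n|n]; first exact: main.
(* In negative degree x = eta w, and [g] takes the same value on [w] as on [x]. *)
rewrite NegzE; elim: n x => [|n IH] x hx gx.
  have [w hw xw] := symspan_eta_factor (isT : - 1%:Z < 0) hx.
  rewrite xw (main 0%N w) ?mulr0 // -gx xw; apply/esym/witthom_eta.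
have [w hw xw] := symspan_eta_factor (isT : - (n.+2)%:Z < 0) hx.
rewrite xw (IH w) ?mulr0 //; last by rewrite -gx xw; apply/esym/witthom_eta.
by move: hw; rewrite (_ : - n.+2%:Z + 1 = - n.+1%:Z) //; lia.
Qed.
End Relations.

(** * The isomorphism *)

Section WittK.
Variable F : fieldType.

Definition kpi (p : KMWfree F) : KW F := qpi (fun t => t = KMWh F) (qpi (@KMWrel F) p).

Lemma kpiB p q : kpi (p - q) = kpi p - kpi q.
Proof. by rewrite /kpi raddfB; exact: raddfB. Qed.
Lemma kpi0 : kpi 0 = 0.
Proof. by rewrite -(subrr 0) kpiB subrr. Qed.
Lemma kpiD p q : kpi (p + q) = kpi p + kpi q.
Proof. by rewrite -{1}[q]opprK -[- q]sub0r !kpiB kpi0 sub0r opprK. Qed.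
Lemma kpiM p q : kpi (p * q) = kpi p * kpi q.
Proof. by rewrite /kpi rmorphM; exact: rmorphM. Qed.
Lemma kpi1 : kpi 1 = 1.
Proof. by rewrite /kpi rmorph1; exact: rmorph1. Qed.
Lemma kpi_rel p : KMWrel p -> kpi p = 0.
Proof.
move=> hp; rewrite /kpi (_ : qpi _ p = 0); first exact: raddf0.
by apply/qpi_eq0; exact: idealgen_sub.
Qed.
Lemma kpi_sym a : kpi (Defs.fsym a) = KWsym a. Proof. by []. Qed.

Lemma kpi_word (w : seq (KMWgen F)) :
  kpi (\prod_(x <- w) << fmu x >>) = wordval (rgen (@KWsym F) (KWeta F)) w.
Proof.
rewrite /wordval; elim: w => [|x w IH]; first by rewrite !big_nil kpi1.
by rewrite !big_cons kpiM IH; case: x.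
Qed.

Lemma KW_st a (h : val a != 1) : KWsym a * KWsym (nz1B h) = 0 :> KW F.
Proof. by rewrite -!kpi_sym -kpiM; apply: kpi_rel; exact: KMW_steinberg. Qed.

Lemma KW_tw (a b : nz F) :
  KWsym (nzM a b) = KWsym a + KWsym b + KWeta F * KWsym a * KWsym b.
Proof.
have := kpi_rel (KMW_twist a b); rewrite kpiB => /eqP; rewrite subr_eq0 => /eqP h.
apply: (etrans (esym (kpi_sym (nzM a b)))); apply: (etrans h).
by rewrite kpiD (kpiD (Defs.fsym a)) kpiM (kpiM (@feta F)).
Qed.

Lemma KW_etaC (u : nz F) : KWeta F * KWsym u = KWsym u * KWeta F.
Proof.
have := kpi_rel (KMW_etaC u); rewrite kpiB => /eqP; rewrite subr_eq0 => /eqP h.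
by apply: (etrans (esym (kpiM (@feta F) (Defs.fsym u)))); apply: (etrans h); exact: kpiM.
Qed.

Lemma KW_h : KWeta F * KWsym (nzN (nz1 F)) + 2%:R = 0.
Proof.
have -> : KWeta F * KWsym (nzN (nz1 F)) + 2%:R = qpi (fun t => t = KMWh F) (KMWh F).
  by rewrite /KMWh rmorphD rmorphM rmorph_nat.
by apply/qpi_eq0; exact: idealgen_sub.
Qed.

Lemma KW_gen (P : KW F -> Prop) : P 0 -> (forall u v, P u -> P v -> P (u - v)) ->
  (forall w, P (wordval (rgen (@KWsym F) (KWeta F)) w)) -> forall x, P x.
Proof.
move=> P0 PB Pw; elim/qpiW=> y; elim/qpiW: y => p; rewrite -/(kpi p).
apply: (@free_span F (fun p => P (kpi p))).
- by rewrite kpi0.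
- by move=> u v hu hv; rewrite kpiB; exact: PB.
- by move=> w _; rewrite kpi_word.
Qed.

Lemma KW_deg_wspan n (x : KW F) : gr_deg n x -> wspan (@KWsym F) (KWeta F) n x.
Proof.
move=> [_ [p hp ->] ->]; rewrite -/(kpi p).
apply: (@free_span F (fun p => wspan _ _ n (kpi p))).
- rewrite kpi0; exact: wspan0.
- by move=> u v hu hv; rewrite kpiB; exact: wspanB.
- by move=> w wp; rewrite kpi_word; apply: wspanW; exact: (hp w wp).
Qed.
End WittK.

Lemma twist_expand (R : comPzRingType) (x y : R) : (forall z : R, z + z = 0) ->
  1 + x * y = 1 + x + (1 + y) + 1 * (1 + x) * (1 + y).
Proof.
move=> h; rewrite [RHS](_ : _ = 1 + x * y + ((1 + x + y) + (1 + x + y))); last by ring.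
by rewrite h addr0.
Qed.

Section Final.
Variable F : fieldType.
Hypothesis two0 : 2%:R = 0 :> F.

Lemma W_st (a : nz F) (h : val a != 1) : pfister a * pfister (nz1B h) = 0.
Proof. by apply: (pfister_steinberg two0); rewrite /= addrC subrK. Qed.

Lemma W_tw (a b : nz F) :
  pfister (nzM a b) = pfister a + pfister b + 1 * pfister a * pfister b.
Proof.
rewrite !(pfisterE2 two0) -(twist_expand _ _ (WDD two0)); congr (1 + _).
by rewrite /Wline -GWlineM; exact: (rmorphM (qpi _)).
Qed.

Lemma W_h : 1 * pfister (nzN (nz1 F)) + 2%:R = 0.
Proof.
rewrite mul1r !(nzN_id two0) (pfisterE2 two0) /Wline (GWline1 F) (rmorph1 (qpi _)).
by rewrite mulr2n !(WDD two0).
Qed.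

Definition mon (n : int) (w : W F) (x : Istar F) : Prop := Istar_val x = << w *g n >>.

Lemma mon0 n : mon n 0 0.
Proof. by rewrite /mon Istar_val0 monalgU0. Qed.
Lemma monB n v w x y : mon n v x -> mon n w y -> mon n (v - w) (x - y).
Proof. by rewrite /mon Istar_valB => -> ->; rewrite monalgUB. Qed.
Lemma monM m n v w x y : mon m v x -> mon n w y -> mon (m + n) (v * w) (x * y).
Proof. by rewrite /mon Istar_valM => -> ->; exact: lmulUU. Qed.
Lemma mon1 : mon 0 1 1. Proof. exact: Istar_val1. Qed.
Lemma mon_pfister a : mon 1 (pfister a) (Istar_pfister a). Proof. by []. Qed.
Lemma mon_eta : mon (- 1) 1 (Istar_eta F).
Proof. by rewrite /mon /= (WN two0). Qed.
Lemma monD n v w x y : mon n v x -> mon n w y -> mon n (v + w) (x + y).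
Proof.
move=> hx hy; rewrite -(WN two0 w) -[y]opprK -[- y]sub0r.
apply: monB => //; rewrite -[w]opprK -(sub0r (- w)) (WN two0 w).
by apply: monB => //; exact: mon0.
Qed.
Lemma mon_inj n w x y : mon n w x -> mon n w y -> x = y.
Proof. by rewrite /mon => hx hy; apply/val_inj; rewrite /= hx hy. Qed.
Lemma mon_deg n w x : mon n w x -> gr_deg n x.
Proof. by move=> hx m mn; rewrite hx mcoeffU eq_sym (negPf mn). Qed.
Lemma deg_mon n (x : Istar F) : gr_deg n x -> exists w, mon n w x.
Proof.
move=> hx; exists (Istar_val x)@_n; apply/malgP=> m; rewrite mcoeffU.
by have [->|nm] := eqVneq n m; rewrite ?mulr1n // mulr0n; apply: hx; rewrite eq_sym.
Qed.

Lemma Istar_st (a : nz F) (h : val a != 1) :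
  Istar_pfister a * Istar_pfister (nz1B h) = 0.
Proof.
apply: (@mon_inj (1 + 1) 0); last exact: mon0.
by rewrite -(W_st h); apply: monM; exact: mon_pfister.
Qed.

Lemma Istar_tw (a b : nz F) : Istar_pfister (nzM a b) = Istar_pfister a +
  Istar_pfister b + Istar_eta F * Istar_pfister a * Istar_pfister b.
Proof.
apply: (@mon_inj 1 (pfister (nzM a b))); first exact: mon_pfister.
rewrite W_tw; apply: monD; first by apply: monD; exact: mon_pfister.
exact: (monM (monM mon_eta (mon_pfister a)) (mon_pfister b)).
Qed.

Lemma Istar_etaC (u : nz F) :
  Istar_eta F * Istar_pfister u = Istar_pfister u * Istar_eta F.
Proof.
apply: (@mon_inj 0 (pfister u)).
  by rewrite -[pfister u]mul1r; exact: (monM mon_eta (mon_pfister u)).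
by rewrite -[pfister u]mulr1; exact: (monM (mon_pfister u) mon_eta).
Qed.

Lemma Istar_h : Istar_eta F * Istar_pfister (nzN (nz1 F)) + 2%:R = 0.
Proof.
apply: (@mon_inj 0 0); last exact: mon0.
rewrite -W_h mulr2n; apply: monD; first exact: (monM mon_eta (mon_pfister _)).
by apply: monD; exact: mon1.
Qed.

Notation phi := (rgen (@KWsym F) (KWeta F)).

Section Hom.
Variable f : KW F -> Istar F.
Hypotheses (fB : zmod_morphism f) (fM : monoid_morphism f)
  (f_sym : forall a, f (KWsym a) = Istar_pfister a) (f_eta : f (KWeta F) = Istar_eta F).

Variable g : KW F -> W F.
Hypotheses (gB : zmod_morphism g) (gM : monoid_morphism g)
  (g_sym : forall a, g (KWsym a) = pfister a) (g_eta : g (KWeta F) = 1).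

(** [g] is [f] with the grading forgotten; this transfers the injectivity of [g] in each degree to
    [f]. *)
Lemma hom_mon n x : wspan (@KWsym F) (KWeta F) n x -> mon n (g x) (f x).
Proof.
have [f1 fMM] := fM; have [g1 gMM] := gM.
elim=> [|u v _ hu _ hv|w <-].
- have -> : f 0 = 0 by have := fB 0 0; rewrite !subrr.
  have -> : g 0 = 0 by have := gB 0 0; rewrite !subrr.
  exact: mon0.
- by rewrite fB gB; exact: monB.
rewrite /wordval; elim: w => [|x0 w IH]; first by rewrite !big_nil f1 g1; exact: mon1.
rewrite !big_cons fMM gMM; apply: monM => //.
case: x0 => [a|]; rewrite /= ?f_sym ?g_sym ?f_eta ?g_eta; [exact: mon_pfister|exact: mon_eta].
Qed.

Lemma hom_sum (T : Type) (r : seq T) (G : T -> KW F) :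
  f (\sum_(i <- r) G i) = \sum_(i <- r) f (G i).
Proof.
have f0 : f 0 = 0 by have := fB 0 0; rewrite !subrr.
apply: (big_morph f _ f0) => x y.
have fN c : f (- c) = - f c by have := fB 0 c; rewrite f0 !sub0r.
by rewrite -{1}[y]opprK fB fN opprK.
Qed.

Lemma hom_deg_inj n x : gr_deg n x -> f x = 0 -> x = 0.
Proof.
move=> /KW_deg_wspan hx fx.
apply: (rel_inj two0 (@KW_st F) (@KW_tw F) (@KW_etaC F) (@KW_h F) (@KW_gen F) gB gM g_sym g_eta hx).
have := hom_mon hx; rewrite /mon fx Istar_val0 => /(congr1 (mcoeff n)).
by rewrite mcoeff0 mcoeffUU.
Qed.

Lemma hom_inj x : f x = 0 -> x = 0.
Proof.
move=> fx; have [_ _ dec _] := gr_axiom (KW F).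
have [s [y [hy xE]]] := dec x.
(* The decomposition may list a degree several times; [z] collects its terms. *)
pose z n := y n *+ count_mem n s.
have zE : x = \sum_(n <- undup s) z n.
  rewrite xE -big_undup_iterop_count /=; apply: eq_bigr => n _.
  rewrite Monoid.iteropE /z; elim: (count _ s) => [|k IH] //=.
  by rewrite mulrS IH.
have hz n : gr_deg n (z n).
  rewrite /z; elim: (count _ s) => [|k IH]; first exact: (gr0 (gr_axiom (KW F))).
  by rewrite mulrS; exact: (grD (gr_axiom (KW F))).
have [_ _ _ uni] := gr_axiom (Istar F).
have fz n : n \in undup s -> f (z n) = 0.
  apply: (uni (undup s) (fun m => f (z m))); first exact: undup_uniq.
    by move=> m; exact: mon_deg (hom_mon (KW_deg_wspan (hz m))).
  by rewrite -hom_sum -zE.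
rewrite zE big_seq big1 // => n ns; exact: hom_deg_inj (hz n) (fz n ns).
Qed.

Definition img (n : int) (w : W F) : Prop := exists2 x : KW F, gr_deg n x & mon n w (f x).

Lemma img_gen n x : gr_deg n x -> img n (g x).
Proof. by move=> hx; exists x => //; apply/hom_mon/KW_deg_wspan. Qed.

Lemma img0 n : img n 0.
Proof.
have -> : 0 = g 0 by have := gB 0 0; rewrite !subrr.
exact/img_gen/(gr0 (gr_axiom (KW F))).
Qed.

Lemma imgD n v w : img n v -> img n w -> img n (v + w).
Proof.
move=> [x hx fx] [y hy fy]; exists (x - y); first exact: (grB (gr_axiom (KW F))).
by rewrite fB -(WN two0 w); exact: monB.
Qed.

Lemma imgM m n v w : img m v -> img n w -> img (m + n) (v * w).
Proof.
move=> [x hx fx] [y hy fy]; exists (x * y); first exact: (grM (gr_axiom (KW F))).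
by case: fM => _ ->; exact: monM.
Qed.

Lemma img_pfister a : img 1 (pfister a).
Proof. by rewrite -g_sym; apply: img_gen; exact: KWsym_deg. Qed.

Lemma img_eta : img (- 1) 1.
Proof. by rewrite -g_eta; apply: img_gen; exact: KWeta_deg. Qed.

Lemma img1 : img 0 1.
Proof. by case: gM => <- _; apply: img_gen; exact: (gr1 (gr_axiom (KW F))). Qed.

(** The line <a> = 1 + <<a>> comes from 1 + eta [a]. *)
Lemma img_W w : img 0 w.
Proof.
elim/(W_span two0): w => [|u v|a]; [exact: img0 | exact: imgD |].
have -> : Wline a = 1 + 1 * pfister a.
  by rewrite mul1r (pfisterE2 two0) addrA (WDD two0) add0r.
by apply: imgD; [exact: img1 | exact: (imgM img_eta (img_pfister a))].
Qed.

(** Multiplication by eta carries all of W(F) from degree 0 to the negative degrees; in positive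
    degrees I(F) is spanned by Pfister forms. *)
Lemma img_Ipow n w : Ipow n w -> img n w.
Proof.
case: n => n /=; last first.
  move=> _; rewrite NegzE; elim: n => [|n IH].
    by rewrite -[w]mul1r; exact: (imgM img_eta (img_W w)).
  rewrite -[w]mul1r (_ : - n.+2%:Z = - 1 + - n.+1%:Z); last by lia.
  exact: (imgM img_eta IH).
elim: n w => [|n IH] w; first by move=> _; exact: img_W.
elim=> [|x y z hx hy _ hz]; first exact: img0.
apply: imgD => //; rewrite intS; apply: imgM; last exact: IH.
have [t ->] := fundI_span two0 hx.
by elim/big_ind: _ => [|u v|a _]; [exact: img0 | exact: imgD | exact: img_pfister].
Qed.

Lemma hom_surj y : exists x, f x = y.
Proof.
have /choice[x hx] : forall n, exists x, mon n (Istar_val y)@_n (f x).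
  move=> n; have [|x _ hx] := @img_Ipow n (Istar_val y)@_n; last by exists x.
  by have /Istar_predP := valP y.
exists (\sum_(n <- msupp (Istar_val y)) x n); apply/val_inj.
rewrite hom_sum [LHS]Istar_val_sum [RHS]/= [RHS]monalgE; apply: eq_bigr => n _.
exact: hx.
Qed.

Lemma hom_graded_iso : graded_iso f.
Proof.
have inj : injective f.
  by move=> x y e; apply/eqP; rewrite -subr_eq0; apply/eqP/hom_inj; rewrite fB e subrr.
split=> //.
  have /choice[h hK] := hom_surj.
  by exists h => // x; apply: inj; rewrite hK.
move=> n x; split=> [hx|/deg_mon[w hw]]; first exact: mon_deg (hom_mon (KW_deg_wspan hx)).
(* f x has a preimage of degree [n], which is [x] by injectivity. *)
have [|x' hx' fx'] := @img_Ipow n w.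
  have <- : (Istar_val (f x))@_n = w by move: hw; rewrite /mon => ->; rewrite mcoeffUU.
  by have /Istar_predP := valP (f x : Istar_ring F).
by rewrite (inj x x') //; exact: mon_inj hw fx'.
Qed.
End Hom.
End Final.

(** In degrees at most 0 uniqueness involves the value at eta: if I^2(F) = 0 and c = 1 + i with i in
    I(F), then c^2 = 1, and multiplication by c^n in each degree n is an automorphism of the graded
    ring of the I^n(F) that fixes the Pfister forms in degree 1 but moves eta when i is nonzero. *)
Theorem theorem3p1 (F : fieldType) (charF : 2%N \in [pchar F]) :
  (exists! f : KW F -> Istar F,
     [/\ graded_iso f,
         forall a : nz F, f (KWsym a) = Istar_pfister a
       & f (KWeta F) = Istar_eta F])
  /\
  (forall f g : KW F -> Istar F,
     graded_iso f -> (forall a : nz F, f (KWsym a) = Istar_pfister a) ->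
     graded_iso g -> (forall a : nz F, g (KWsym a) = Istar_pfister a) ->
     forall (n : int) (x : KW F), 0 < n -> gr_deg n x -> f x = g x).
Proof.
have two0 : 2%:R = 0 :> F := pcharf0 charF.
split.
  have [f [fB fM fs fe]] := KW_universal (Istar_st two0) (Istar_tw two0)
    (Istar_etaC two0) (Istar_h two0).
  have comm (a : nz F) : 1 * pfister a = pfister a * 1 by rewrite mul1r mulr1.
  have [g [gB gM gs ge]] := KW_universal (W_st two0) (W_tw two0) comm (W_h two0).
  exists f; split; first by split=> //; exact: hom_graded_iso gB gM gs ge.
  move=> f' [[f'B [f'1 f'M] _ _] f's f'e]; apply/funext=> x; have [f1 fMM] := fM.
  elim/KW_gen: x => [|u v hu hv|w]; last 1 first.
  - rewrite /wordval; elim: w => [|[a|] w IH]; first by rewrite !big_nil f1 f'1.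
      by rewrite !big_cons fMM f'M IH /= fs f's.
    by rewrite !big_cons fMM f'M IH /= fe f'e.
  - by have := fB 0 0; have := f'B 0 0; rewrite !subrr => -> ->.
  - by rewrite fB f'B hu hv.
(* In positive degree [x] is a sum of products of symbols [a], on which [f] and [g] agree. *)
move=> f g [fB [f1 fM] _ _] fs [gB [g1 gM] _ _] gs [[|n]|//] x // _ /KW_deg_wspan.
have f0 : f 0 = 0 by have := fB 0 0; rewrite !subrr.
have g0 : g 0 = 0 by have := gB 0 0; rewrite !subrr.
apply: (wspan_pos two0 (@KW_st F) (@KW_tw F) (@KW_etaC F) (@KW_h F) (@KW_gen F)
  (P := fun y => f y = g y)).
- by rewrite f0 g0.
- move=> u v hu hv; rewrite -[v]opprK fB gB hu; congr (_ - _).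
  by rewrite -[- v]sub0r fB gB hv f0 g0.
- by elim=> [|a t IH]; rewrite ?big_nil ?f1 ?g1 // !big_cons fM gM IH fs gs.
Qed.
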